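(* Let $T>0$, $d,r\in\mathbb{N}$ with $d,r\ge 1$, $\bar m_0\in\mathcal{P}_2(\mathbb{R}^d)$, and let $b: C([0,T];\mathcal{P}_1(\mathbb{R}^d))\times\mathbb{R}^d\times[0,T]\to\mathbb{R}^d$ and $\sigma: C([0,T];\mathcal{P}_1(\mathbb{R}^d))\times\mathbb{R}^d\times[0,T]\to\mathbb{R}^{d\times r}$ satisfy: (i) $b$ and $\sigma$ are continuous; (ii) there exists $C>0$ such that $|b[\mu](x,t)|+|\sigma[\mu](x,t)|\le C(1+|x|)$ for all $\mu\in C([0,T];\mathcal{P}_1(\mathbb{R}^d))$, $x\in\mathbb{R}^d$, $t\in[0,T]$; (iii) for every $\mu\in C([0,T];\mathcal{P}_1(\mathbb{R}^d))$ and every compact $K\subseteq\mathbb{R}^d$ there exists $C_K>0$ such that $|b[\mu](y,t)-b[\mu](x,t)|+|\sigma[\mu](y,t)-\sigma[\mu](x,t)|\le C_K|y-x|$ for all $x,y\in K$, $t\in[0,T]$. Let $N_n\in\mathbb{N}$ with $N_n\to\infty$, $h_n:=T/N_n$, and let $\rho_n>0$ with $\rho_n\to0$ and $\rho_n^2=o(h_n)$. For each $n$ let $m^n\in\mathcal{S}^{\rho_n,h_n}$ be a solution of the fully discrete scheme (S) with $\rho=\rho_n$, $h=h_n$, and denote also by $m^n\in C([0,T];\mathcal{P}_1(\mathbb{R}^d))$ its time-interpolated extension. Then the sequence $(m^n)$ has at least one limit point in $C([0,T];\mathcal{P}_1(\mathbb{R}^d))$, and every limit point $m$ of $(m^n)$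 solves the nonlinear Fokker-Planck-Kolmogorov equation (FPK) with initial condition $\bar m_0$. In particular, (FPK) admits at least one solution.
   Context: Notation. $\mathcal{P}_p(\mathbb{R}^d)$ is the set of Borel probability measures on $\mathbb{R}^d$ with finite $p$-th moment, endowed with the $p$-Wasserstein distance $d_p$. $C([0,T];\mathcal{P}_1(\mathbb{R}^d))$ is the space of continuous maps $[0,T]\to(\mathcal{P}_1(\mathbb{R}^d),d_1)$ with the topology of uniform convergence. Write $b[\mu](x,t)=b(\mu,x,t)$, $\sigma[\mu](x,t)=\sigma(\mu,x,t)$, $\sigma_\ell$ for the $\ell$-th column of $\sigma$ ($\ell=1,\dots,r$), and $a_{i,j}=\sum_{k=1}^r\sigma_{ik}\sigma_{jk}$. (FPK). Formally, $\partial_t m-\frac12\sum_{1\le i,j\le d}\partial^2_{x_i,x_j}(a_{i,j}[m](x,t)m)+\mathrm{div}(b[m](x,t)m)=0$, $m(0)=\bar m_0$. A solution is an $m\in C([0,T];\mathcal{P}_1(\mathbb{R}^d))$ such that for all $t\in[0,T]$ and all $\varphi\in C_0^\infty(\mathbb{R}^d)$ (smooth with compact support), $$\int\varphi\,dm(t)=\int\varphi\,d\bar m_0+\int_0^t\!\!\int_{\mathbb{R}^d}\Big[b[m](x,s)\cdot\nabla\varphi(x)+\tfrac12\sum_{i,j}a_{i,j}[m](x,s)\partial^2_{x_i,x_j}\varphi(x)\Big]dm(s)(x)\,ds.$$ Discretization. Given $\rho>0$ and $h=T/N$ ($N\in\mathbb{N}$), let $t_k=kh$ ($k=0,\dots,N$),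 $x_i=i\rho$ for $i\in\mathbb{Z}^d$, $\mathcal{G}_\rho=\{x_i\,;\,i\in\mathbb{Z}^d\}$, and let $(\beta_i)_{i\in\mathbb{Z}^d}$ be the $\mathbb{Q}_1$ finite element basis on the uniform grid: $\beta_i(x)=\prod_{l=1}^d\max\{1-|x^l-x_i^l|/\rho,0\}$ (so $0\le\beta_i\le1$, $\sum_i\beta_i=1$, $\beta_i(x_j)=\delta_{ij}$). Let $E_i=\{x\in\mathbb{R}^d\,;\,|x-x_i|_\infty\le\rho/2\}$; it is assumed that $\bar m_0(\partial E_i)=0$ for all $i\in\mathbb{Z}^d$ (for every space step used). $\mathcal{S}^{\rho,h}$ is the set of families $(\mu_{i,k})_{i\in\mathbb{Z}^d,\,k=0,\dots,N}$ with $\mu_{i,k}\ge0$, $\sum_i\mu_{i,k}=1$ and $\sum_i|x_i|\mu_{i,k}<\infty$ for all $k$. An element $\mu\in\mathcal{S}^{\rho,h}$ is extended to an element of $C([0,T];\mathcal{P}_1(\mathbb{R}^d))$, still denoted $\mu$, by $$\mu(t)=\frac{t-t_k}{h}\sum_{i}\mu_{i,k+1}\delta_{x_i}+\frac{t_{k+1}-t}{h}\sum_i\mu_{i,k}\delta_{x_i},\quad t\in[t_k,t_{k+1}],\ k=0,\dots,N-1.$$ Scheme (S). For $\mu\in\mathcal{S}^{\rho,h}$ put $\Phi_{j,k}^{\ell,\pm}[\mu]=x_j+h\,b[\mu](x_j,t_k)\pm\sqrt{rh}\,\sigma_\ell[\mu](x_j,t_k)$. A solution of (S) is an $m\in\mathcal{S}^{\rho,h}$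 such that $m_{i,0}=\bar m_0(E_i)$ for all $i\in\mathbb{Z}^d$ and $$m_{i,k+1}=\frac1{2r}\sum_{\ell=1}^r\sum_{j\in\mathbb{Z}^d}\big[\beta_i(\Phi_{j,k}^{\ell,+}[m])+\beta_i(\Phi_{j,k}^{\ell,-}[m])\big]m_{j,k}\quad\forall i\in\mathbb{Z}^d,\ k=0,\dots,N-1.$$ Under (i)-(ii) such a solution exists for every $\rho,h$. *)

(* Defs.v *)
From HB Require Import structures.
From mathcomp Require Import all_boot all_order all_algebra.
From mathcomp Require Import all_classical all_reals all_analysis.

Set Implicit Arguments.
Unset Strict Implicit.
Unset Printing Implicit Defensive.

Import Order.TTheory GRing.Theory Num.Theory.
Import numFieldNormedType.Exports.

Local Open Scope classical_set_scope.
Local Open Scope ring_scope.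

(* Euclidean norm of a row vector, Frobenius norm of a general matrix.  The
   norm `|_| which the library puts on matrices is the sup norm. *)
Definition enorm (R : realType) (m n : nat) (A : 'M[R]_(m, n)) : R :=
  Num.sqrt (\sum_(i < m) \sum_(j < n) A i j ^+ 2).

Definition Borel (R : realType) (d : nat) :=
  g_sigma_algebraType (@open 'rV[R]_d).

(* P_p(R^d) *)
Record wprob (R : realType) (d p : nat) := WProb {
  law :> probability (Borel R d) R ;
  law_moment : (\int[law]_x (enorm (x : 'rV[R]_d) ^+ p)%:E < +oo)%E }.

Definition coupling (R : realType) (d : nat) (mu nu : probability (Borel R d) R)
    (pi : probability (Borel R d * Borel R d)%type R) : Prop :=
  forall A : set (Borel R d), measurable A ->
    pi (A `*` setT) = mu A /\ pi (setT `*` A) = nu A.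

(* The 1-Wasserstein distance d_1. *)
Definition wass1 (R : realType) (d : nat) (mu nu : wprob R d 1) : \bar R :=
  ereal_inf [set (\int[pi]_z (enorm ((z.1 : 'rV[R]_d) - (z.2 : 'rV[R]_d)))%:E)%E
            | pi in [set pi | coupling mu nu pi]].

(* Open sets of the topology induced by a distance. *)
Section dist_open.
Context {R : realType} {X : Type} (dist : X -> X -> \bar R).

Definition dist_open : set_system X := [set U | forall x, U x ->
  exists2 e : R, 0 < e & forall y, (dist x y < e%:E)%E -> U y].

Lemma dist_openT : dist_open setT.
Proof. by move=> x _; exists 1. Qed.

Lemma dist_openI : setI_closed dist_open.
Proof.
move=> U V oU oV x [/oU[e e0 eU] /oV[f f0 fV]].
exists (Order.min e f) => [|y]; first by rewrite lt_min e0.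
by rewrite EFin_min lt_min => /andP[/eU Uy /fV Vy].
Qed.

Lemma dist_open_bigU (I : Type) (F : I -> set X) :
  (forall i, dist_open (F i)) -> dist_open (\bigcup_i F i).
Proof.
move=> oF x [i _ /oF[e e0 eF]]; exists e => // y /eF Fy.
by exists i.
Qed.

End dist_open.

HB.instance Definition _ (R : realType) (d p : nat) :=
  gen_eqMixin (wprob R d p).
HB.instance Definition _ (R : realType) (d p : nat) :=
  gen_choiceMixin (wprob R d p).
HB.instance Definition _ (R : realType) (d : nat) :=
  isOpenTopological.Build (wprob R d 1)
    (dist_openT (@wass1 R d)) (@dist_openI _ _ (@wass1 R d))
    (@dist_open_bigU _ _ (@wass1 R d)).

(* C([0,T]; P_1(R^d)).  A curve is represented by a function on R whose values
   outside [0,T] are irrelevant: curves which agree on [0,T] are at distance 0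
   for [curve_dist], hence are topologically indistinguishable. *)
Record curve (R : realType) (d : nat) (T : R) := Curve {
  curve_fun :> R -> wprob R d 1 ;
  curve_cont : {within `[0, T], continuous curve_fun} }.

Definition curve_dist (R : realType) (d : nat) (T : R) (mu nu : curve d T) :
    \bar R :=
  ereal_sup [set wass1 (mu t) (nu t) | t in `[0, T]].

HB.instance Definition _ (R : realType) (d : nat) (T : R) :=
  gen_eqMixin (curve d T).
HB.instance Definition _ (R : realType) (d : nat) (T : R) :=
  gen_choiceMixin (curve d T).
HB.instance Definition _ (R : realType) (d : nat) (T : R) :=
  isOpenTopological.Build (curve d T)
    (dist_openT (@curve_dist R d T)) (@dist_openI _ _ (@curve_dist R d T))
    (@dist_open_bigU _ _ (@curve_dist R d T)).

Section test_functions.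
Context {R : realType} {d : nat}.

Definition partial (i : 'I_d) (f : 'rV[R]_d -> R) : 'rV[R]_d -> R :=
  fun x => 'D_(delta_mx 0 i) f x.

Definition smooth (f : 'rV[R]_d -> R) : Prop :=
  forall s : seq 'I_d, let g := foldr partial f s in
    continuous g /\ forall i x, derivable g x (delta_mx 0 i).

Definition test_function (f : 'rV[R]_d -> R) : Prop :=
  smooth f /\ compact (closure [set x | f x != 0]).

End test_functions.

Section FPK.
Context {R : realType} {d r : nat} {T : R}.
Context (b : curve d T -> 'rV[R]_d -> R -> 'rV[R]_d).
Context (sigma : curve d T -> 'rV[R]_d -> R -> 'M[R]_(d, r)).

Definition diffusion (m : curve d T) (x : 'rV[R]_d) (t : R) (i j : 'I_d) : R :=
  \sum_(k < r) sigma m x t i k * sigma m x t j k.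

Definition generator (m : curve d T) (phi : 'rV[R]_d -> R) (x : 'rV[R]_d)
    (s : R) : R :=
  \sum_(i < d) b m x s 0 i * partial i phi x +
  2^-1 * \sum_(i < d) \sum_(j < d)
    diffusion m x s i j * partial i (partial j phi) x.

Definition FPK_solution (m0 : probability (Borel R d) R) (m : curve d T) :
    Prop :=
  forall t : R, t \in `[0, T] ->
  forall phi : 'rV[R]_d -> R, test_function phi ->
    \int[m t]_x phi x =
      \int[m0]_x phi x +
      \int[lebesgue_measure]_(s in `[0, t]) (\int[m s]_x generator m phi x s).

End FPK.

Section scheme.
Context {R : realType} {d : nat}.

Definition grid (rho : R) (i : 'rV[int]_d) : 'rV[R]_d :=
  \row_l ((i 0 l)%:~R * rho).

Definition beta (rho : R) (i : 'rV[int]_d) (x : 'rV[R]_d) : R :=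
  \prod_(l < d) Num.max (1 - `|x 0 l - grid rho i 0 l| / rho) 0.

(* E_i: here `|_| is the sup norm. *)
Definition cell (rho : R) (i : 'rV[int]_d) : set 'rV[R]_d :=
  [set x | `|x - grid rho i| <= rho / 2].

Definition null_cell_boundaries (rho : R) (m0 : probability (Borel R d) R) :
    Prop :=
  forall i : 'rV[int]_d, m0 (closure (cell rho i) `\` (cell rho i)°) = 0%E.

(* The set S^{rho,h} with h = T / N; only the indices k <= N matter. *)
Definition grid_family (rho : R) (N : nat) (mu : 'rV[int]_d -> nat -> R) :
    Prop :=
  forall k, (k <= N)%N ->
    [/\ forall i, 0 <= mu i k,
        (\esum_(i in [set: 'rV[int]_d]) (mu i k)%:E = 1)%E &
        (\esum_(i in [set: 'rV[int]_d]) (enorm (grid rho i) * mu i k)%:E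
          < +oo)%E].

(* sum_i mu_{i,k} delta_{x_i} *)
Definition grid_measure (rho : R) (mu : 'rV[int]_d -> nat -> R) (k : nat)
    (A : set (Borel R d)) : \bar R :=
  (\esum_(i in [set: 'rV[int]_d])
     ((mu i k)%:E * \d_(grid rho i : Borel R d) A))%E.

(* m is the piecewise linear in time extension of mu. *)
Definition extension (T rho : R) (N : nat) (mu : 'rV[int]_d -> nat -> R)
    (m : curve d T) : Prop :=
  let h := T / N%:R in
  forall (k : nat) (t : R), (k < N)%N -> k%:R * h <= t <= k.+1%:R * h ->
  forall A : set (Borel R d), measurable A ->
    m t A = (((t - k%:R * h) / h)%:E * grid_measure rho mu k.+1 A +
             ((k.+1%:R * h - t) / h)%:E * grid_measure rho mu k A)%E.

Context {r : nat} {T : R}.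
Context (b : curve d T -> 'rV[R]_d -> R -> 'rV[R]_d).
Context (sigma : curve d T -> 'rV[R]_d -> R -> 'M[R]_(d, r)).

(* Phi^{l,+}_{j,k}[m] and Phi^{l,-}_{j,k}[m] are obtained with e = 1 and
   e = -1. *)
Definition Phi (rho : R) (N : nat) (m : curve d T) (e : R) (l : 'I_r)
    (j : 'rV[int]_d) (k : nat) : 'rV[R]_d :=
  let h := T / N%:R in
  let x := grid rho j in
  let t := k%:R * h in
  x + h *: b m x t + (e * Num.sqrt (r%:R * h)) *: (col l (sigma m x t))^T.

(* mu in S^{rho,T/N} solves the scheme and m is its extension. *)
Definition scheme_solution (m0 : probability (Borel R d) R) (rho : R) (N : nat)
    (mu : 'rV[int]_d -> nat -> R) (m : curve d T) : Prop :=
  [/\ grid_family rho N mu,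
      extension rho N mu m,
      forall i, (mu i 0)%:E = m0 (cell rho i) &
      forall i k, (k < N)%N ->
        (mu i k.+1)%:E =
        (((2 * r%:R)^-1)%:E * \sum_(l < r) \esum_(j in [set: 'rV[int]_d])
          ((beta rho i (Phi rho N m 1 l j k) +
            beta rho i (Phi rho N m (-1) l j k)) * mu j k)%:E)%E].

End scheme.

(* Main.v *)
Require Import Defs.
From HB Require Import structures.
From mathcomp Require Import all_boot all_order all_algebra.
From mathcomp Require Import all_classical all_reals all_analysis.
From mathcomp Require Import measurable_realfun ring lra zify.

Set Implicit Arguments.
Unset Strict Implicit.
Unset Printing Implicit Defensive.

Import Order.TTheory GRing.Theory Num.Theory.
Import numFieldNormedType.Exports.

Local Open Scope classical_set_scope.
Local Open Scope ring_scope.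

(* By the linear growth condition and a discrete Gronwall argument the second
   moments of m^n(t) are bounded uniformly in n and t, and the integrals of
   C^{1,1} functions against m^n(t) are Lipschitz in t uniformly in n.  Along an
   ultrafilter on the indices, m^n(t) then converges weakly for every t, the limit
   law being given by the Riesz representation theorem.  Since finitely many
   C^{1,1} functions control d_1 among laws with bounded second moments, the
   convergence is uniform in t for d_1, which yields a limit point.

   Let m be a limit point and phi a test function.  Over one time step the
   integral of phi against m^n grows by h times the integral of L[m^n] phi, up to
   o(h): the two symmetric jumps of the random walk reproduce the generator L by
   Taylor's formula, and the Q_1 interpolation costs O(rho^2) = o(h).  As
   (m, t) |-> int L[m] phi(., t) dm(t) is continuous, t |-> int phi dm(t) has the
   derivative int L[m] phi(., t) dm(t), and (FPK) follows by integration. *)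

(** * Norms and integrals of bounded functions *)

(** The class C^{1,1} is what the scheme and d_1 have in common. A first-order Taylor formula with
    quadratic remainder is all that the bounds on a time step use: the Q_1 weights have mean
    displacement zero, so interpolation leaves only O(rho^2), and the symmetric jumps leave a drift
    and a variance of order h. Conversely, products of C^{1,1} steps form arbitrarily fine
    partitions of unity, and two laws that give nearly the same mass to every patch can be coupled
    explicitly within the patches; the tails are paid by the second moments.

    An ultrafilter makes the bounded integrals converge for all test functions and all times at
    once, so no diagonal extraction is made; as it refines the filter of eventual properties, its
    limits are cluster points.

    In the limit equation the generator depends on the whole curve and its coefficients are
    unbounded. Applied to phi it vanishes off a fixed ball, and the local Lipschitz condition makes
    x |-> L[m] phi(x, s) bounded and Lipschitz, hence an integrand that d_1 controls. Comparing the
    slopes of a piecewise affine function of time with a derivative then takes the place of a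
    Riemann sum argument. *)

Lemma ratio_le (R : realFieldType) (a e : R) : 0 <= a -> 0 <= e ->
  a * (e / (a + 1)) <= e.
Proof.
by move=> a0 e0; rewrite mulrA ler_pdivrMr ?ltr_wpDl// mulrC ler_wpM2l// lerDl.
Qed.

Lemma continuous_sumr (R : realType) (T : topologicalType) I (s : seq I)
    (f : I -> T -> R) : (forall i, continuous (f i)) ->
  continuous (fun x => \sum_(i <- s) f i x).
Proof.
move=> cf; elim: s => [|i s IH] x.
  by under eq_fun do rewrite big_nil; exact: cvg_cst.
under eq_fun do rewrite big_cons.
by apply: cvgD; [exact: cf|exact: IH].
Qed.

Lemma continuous_mulr (R : realType) (T : topologicalType) (f g : T -> R) :
  continuous f -> continuous g -> continuous (fun x => f x * g x).
Proof. by move=> cf cg x; apply: cvgM; [exact: cf|exact: cg]. Qed.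

Lemma continuous_addr (R : realType) (T : topologicalType) (f g : T -> R) :
  continuous f -> continuous g -> continuous (fun x => f x + g x).
Proof. by move=> cf cg x; apply: cvgD; [exact: cf|exact: cg]. Qed.

Lemma continuous_cstr (R : realType) (T : topologicalType) (c : R) :
  continuous (fun _ : T => c).
Proof. by move=> x; exact: cvg_cst. Qed.

Section euclidean_norm.
Context {R : realType} {d : nat}.
Implicit Types x y : 'rV[R]_d.

Definition sq (x : 'rV[R]_d) : R := \sum_(l < d) x 0 l ^+ 2.

Lemma sq_ge0 x : 0 <= sq x.
Proof. by apply: sumr_ge0 => l _; exact: sqr_ge0. Qed.

Lemma enorm_ge0 (m n : nat) (A : 'M[R]_(m, n)) : 0 <= enorm A.
Proof. exact: sqrtr_ge0. Qed.

Lemma enorm_sqr x : enorm x ^+ 2 = sq x.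
Proof. by rewrite /enorm big_ord1 sqr_sqrtr// sq_ge0. Qed.

Lemma enorm_sqrE (m n : nat) (A : 'M[R]_(m, n)) :
  enorm A ^+ 2 = \sum_(i < m) \sum_(j < n) A i j ^+ 2.
Proof.
by rewrite sqr_sqrtr//; do 2 (apply: sumr_ge0 => ? _); exact: sqr_ge0.
Qed.

Lemma normr_le_enorm (m n : nat) (A : 'M[R]_(m, n)) i j : `|A i j| <= enorm A.
Proof.
rewrite -(ler_pXn2r (n := 2))// ?nnegrE ?enorm_ge0// enorm_sqrE real_normK ?num_real//.
rewrite (bigD1 i)//= (bigD1 j)//= -addrA lerDl addr_ge0//.
  by apply: sumr_ge0 => k _; exact: sqr_ge0.
by do 2 (apply: sumr_ge0 => ? _); exact: sqr_ge0.
Qed.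

Lemma sqN x : sq (- x) = sq x.
Proof. by apply: eq_bigr => l _; rewrite mxE sqrrN. Qed.

Lemma enormN x : enorm (- x) = enorm x.
Proof. by rewrite /enorm !big_ord1; congr Num.sqrt; exact: sqN. Qed.

Lemma sqZ a x : sq (a *: x) = a ^+ 2 * sq x.
Proof. by rewrite mulr_sumr; apply: eq_bigr => l _; rewrite mxE exprMn. Qed.

Lemma sqD_le x y : sq (x + y) <= 2 * (sq x + sq y).
Proof.
rewrite -big_split/= mulr_sumr; apply: ler_sum => l _; rewrite mxE.
have := sqr_ge0 (x 0 l - y 0 l); nra.
Qed.

Lemma sqB_le x y : sq (x - y) <= 2 * (sq x + sq y).
Proof. by rewrite (le_trans (sqD_le _ _))// sqN. Qed.

Lemma norm_le_enorm x : `|x| <= enorm x.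
Proof.
rewrite /Num.norm/= mx_normrE; apply/bigmax_leP; split; first exact: enorm_ge0.
by move=> [i j] _ /=; exact: normr_le_enorm.
Qed.

Lemma normr_coord_le x l : `|x 0 l| <= `|x|.
Proof.
rewrite [leRHS]/Num.norm/= mx_normrE.
by apply: le_trans (le_bigmax _ _ (0, l)).
Qed.

Lemma enorm_le_norm x : enorm x <= d%:R * `|x|.
Proof.
rewrite -(ler_pXn2r (n := 2))// ?nnegrE ?enorm_ge0 ?mulr_ge0//.
rewrite enorm_sqr exprMn (@le_trans _ _ (d%:R * `|x| ^+ 2))//; last first.
  by rewrite ler_wpM2r ?sqr_ge0// -natrX ler_nat; case: (d) => // n; rewrite expnS leq_pmulr.
rewrite mulr_natl -[X in _ *+ X](card_ord d) -sumr_const; apply: ler_sum => l _.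
rewrite -[leLHS]real_normK ?num_real// ler_pXn2r ?nnegrE//.
exact: normr_coord_le.
Qed.

Lemma coord_continuous_rV l : continuous (fun x => x 0 l : R).
Proof. exact: coord_continuous. Qed.

Lemma sq_continuous : continuous sq.
Proof.
apply: continuous_sumr => l; under eq_fun do rewrite expr2.
by apply: continuous_mulr; exact: coord_continuous_rV.
Qed.

Lemma continuous_borel (f : 'rV[R]_d -> R) : continuous f ->
  measurable_fun setT (f : Borel R d -> R).
Proof.
move=> cf; apply: (measurability _ (RGenOpens.measurableE R)) => //.
move=> _ [_ [a [b ->]] <-]; rewrite setTI; apply: sub_sigma_algebra.
by apply: open_comp => // x _; exact: cf.
Qed.

End euclidean_norm.

Section probability_integrals.
Context {R : realType} {dT : measure_display} {T : measurableType dT}.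
Context (P : probability T R).
Implicit Types f g : T -> R.

Lemma bounded_integrable f B : measurable_fun setT f ->
  (forall x, `|f x| <= B) -> P.-integrable setT (EFin \o f).
Proof.
move=> mf fB; apply: measurable_bounded_integrable => //.
  by have := probability_setT P => /= ->; rewrite ltry.
exists B; split; first exact: num_real.
by move=> y /ltW By x _; exact: le_trans By.
Qed.

Lemma EFin_Rintegral f : P.-integrable setT (EFin \o f) ->
  ((\int[P]_x f x)%:E = \int[P]_x (f x)%:E)%E.
Proof. by move=> fi; rewrite /Rintegral fineK//; exact: integrable_fin_num. Qed.

Lemma Rintegral_cstT (c : R) : \int[P]_x c = c.
Proof. by rewrite Rintegral_cst//; have /= -> := probability_setT P; rewrite mulr1. Qed.

Lemma Rintegral_le_bound f B : measurable_fun setT f ->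
  (forall x, `|f x| <= B) -> `|\int[P]_x f x| <= B.
Proof.
move=> mf fB; have fi := bounded_integrable mf fB.
rewrite (le_trans (le_normr_Rintegral _ fi))// -[leRHS]Rintegral_cstT.
apply: le_Rintegral => //; first exact: integrable_norm.
by apply: (@bounded_integrable _ `|B|) => //.
Qed.

Lemma Rintegral_dist_le f g e : P.-integrable setT (EFin \o f) ->
  P.-integrable setT (EFin \o g) ->
  (forall x, `|f x - g x| <= e) -> `|\int[P]_x f x - \int[P]_x g x| <= e.
Proof.
move=> fi gi fge; rewrite -RintegralB//; apply: Rintegral_le_bound => //.
by apply: measurable_funB; apply/measurable_EFinP; apply: measurable_int; eassumption.
Qed.

Lemma integrable_sumr I (s : seq I) (f : I -> T -> R) :
  (forall i, P.-integrable setT (EFin \o f i)) ->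
  P.-integrable setT (EFin \o (fun x => \sum_(i <- s) f i x)).
Proof.
move=> fi; rewrite [X in _.-integrable _ X](_ : _ =
  fun x => (\sum_(i <- s) (EFin \o f i) x)%E).
  by apply: integrable_sum => // i _; exact: fi.
by apply/funext => x /=; rewrite sumEFin.
Qed.

Lemma Rintegral_sum I (s : seq I) (f : I -> T -> R) :
  (forall i, P.-integrable setT (EFin \o f i)) ->
  \int[P]_x \sum_(i <- s) f i x = \sum_(i <- s) \int[P]_x f i x.
Proof.
move=> fi; elim: s => [|i s IH].
  by under eq_Rintegral do rewrite big_nil; rewrite big_nil Rintegral_cstT.
under eq_Rintegral do rewrite big_cons; rewrite big_cons -IH RintegralD//.
exact: integrable_sumr.
Qed.

End probability_integrals.

(** * Couplings *)

Section density.
Import HBNNSimple.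
Context {R : realType} {dT : measure_display} {T : measurableType dT}.
Context (m : {measure set T -> \bar R}) (g : T -> R).
Hypothesis (g0 : forall x, 0 <= g x) (mg : measurable_fun setT g).

Let dens (A : set T) : \bar R := (\int[m]_(x in A) (g x)%:E)%E.

Let mgE : measurable_fun setT (EFin \o g).
Proof. exact/measurable_EFinP. Qed.

Let dens0 : dens set0 = 0%E. Proof. exact: integral_set0. Qed.

Let dens_ge0 A : (0 <= dens A)%E.
Proof. by apply: integral_ge0 => x _; rewrite lee_fin. Qed.

Let dens_sigma_additive : semi_sigma_additive dens.
Proof.
move=> F mF tF mUF; rewrite /dens ge0_integral_bigcup//.
- apply: is_cvg_nneseries => n _ _.
  by apply: integral_ge0 => x _; rewrite lee_fin.
- exact: measurable_funTS.
- by move=> x _; rewrite lee_fin.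
Qed.

(** The integral formula is clear for indicators; finite sums, and monotone convergence along the
    simple functions [h n] on both sides, extend it to [f]. *)
Lemma density_probability : (\int[m]_x (g x)%:E = 1)%E ->
  exists P : probability T R,
    (forall A, measurable A -> P A = \int[m]_(x in A) (g x)%:E)%E /\
    forall f : T -> R, (forall x, 0 <= f x) -> measurable_fun setT f ->
      (\int[P]_x (f x)%:E = \int[m]_x (f x * g x)%:E)%E.
Proof.
move=> g1.
pose M := isMeasure.Build _ _ _ dens dens0 dens_ge0 dens_sigma_additive.
pose PM : {measure set T -> \bar R} := HB.pack dens M.
pose Q := Measure_isProbability.Build _ _ _ PM g1.
pose P : probability T R := HB.pack (Measure.sort PM) Q.
have PE A : P A = (\int[m]_(x in A) (g x)%:E)%E by [].
clearbody P; exists P; split => // f f0 mf; clear Q PM M.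
have mfE : measurable_fun setT (EFin \o f) by exact/measurable_EFinP.
pose h := nnsfun_approx measurableT mfE.
have hf x : (EFin \o h n) x @[n --> \oo] --> (f x)%:E.
  by apply: (cvg_nnsfun_approx _ mfE) => // y _; rewrite lee_fin.
have hnd x : {homo (fun n => (EFin \o h n) x) : a b / (a <= b)%N >-> (a <= b)%E}.
  by move=> a b ab; rewrite lee_fin; exact/lefP/nd_nnsfun_approx.
transitivity (lim (\int[P]_x (EFin \o h n) x @[n --> \oo]))%E.
  rewrite -monotone_convergence//.
  - by apply: eq_integral => x _; apply/esym/cvg_lim => //; exact: hf.
  - by move=> n; exact/measurable_EFinP.
  - by move=> n x _; rewrite lee_fin.
transitivity (lim (\int[m]_x (h n x * g x)%:E @[n --> \oo]))%E; last first.
  rewrite -monotone_convergence//.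
  - apply: eq_integral => x _; apply/cvg_lim => //.
    under eq_fun do rewrite EFinM.
    by rewrite EFinM; apply: cvgeZr => //; exact: hf.
  - by move=> n; apply/measurable_EFinP/measurable_funM.
  - by move=> n x _; rewrite lee_fin mulr_ge0.
  - by move=> x _ a b ab; rewrite lee_fin ler_wpM2r//; exact: hnd.
suff suf n : (\int[P]_x (EFin \o h n) x = \int[m]_x (h n x * g x)%:E)%E.
  by under eq_fun do rewrite suf.
transitivity (\int[P]_x (\sum_(y \in range (h n)) (y * \1_(h n @^-1` [set y]) x)%:E))%E.
  by apply: eq_integral => t tE; rewrite /= fimfunE -fsumEFin.
have mpre r : measurable (h n @^-1` [set r]) by exact: measurable_funPTI.
have indich r : measurable_fun setT (fun x => (r * \1_(h n @^-1` [set r]) x)%:E).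
  by apply/measurable_EFinP; exact: measurable_funM.
rewrite ge0_integral_fsum//; last by move=> r y Ey; exact: nnfun_muleindic_ge0.
transitivity (\int[m]_x (\sum_(y \in range (h n))
    (y * \1_(h n @^-1` [set y]) x * g x)%:E))%E; last first.
  apply: eq_integral => t _; rewrite fsumEFin//; congr EFin.
  by rewrite -mulr_fsuml -fimfunE.
have mg1 r : measurable_fun setT (fun x => (r * \1_(h n @^-1` [set r]) x * g x)%:E).
  by apply/measurable_EFinP; apply: measurable_funM => //; apply: measurable_funM.
have ge0y r x : (0 <= (r * \1_(h n @^-1` [set r]) x * g x)%:E)%E.
  by rewrite EFinM mule_ge0 ?lee_fin ?g0//; exact: nnfun_muleindic_ge0.
rewrite ge0_integral_fsum//.
apply: eq_fsbigr => r; rewrite inE => -[t _ htr].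
have r0 : 0 <= r by rewrite -htr.
under eq_integral do rewrite EFinM.
rewrite ge0_integralZl_EFin//; last exact/measurable_EFinP.
rewrite integral_indic// setIT.
under [RHS]eq_integral do rewrite -mulrA EFinM.
rewrite ge0_integralZl_EFin//; last 2 first.
- by move=> x _; rewrite lee_fin mulr_ge0.
- by apply/measurable_EFinP; apply: measurable_funM.
congr (_ * _)%E; have /= -> := PE (h n @^-1` [set r]); rewrite integral_mkcond; apply: eq_integral => x _.
by rewrite patchE indicE; case: ifPn => _; rewrite ?mul1r ?mul0r.
Qed.

End density.

(** The common mass min (p i, q i) stays on the diagonal; the two surpluses, both of total [s], are
    matched by their product divided by [s]. Only surplus leaves the diagonal, and it is at most the
    sum of the |p i - q i|. *)
Lemma finite_coupling (R : realType) (I : finType) (p q : I -> R) :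
  (forall i, 0 <= p i) -> (forall i, 0 <= q i) ->
  \sum_i p i = 1 -> \sum_i q i = 1 ->
  exists W : I -> I -> R, [/\ forall i j, 0 <= W i j,
    forall i, \sum_j W i j = p i, forall j, \sum_i W i j = q j &
    \sum_i \sum_(j | j != i) W i j <= \sum_i `|p i - q i|].
Proof.
move=> p0 q0 p1 q1; pose m i := Num.min (p i) (q i).
have mp i : 0 <= p i - m i by rewrite subr_ge0 ge_min lexx.
have mq i : 0 <= q i - m i by rewrite subr_ge0 ge_min lexx orbT.
have m0 i : 0 <= m i by rewrite le_min p0 q0.
pose s := \sum_i (p i - m i).
have sq : \sum_i (q i - m i) = s by rewrite /s !sumrB p1 q1.
have s0 : 0 <= s by exact: sumr_ge0.
(* If s = 0 the surpluses vanish, so the value 0 of the division by [s] is harmless. *)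
have rowE (a : R) (u : I -> R) : (forall i, 0 <= u i) -> \sum_i u i = s ->
    forall i, u i * s / s = u i.
  move=> u0 us i; have [sE|sN0] := eqVneq s 0; last by rewrite mulfK.
  rewrite sE mulr0 mul0r; apply/esym/(psumr_eq0P (P := xpredT)) => //.
  by rewrite us.
pose W i j := (i == j)%:R * m i + (p i - m i) * (q j - m j) / s.
exists W; split.
- by move=> i j; rewrite addr_ge0 ?mulr_ge0 ?invr_ge0.
- move=> i; rewrite big_split/= (bigD1 i)//= eqxx mul1r big1 ?addr0; last first.
    by move=> j ji; rewrite eq_sym (negPf ji) mul0r.
  under eq_bigr do rewrite -mulrA [_ / s]mulrC mulrA; rewrite -mulr_sumr sq.
  by rewrite mulrAC (rowE 0 (fun i => p i - m i))// addrC subrK.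
- move=> j; rewrite big_split/= (bigD1 j)//= eqxx mul1r big1 ?addr0; last first.
    by move=> i ij; rewrite (negPf ij) mul0r.
  under eq_bigr do rewrite -mulrA; rewrite -mulr_suml -/s.
  by rewrite mulrA [s * _]mulrC (rowE 0 (fun i => q i - m i))// addrC subrK.
apply: (@le_trans _ _ (\sum_i (p i - m i))); last first.
  apply: ler_sum => i _; rewrite /m minElt; case: ifPn => pq; first by rewrite subrr.
  exact: ler_norm.
apply: ler_sum => i _.
rewrite -[leRHS](rowE 0 (fun i => p i - m i))//.
rewrite -sq mulr_sumr mulr_suml [leRHS](bigD1 i)//= sq.
rewrite -[leLHS]add0r lerD//; first by rewrite !mulr_ge0 ?invr_ge0.
by apply: ler_sum => j ji; rewrite /W eq_sym (negPf ji) mul0r add0r.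
Qed.

Section partition_coupling.
Context {R : realType} {dT : measure_display} {T : measurableType dT}.

Lemma product_integral (mu nu : probability T R) (f g : T -> R) (A B : R) :
  measurable_fun setT f -> measurable_fun setT g ->
  (forall x, 0 <= f x <= A) -> (forall x, 0 <= g x <= B) ->
  (\int[(mu \x nu)]_z (f z.1 * g z.2)%:E =
   ((\int[mu]_x f x) * (\int[nu]_x g x))%:E)%E.
Proof.
move=> mf mg fA gB.
have f0 x : 0 <= f x by case/andP: (fA x).
have g0 x : 0 <= g x by case/andP: (gB x).
have fi : mu.-integrable setT (EFin \o f).
  by apply: (@bounded_integrable _ _ _ _ _ A) => // x; rewrite ger0_norm//; case/andP: (fA x).
have gi : nu.-integrable setT (EFin \o g).
  by apply: (@bounded_integrable _ _ _ _ _ B) => // x; rewrite ger0_norm//; case/andP: (gB x).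
rewrite fubini_tonelli1; last 2 first.
- apply/measurable_EFinP; apply: measurable_funM.
    by apply: measurableT_comp => //; exact: measurable_fst.
  by apply: measurableT_comp => //; exact: measurable_snd.
- by move=> z; rewrite lee_fin mulr_ge0.
rewrite EFinM EFin_Rintegral// EFin_Rintegral//.
under eq_integral => x _.
  rewrite /fubini_F/=; under eq_integral do rewrite EFinM.
  rewrite ge0_integralZl_EFin//; last 2 first.
  - by move=> y _; rewrite lee_fin.
  - exact/measurable_EFinP.
  rewrite -EFin_Rintegral// -EFinM mulrC EFinM; over.
rewrite ge0_integralZl_EFin//.
- by rewrite muleC EFin_Rintegral.
- by move=> x _; rewrite lee_fin.
- exact/measurable_EFinP.
- exact: Rintegral_ge0.
Qed.

Context {I : finType} (chi : I -> T -> R).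
Hypothesis mchi : forall i, measurable_fun setT (chi i).
Hypothesis chi0 : forall i x, 0 <= chi i x.
Hypothesis chi1 : forall x, \sum_i chi i x = 1.

Let chi_le1 i x : chi i x <= 1.
Proof.
by rewrite -(chi1 x) (bigD1 i)//= lerDl; apply: sumr_ge0 => j _; exact: chi0.
Qed.

Lemma partition_integrable (P : probability T R) i :
  P.-integrable setT (EFin \o chi i).
Proof.
by apply: (@bounded_integrable _ _ _ _ _ 1) => // x; rewrite ger0_norm.
Qed.

(** The coupling has density sum_(i, j) W i j / (p i q j) chi i (x) chi j (y) with respect to
    [mu \x nu], where [W] couples the patch masses [p] and [q]. Pairs from the same patch pay the
    local cost c + a x + a y; the off-diagonal mass of [W], at most the sum of the |p i - q i|, pays
    [K] in addition. *)
Lemma partition_coupling (mu nu : probability T R)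
    (e : T * T -> R) (a : T -> R) (c K : R) :
  (forall z, 0 <= e z) -> measurable_fun setT e ->
  (forall x, 0 <= a x) -> measurable_fun setT a -> 0 <= c -> 0 <= K ->
  (forall i x y, chi i x != 0 -> chi i y != 0 -> e (x, y) <= c + a x + a y) ->
  (forall x y, e (x, y) <= K + (c + a x + a y)) ->
  exists2 pi : probability (T * T)%type R,
    forall A, measurable A ->
      pi (A `*` setT) = mu A /\ pi (setT `*` A) = nu A &
    (\int[pi]_z (e z)%:E <= c%:E + \int[mu]_x (a x)%:E + \int[nu]_x (a x)%:E
      + (K * \sum_i `|\int[mu]_x chi i x - \int[nu]_x chi i x|)%:E)%E.
Proof.
move=> e0 me a0 ma c0 K0 eloc eglob.
pose p i := \int[mu]_x chi i x; pose q i := \int[nu]_x chi i x.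
have p0 i : 0 <= p i by apply: Rintegral_ge0 => x _.
have q0 i : 0 <= q i by apply: Rintegral_ge0 => x _.
have sum1 (P : probability T R) : \sum_i \int[P]_x chi i x = 1.
  rewrite -Rintegral_sum; last by move=> i; exact: partition_integrable.
  by under eq_Rintegral do rewrite chi1; rewrite Rintegral_cstT.
have [W [W0 Wp Wq Woff]] := finite_coupling p0 q0 (sum1 mu) (sum1 nu).
(* If p i or q j is 0 then so is W i j, hence a division by zero does not spoil the identity [wE]
   below. *)
pose w i j := W i j / (p i * q j).
have w0 i j : 0 <= w i j by rewrite divr_ge0 ?mulr_ge0.
have Wp0 i j : p i = 0 -> W i j = 0.
  by move=> pi0; apply: (psumr_eq0P (P := xpredT)) => //; rewrite Wp.
have Wq0 i j : q j = 0 -> W i j = 0.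
  by move=> qj0; apply: (psumr_eq0P (P := xpredT) (F := W^~ j)) => //; rewrite Wq.
have wE i j : w i j * (p i * q j) = W i j.
  rewrite /w; have [pi0|pi0] := eqVneq (p i) 0; first by rewrite Wp0// !mul0r.
  have [qj0|qj0] := eqVneq (q j) 0; first by rewrite Wq0// !mul0r.
  by rewrite mulfVK// mulf_neq0.
clearbody w.
have [t tE] : exists t : I -> I -> T * T -> R,
    forall i j z, t i j z = w i j * (chi i z.1 * chi j z.2).
  by exists (fun i j z => w i j * (chi i z.1 * chi j z.2)).
have t0 i j z : 0 <= t i j z by rewrite tE !mulr_ge0.
have mfst (f : T -> R) : measurable_fun setT f -> measurable_fun setT (fun z : T * T => f z.1).
  by move=> mf; apply: measurableT_comp => //; exact: measurable_fst.
have msnd (f : T -> R) : measurable_fun setT f -> measurable_fun setT (fun z : T * T => f z.2).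
  by move=> mf; apply: measurableT_comp => //; exact: measurable_snd.
have mt i j : measurable_fun setT (t i j).
  rewrite [t i j](_ : _ = fun z => w i j * (chi i z.1 * chi j z.2)); last first.
    by apply/funext => z; rewrite tE.
  by apply: measurable_funM => //; apply: measurable_funM; [exact: mfst|exact: msnd].
pose G z := \sum_i \sum_j t i j z.
have G0 z : 0 <= G z by do 2 (apply: sumr_ge0 => ? _).
have mG : measurable_fun setT G.
  by apply: measurable_sum => i; apply: measurable_sum => j.
have tint (f g : T -> R) i j : measurable_fun setT f -> measurable_fun setT g ->
    (forall x, 0 <= f x <= 1) -> (forall x, 0 <= g x <= 1) ->
    (\int[(mu \x nu)]_z (f z.1 * g z.2 * t i j z)%:E =
     (w i j * ((\int[mu]_x (f x * chi i x)) * (\int[nu]_x (g x * chi j x))))%:E)%E.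
  move=> mf mg f1 g1.
  have [f0 g0] : (forall x, 0 <= f x) /\ (forall x, 0 <= g x).
    by split => x; [case/andP: (f1 x)|case/andP: (g1 x)].
  under eq_integral => z _.
    rewrite [X in X%:E](_ : _ = w i j * ((f z.1 * chi i z.1) * (g z.2 * chi j z.2))); last by rewrite tE; ring.
    rewrite EFinM; over.
  rewrite ge0_integralZl_EFin//; last 2 first.
  - by move=> z _; rewrite lee_fin !mulr_ge0.
  - apply/measurable_EFinP/measurable_funM.
      by apply: (mfst (fun x => f x * chi i x)); exact: measurable_funM.
    by apply: (msnd (fun x => g x * chi j x)); exact: measurable_funM.
  rewrite (@product_integral mu nu (fun x => f x * chi i x) (fun x => g x * chi j x) 1 1) ?EFinM//.
  - exact: measurable_funM.
  - exact: measurable_funM.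
  - by move=> x; rewrite mulr_ge0// mulr_ile1//; case/andP: (f1 x).
  - by move=> x; rewrite mulr_ge0// mulr_ile1//; case/andP: (g1 x).
(* With [f] and [g] constant or indicators this gives the total mass and both marginals. *)
have Gint (f g : T -> R) : measurable_fun setT f -> measurable_fun setT g ->
    (forall x, 0 <= f x <= 1) -> (forall x, 0 <= g x <= 1) ->
    (\int[(mu \x nu)]_z (f z.1 * g z.2 * G z)%:E =
     (\sum_i \sum_j w i j * ((\int[mu]_x (f x * chi i x)) * (\int[nu]_x (g x * chi j x))))%:E)%E.
  move=> mf mg f1 g1.
  have [f0 g0] : (forall x, 0 <= f x) /\ (forall x, 0 <= g x).
    by split => x; [case/andP: (f1 x)|case/andP: (g1 x)].
  under eq_integral => z _.
    rewrite mulr_sumr -sumEFin; under eq_bigr do rewrite mulr_sumr -sumEFin.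
    over.
  have mfg i j : measurable_fun setT (fun z : T * T => (f z.1 * g z.2 * t i j z)%:E).
    by apply/measurable_EFinP/measurable_funM => //; apply: measurable_funM; [exact: mfst|exact: msnd].
  have fg0 i j (z : T * T) : (0 <= (f z.1 * g z.2 * t i j z)%:E)%E by rewrite lee_fin !mulr_ge0.
  rewrite ge0_integral_sum//; last 2 first.
  - by move=> i; apply: emeasurable_sum.
  - by move=> i z _; apply: sume_ge0.
  rewrite -sumEFin; apply: eq_bigr => i _.
  rewrite ge0_integral_sum// -sumEFin; apply: eq_bigr => j _.
  exact: tint.
have m1 : measurable_fun setT (fun _ : T => 1 : R) by exact: measurable_cst.
have b1 (x : T) : 0 <= (1 : R) <= 1 by rewrite ler01 lexx.
have mind A : measurable A -> measurable_fun setT (\1_A : T -> R) by move=> mA; exact: measurable_indic.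
have bind A (x : T) : 0 <= (\1_A x : R) <= 1 by rewrite indicE; case: (x \in A); rewrite ?lexx ?ler01.
have i1chi (P : probability T R) i : \int[P]_x (1 * chi i x) = \int[P]_x chi i x.
  by under eq_Rintegral do rewrite mul1r.
have i0 (P : probability T R) A i : measurable A ->
    \int[P]_x chi i x = 0 -> \int[P]_x (\1_A x * chi i x) = 0.
  move=> mA P0; apply/eqP; rewrite eq_le; apply/andP; split.
    rewrite -P0; apply: le_Rintegral => //.
    - apply: (@bounded_integrable _ _ _ _ _ 1); first by apply: measurable_funM => //; exact: mind.
      move=> x; case/andP: (bind A x) => A0 A1; rewrite ger0_norm ?mulr_ge0//.
      by rewrite mulr_ile1.
    - exact: partition_integrable.
    - by move=> x _; case/andP: (bind A x) => A0 A1; rewrite ler_piMl.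
  by apply: Rintegral_ge0 => x _; rewrite mulr_ge0//; case/andP: (bind A x).
have isum (P : probability T R) A : measurable A ->
    ((\sum_i \int[P]_x (\1_A x * chi i x))%:E = P A)%E.
  move=> mA; rewrite -Rintegral_sum; last first.
    move=> i; apply: (@bounded_integrable _ _ _ _ _ 1); first by apply: measurable_funM => //; exact: mind.
    move=> x; case/andP: (bind A x) => A0 A1; rewrite ger0_norm ?mulr_ge0//.
    by rewrite mulr_ile1.
  under eq_Rintegral do rewrite -mulr_sumr chi1 mulr1.
  rewrite EFin_Rintegral ?integral_indic ?setIT//.
  apply: (@bounded_integrable _ _ _ _ _ 1); first exact: mind.
  by move=> x; case/andP: (bind A x) => A0 A1; rewrite ger0_norm.
have intG : (\int[(mu \x nu)]_z (G z)%:E = 1)%E.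
  under eq_integral do rewrite -[G _]mul1r -[1 in X in X%:E]mulr1.
  rewrite (Gint (fun=> 1) (fun=> 1))//.
  congr (_%:E); under eq_bigr do under eq_bigr do rewrite !i1chi wE.
  by under eq_bigr do rewrite Wp; exact: sum1.
have [pi [piA piint]] := density_probability G0 mG intG.
have marg1 A : measurable A -> pi (A `*` setT) = mu A.
  move=> mA; rewrite piA; last exact: measurableX.
  rewrite integral_mkcond.
  transitivity (\int[(mu \x nu)]_z (\1_A z.1 * 1 * G z)%:E)%E.
    apply: eq_integral => -[x y] _; rewrite patchE/= indicE mulr1.
    by rewrite in_setX in_setT andbT/=; case: ifPn => _; rewrite ?mul1r ?mul0r.
  rewrite (Gint _ _ (mind A mA) m1 (bind A) b1).
  rewrite -isum//; congr (_%:E); apply: eq_bigr => i _.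
  have [pi0|pi0] := eqVneq (p i) 0.
    by rewrite i0// big1// => j _; rewrite mul0r mulr0.
  under eq_bigr do rewrite mulrCA i1chi; rewrite -mulr_sumr.
  rewrite [X in _ * X](_ : _ = 1) ?mulr1//.
  apply: (mulfI pi0); rewrite mulr1 -[RHS]Wp mulr_sumr; apply: eq_bigr => j _.
  by rewrite mulrCA wE.
have marg2 A : measurable A -> pi (setT `*` A) = nu A.
  move=> mA; rewrite piA; last exact: measurableX.
  rewrite integral_mkcond.
  transitivity (\int[(mu \x nu)]_z (1 * \1_A z.2 * G z)%:E)%E.
    apply: eq_integral => -[x y] _; rewrite patchE/= indicE mul1r.
    by rewrite in_setX in_setT/=; case: ifPn => _; rewrite ?mul1r ?mul0r.
  rewrite (Gint _ _ m1 (mind A mA) b1 (bind A)).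
  rewrite -isum//; congr (_%:E); rewrite exchange_big/=; apply: eq_bigr => j _.
  have [qj0|qj0] := eqVneq (q j) 0.
    by rewrite [X in _ = X]i0// big1// => i _; rewrite i0// !mulr0.
  under eq_bigr do rewrite mulrA i1chi; rewrite -mulr_suml.
  rewrite [X in X * _](_ : _ = 1) ?mul1r//.
  apply: (mulfI qj0); rewrite mulr1 -[RHS]Wq mulr_sumr; apply: eq_bigr => i _.
  by rewrite -wE /p; ring.
exists pi; first by move=> A mA; split; [exact: marg1|exact: marg2].
(* [H] collects the pairs of distinct patches, the only ones charged with [K]. *)
pose H z := \sum_i \sum_(j | j != i) t i j z.
have H0 z : 0 <= H z by do 2 (apply: sumr_ge0 => ? _).
have mH : measurable_fun setT H.
  apply: measurable_sum => i.
  under eq_fun do rewrite big_mkcond/=.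
  by apply: measurable_sum => j; case: (j != i).
have intH : (\int[(mu \x nu)]_z (H z)%:E <= (\sum_i `|p i - q i|)%:E)%E.
  apply: (@le_trans _ _ ((\sum_i \sum_(j | j != i) W i j)%:E)); last by rewrite lee_fin.
  rewrite le_eqVlt; apply/orP; left; apply/eqP.
  under eq_integral => z _.
    rewrite /H; under eq_bigr do rewrite big_mkcond/=.
    rewrite -sumEFin; under eq_bigr do rewrite -sumEFin.
    over.
  have mif i j : measurable_fun setT (fun z => (if j != i then t i j z else 0)%:E).
    by apply/measurable_EFinP; case: (j != i).
  have if0 i j z : (0 <= (if j != i then t i j z else 0)%:E)%E by case: ifP; rewrite lee_fin.
  rewrite ge0_integral_sum//; last 2 first.
  - by move=> i; apply: emeasurable_sum.
  - by move=> i z _; apply: sume_ge0.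
  rewrite -sumEFin; apply: eq_bigr => i _.
  rewrite ge0_integral_sum// [in RHS]big_mkcond/= -sumEFin; apply: eq_bigr => j _.
  case: ifPn => ji; last by rewrite integral0.
  under eq_integral do rewrite -[t _ _ _]mul1r -[1 in X in X%:E]mulr1.
  by rewrite (tint (fun=> 1) (fun=> 1))// !i1chi wE.
have eG x y : e (x, y) * G (x, y) <= (c + a x + a y) * G (x, y) + K * H (x, y).
  rewrite mulr_sumr [in leRHS]mulr_sumr [X in _ + X]mulr_sumr -big_split/=.
  apply: ler_sum => i _; rewrite (bigD1 i)//= mulrDr.
  rewrite [in leRHS]mulrDr -addrA lerD//.
    have [cx0|cx0] := eqVneq (chi i x) 0; first by rewrite tE/= cx0 mul0r !mulr0.
    have [cy0|cy0] := eqVneq (chi i y) 0; first by rewrite tE/= cy0 !mulr0.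
    by rewrite ler_wpM2r//; exact: eloc cx0 cy0.
  rewrite -mulrDl ler_wpM2r//; first by apply: sumr_ge0.
  by rewrite addrC; exact: eglob.
have mEa : measurable_fun setT (EFin \o a) by exact/measurable_EFinP.
have a1 : (\int[pi]_z (a z.1)%:E = \int[mu]_x (a x)%:E)%E.
  have := @ge0_integral_pushforward _ _ _ _ _ _ (@measurable_fst _ _ T T) pi setT _ measurableT mEa.
  rewrite preimage_setT => <-; last by move=> x _; rewrite lee_fin.
  apply: eq_measure_integral => A mA _; have /= <- := marg1 A mA.
  by rewrite /pushforward; congr (pi _); apply/seteqP; split => -[x y]//= [].
have a2 : (\int[pi]_z (a z.2)%:E = \int[nu]_x (a x)%:E)%E.
  have := @ge0_integral_pushforward _ _ _ _ _ _ (@measurable_snd _ _ T T) pi setT _ measurableT mEa.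
  rewrite preimage_setT => <-; last by move=> x _; rewrite lee_fin.
  apply: eq_measure_integral => A mA _; have /= <- := marg2 A mA.
  by rewrite /pushforward; congr (pi _); apply/seteqP; split => -[x y]//= [].
have mca : measurable_fun setT (fun z : T * T => c + a z.1 + a z.2).
  by apply: measurable_funD; [apply: measurable_funD => //; exact: mfst|exact: msnd].
have ca0 (z : T * T) : 0 <= c + a z.1 + a z.2 by rewrite !addr_ge0.
rewrite piint//.
apply: (@le_trans _ _ (\int[(mu \x nu)]_z (((c + a z.1 + a z.2) * G z)%:E + (K * H z)%:E))%E).
  apply: ge0_le_integral => //.
  - by move=> z _; rewrite lee_fin mulr_ge0.
  - by apply/measurable_EFinP; exact: measurable_funM.
  - by apply: emeasurable_funD; apply/measurable_EFinP; exact: measurable_funM.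
  - by move=> [x y] _; rewrite -EFinD lee_fin; exact: eG.
rewrite ge0_integralD//; last 4 first.
- by move=> z _; rewrite lee_fin mulr_ge0.
- by apply/measurable_EFinP; exact: measurable_funM.
- by move=> z _; rewrite lee_fin mulr_ge0.
- by apply/measurable_EFinP; exact: measurable_funM.
rewrite leeD//.
  rewrite -piint//.
  under eq_integral do rewrite !EFinD.
  rewrite ge0_integralD//; last 4 first.
  - by move=> z _; rewrite -EFinD lee_fin addr_ge0.
  - by apply: emeasurable_funD => //; apply/measurable_EFinP; exact: mfst.
  - by move=> z _; rewrite lee_fin.
  - by apply/measurable_EFinP; exact: msnd.
  rewrite ge0_integralD//; last 2 first.
  - by move=> z _; rewrite lee_fin.
  - by apply/measurable_EFinP; exact: mfst.
  rewrite a1 a2 integral_cst//; have /= -> := probability_setT pi.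
  by rewrite mule1.
under eq_integral do rewrite EFinM.
rewrite ge0_integralZl_EFin//; last 2 first.
- by move=> z _; rewrite lee_fin.
- exact/measurable_EFinP.
by rewrite EFinM lee_wpmul2l ?lee_fin.
Qed.

End partition_coupling.

(** * Riesz representation by Daniell's method *)

Section clip.
Context {R : realType}.

Definition clip (y : R) : R := Num.max 0 (Num.min 1 y).

Lemma clip_ge0 y : 0 <= clip y. Proof. by rewrite le_max lexx. Qed.

Lemma clip_le1 y : clip y <= 1. Proof. by rewrite ge_max ler01 ge_min lexx. Qed.

Lemma clip_le y z : y <= z -> clip y <= clip z.
Proof.
move=> yz; rewrite /clip ge_max le_max lexx/= le_max; apply/orP; right.
by rewrite le_min !ge_min lexx/= yz orbT.
Qed.

Lemma clip1 y : 1 <= y -> clip y = 1.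
Proof. by move=> y1; rewrite /clip min_l// max_r. Qed.

Lemma clip0 y : y <= 0 -> clip y = 0.
Proof. by move=> y0; rewrite /clip min_r ?max_l// (le_trans y0). Qed.

Lemma clip_id y : 0 <= y <= 1 -> clip y = y.
Proof. by move=> /andP[y0 y1]; rewrite /clip min_r// max_r. Qed.

Lemma clip_lipschitz y z : `|clip y - clip z| <= `|y - z|.
Proof.
have clipE t : clip t = if t <= 0 then 0 else if 1 <= t then 1 else t.
  case: ifPn => [/clip0//|]; rewrite -ltNge => t0.
  by case: ifPn => [/clip1//|]; rewrite -ltNge => t1; rewrite clip_id ?ltW.
have := ler_norm (y - z); have := ler_norm (z - y); rewrite [`|z - y|]distrC.
rewrite !clipE ler_norml.
case: (leP y 0) => ?; case: (leP z 0) => ?; case: (leP 1 y) => ?; case: (leP 1 z) => ?;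
  move=> ? ?; apply/andP; split; lra.
Qed.

(** Layer-cake decomposition: clip (y - j) is the part of [y] between the heights j and j + 1. *)
Lemma sum_clip y n : 0 <= y <= n%:R -> \sum_(j < n) clip (y - j%:R) = y.
Proof.
elim: n => [|n IH] /andP[y0 yn].
  by rewrite big_ord0; apply/eqP; rewrite eq_le y0.
rewrite big_ord_recr/=; have [ny|ny] := leP y n%:R.
  by rewrite IH ?y0// clip0 ?addr0// subr_le0.
rewrite (eq_bigr (fun=> 1)) => [|i _]; last first.
  rewrite clip1// lerBrDl (le_trans _ (ltW ny))// natr1 ler_nat.
  exact: ltn_ord.
rewrite sumr_const card_ord clip_id ?subrKC// subr_ge0 ltW//=.
by rewrite lerBlDl natr1.
Qed.

End clip.

Section bounded_lipschitz.
Context {R : realType} {d : nat}.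
Implicit Types f g : 'rV[R]_d -> R.

(* Lipschitz for the sup norm, hence also for the Euclidean norm. *)
Definition BL f := (exists B, forall x, `|f x| <= B) /\
  (exists C, forall x y, `|f x - f y| <= C * `|x - y|).

Lemma BL_cst c : BL (fun=> c).
Proof.
split; first by exists `|c|.
by exists 0 => x y; rewrite subrr normr0 mul0r.
Qed.

Lemma BLD f g : BL f -> BL g -> BL (fun x => f x + g x).
Proof.
move=> [[B fB] [C fC]] [[B' gB] [C' gC]]; split.
  by exists (B + B') => x; rewrite (le_trans (ler_normD _ _))// lerD.
exists (C + C') => x y; rewrite opprD addrACA mulrDl.
by rewrite (le_trans (ler_normD _ _))// lerD.
Qed.

Lemma BLM f g : BL f -> BL g -> BL (fun x => f x * g x).
Proof.
move=> [[B fB] [C fC]] [[B' gB] [C' gC]]; split.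
  by exists (B * B') => x; rewrite normrM ler_pM.
exists (B * C' + B' * C) => x y.
rewrite [X in `|X|](_ : _ = f x * (g x - g y) + g y * (f x - f y)); last by ring.
rewrite (le_trans (ler_normD _ _))// mulrDl !normrM -!mulrA.
by rewrite lerD// ler_pM.
Qed.

Lemma BLZ c f : BL f -> BL (fun x => c * f x).
Proof. by move=> bf; apply: BLM => //; exact: BL_cst. Qed.

Lemma BLB f g : BL f -> BL g -> BL (fun x => f x - g x).
Proof.
move=> bf bg; rewrite [X in BL X](_ : _ = fun x => f x + (-1) * g x).
  by apply: BLD => //; exact: BLZ.
by apply/funext => x; rewrite mulN1r.
Qed.

Lemma BL_sum I (s : seq I) (f : I -> 'rV[R]_d -> R) : (forall i, BL (f i)) ->
  BL (fun x => \sum_(i <- s) f i x).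
Proof.
move=> bf; elim: s => [|i s IH].
  by under eq_fun do rewrite big_nil; exact: BL_cst.
by under eq_fun do rewrite big_cons; exact: BLD.
Qed.

Lemma BL_clip f C : (forall x y, `|f x - f y| <= C * `|x - y|) ->
  BL (fun x => clip (f x)).
Proof.
move=> fC; split; last by exists C => x y; exact: le_trans (clip_lipschitz _ _) _.
by exists 1 => x; rewrite ger0_norm ?clip_ge0 ?clip_le1.
Qed.

Lemma BL_clip_affine f a c : BL f -> BL (fun x => clip (a * f x + c)).
Proof.
move=> bf; have [_ [C hC]] : BL (fun x => a * f x + c).
  by apply: BLD; [exact: BLZ|exact: BL_cst].
exact: BL_clip hC.
Qed.

Lemma lipschitz_continuous f C : (forall x y, `|f x - f y| <= C * `|x - y|) ->
  continuous f.
Proof.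
move=> fC x; apply/(@cvgrPdist_le _ _ _ (nbhs x) (nbhs_filter x)) => e e0.
have C0 : 0 < `|C| + 1 by rewrite ltr_wpDl.
near=> y; rewrite (le_trans (fC _ _))//.
rewrite (@le_trans _ _ ((`|C| + 1) * `|x - y|))//.
  by rewrite ler_wpM2r// (le_trans (ler_norm _))// lerDl.
rewrite mulrC -ler_pdivlMr//; near: y.
rewrite -nbhs_ballE; exists (e / (`|C| + 1)); first exact: divr_gt0.
by move=> y; rewrite -ball_normE => /ltW.
Unshelve. all: by end_near. Qed.

Lemma BL_continuous f : BL f -> continuous f.
Proof. by move=> [_ [C /lipschitz_continuous]]. Qed.

Lemma BL_measurable f : BL f -> measurable_fun setT (f : Borel R d -> R).
Proof. by move=> /BL_continuous/continuous_borel. Qed.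

Lemma BL_integrable (P : probability (Borel R d) R) f : BL f ->
  P.-integrable setT (EFin \o f).
Proof.
move=> bf; have [[B fB] _] := bf.
exact: bounded_integrable (BL_measurable bf) fB.
Qed.

Lemma BL_plateau (r : R) : BL (fun x => clip (r + 1 - `|x|)).
Proof.
apply: (@BL_clip _ 1) => x y; rewrite mul1r.
rewrite opprD addrACA subrr add0r opprK addrC distrC.
exact: ler_dist_dist.
Qed.

(** [a] is the sup-norm distance to the complement, clipped to [0, 1]; there is no distance to an
    empty complement, hence the separate case of the full space. *)
Lemma open_BL_pos (U : set 'rV[R]_d) : open U -> exists a : 'rV[R]_d -> R,
  [/\ BL a, forall x, 0 <= a x <= 1 & forall x, U x <-> 0 < a x].
Proof.
move=> oU; have [UT|/eqP/setTPn[y0 Uy0]] := pselect (U = setT).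
  exists (fun=> 1); split; first exact: BL_cst.
    by move=> _; rewrite ler01 lexx.
  by move=> x; rewrite UT; split.
pose D x := [set `|x - y| | y in ~` U].
have D0 x : D x !=set0 by exists `|x - y0|, y0.
have Dlb x : has_lbound (D x) by exists 0 => _ [y _ <-].
pose a x := inf (D x).
have a0 x : 0 <= a x by apply: lb_le_inf => // _ [y _ <-].
have aL x x' : a x <= a x' + `|x - x'|.
  rewrite -lerBlDr; apply: lb_le_inf => // _ [y Uy <-]; rewrite lerBlDr.
  apply: (@le_trans _ _ `|x - y|); first by apply: ge_inf => //; exists y.
  by rewrite [leRHS]addrC -[x - y](subrKA x'); exact: ler_normD.
exists (fun x => clip (a x)); split.
- apply: (@BL_clip _ 1) => x y; rewrite mul1r ler_norml.
  have := aL x y; have := aL y x; rewrite [`|y - x|]distrC => ? ?.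
  by apply/andP; split; lra.
- by move=> x; rewrite clip_ge0 clip_le1.
- move=> x; split => [Ux|].
    have [e /= e0 eU] : nbhs_ball x U by rewrite nbhs_ballE; exact: open_nbhs_nbhs.
    suff ax : 0 < a x by rewrite /clip lt_max lt_min ltr01 ax orbT.
    rewrite (lt_le_trans e0)//; apply: lb_le_inf => // _ [y Uy <-].
    rewrite leNgt; apply/negP => xye; apply: Uy; apply: eU.
    by rewrite -ball_normE.
  rewrite lt_max ltxx lt_min ltr01/= => ax; apply: contrapT => Ux.
  suff : a x <= 0 by rewrite leNgt ax.
  by apply: ge_inf => //; exists x => //; rewrite subrr normr0.
Qed.

Lemma closed_ball_rV_compact (r : R) : compact [set x : 'rV[R]_d | `|x| <= r].
Proof.
apply: bounded_closed_compact.
  exists r; split; first exact: num_real.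
  by move=> s rs x /= /le_trans; apply; exact: ltW.
rewrite [X in closed X](_ : _ = Num.norm @^-1` [set y | y <= r])//.
by apply: closed_comp => [x _|]; [exact: norm_continuous|exact: closed_le].
Qed.

End bounded_lipschitz.

Section daniell.
Context {R : realType} {d : nat}.
Context (L : ('rV[R]_d -> R) -> R).
Hypothesis LD : forall f g, BL f -> BL g -> L (fun x => f x + g x) = L f + L g.
Hypothesis LZ : forall c f, BL f -> L (fun x => c * f x) = c * L f.
Hypothesis L_ge0 : forall f, BL f -> (forall x, 0 <= f x) -> 0 <= L f.
Hypothesis L1 : L (fun=> 1) = 1.
Hypothesis L_tight : forall e, 0 < e -> exists r : R, forall f, BL f ->
  (forall x, 0 <= f x <= 1) -> (forall x, `|x| <= r -> f x = 0) -> L f <= e.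

Let LB f g : BL f -> BL g -> L (fun x => f x - g x) = L f - L g.
Proof.
move=> bf bg; rewrite -mulN1r -LZ// -LD//; last exact: BLZ.
by congr L; apply/funext => x; rewrite mulN1r.
Qed.

Let L_le f g : BL f -> BL g -> (forall x, f x <= g x) -> L f <= L g.
Proof.
move=> bf bg fg; rewrite -subr_ge0 -LB//; apply: L_ge0; first exact: BLB.
by move=> x; rewrite subr_ge0.
Qed.

Let L0 : L (fun=> 0) = 0.
Proof.
rewrite [X in L X](_ : _ = fun=> 0 * 1); last by apply/funext => x; rewrite mul0r.
by rewrite (LZ 0 (BL_cst 1)) mul0r.
Qed.

Let L_sum I (s : seq I) (f : I -> 'rV[R]_d -> R) : (forall i, BL (f i)) ->
  L (fun x => \sum_(i <- s) f i x) = \sum_(i <- s) L (f i).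
Proof.
move=> bf; elim: s => [|i s IH].
  by under eq_fun do rewrite big_nil; rewrite big_nil L0.
under eq_fun do rewrite big_cons.
by rewrite big_cons LD ?IH//; exact: BL_sum.
Qed.

(** Sequences of nonnegative functions play the part of countable covers: their sum dominates the
    indicator of [A], and the sum of the values of [L] is their cost. *)
Definition covers (f : nat -> 'rV[R]_d -> R) (A : set 'rV[R]_d) :=
  [/\ forall i, BL (f i), forall i x, 0 <= f i x &
      forall x, A x -> (1 <= \esum_(i in [set: nat]) (f i x)%:E)%E].

Definition daniell (A : set 'rV[R]_d) : \bar R :=
  ereal_inf [set (\esum_(i in [set: nat]) (L (f i))%:E)%E | f in covers^~ A].

Let daniell_le f A : covers f A ->
  (daniell A <= \esum_(i in [set: nat]) (L (f i))%:E)%E.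
Proof. by move=> cf; apply: ereal_inf_lbound; exists f. Qed.

Let daniell0 : daniell set0 = 0%E.
Proof.
apply/eqP; rewrite eq_le; apply/andP; split; last first.
  apply: le_ereal_inf_tmp => _ [f [bf f0 _] <-]; apply: esum_ge0 => i _.
  by rewrite lee_fin L_ge0.
have c0 : covers (fun _ _ => 0) set0 by split => // i; exact: BL_cst.
rewrite (le_trans (daniell_le c0))// esum1// => i _.
by rewrite L0.
Qed.

Let daniell_ge0 A : (0 <= daniell A)%E.
Proof.
apply: le_ereal_inf_tmp => _ [f [bf f0 _] <-]; apply: esum_ge0 => i _.
by rewrite lee_fin L_ge0.
Qed.

Let le_daniell : {homo daniell : A B / A `<=` B >-> (A <= B)%E}.
Proof.
move=> A B AB; apply: ereal_inf_le_tmp => _ [f [bf f0 fB] <-]; exists f => //.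
by split => // x /AB; exact: fB.
Qed.

Let daniell_adherent A (e : R) : 0 < e -> (daniell A < +oo)%E ->
  exists2 f, covers f A &
    (\esum_(i in [set: nat]) (L (f i))%:E <= daniell A + e%:E)%E.
Proof.
move=> e0 Aoo; have Afin : daniell A \is a fin_num by rewrite ge0_fin_numE.
have [_ [f cf <-] fA] := lb_ereal_inf_adherent e0 Afin.
by exists f => //; exact: ltW.
Qed.

(** Covers of the sets A n with excess e / 2^(n+1) are merged into one sequence through a bijection
    of nat with nat * nat. *)
Let daniell_sigma_subadditive : sigma_subadditive daniell.
Proof.
move=> A; have [[i ioo]|] := pselect (exists i, daniell (A i) = +oo%E).
  by rewrite (eseries_pinfty _ _ ioo) ?leey// => n _; rewrite -ltNye (lt_le_trans _ (daniell_ge0 _)).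
rewrite -forallNE => Aoo; apply/lee_addgt0Pr => e e0.
apply: le_trans (epsilon_trick _ _ (ltW e0)) => //.
have /choice[G hG] : forall n, exists f, covers f (A n) /\
    (\esum_(i in [set: nat]) (L (f i))%:E <= daniell (A n) + (e / (2 ^ n.+1)%:R)%:E)%E.
  move=> n; have [||f ? ?] := @daniell_adherent (A n) (e / (2 ^ n.+1)%:R).
  - by rewrite divr_gt0// ltr0n expn_gt0.
  - by rewrite ltey; apply/eqP; exact: Aoo.
  - by exists f.
have /card_esym/ppcard_eqP[b] := card_nat2.
have bij_b : set_bij [set: nat] [set: nat * nat] b by exact: bij.
have setTE : [set: nat * nat] = [set: nat] `*`` (fun=> [set: nat]).
  by apply/seteqP; split.
have G0 n i x : 0 <= G n i x by have [[_ + _] _] := hG n; exact.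
have bG n i : BL (G n i) by have [[+ _ _] _] := hG n; exact.
pose g k := G (b k).1 (b k).2.
have cg : covers g (\bigcup_n A n).
  split; [by move=> k; exact: bG|by move=> k x; exact: G0|].
  move=> x [n _ Ax]; have [[_ _ /(_ x Ax) h] _] := hG n.
  apply: (le_trans h).
  rewrite -(reindex_esum [set: nat] [set: nat * nat] b (fun ni => (G ni.1 ni.2 x)%:E))//.
  rewrite setTE -(esum_esum (a := fun n i => (G n i x)%:E)); last by move=> *; rewrite lee_fin.
  apply: esum_ge; exists [set n]; first by split => //; exact: finite_set1.
  by rewrite fsbig_set1.
apply: (le_trans (daniell_le cg)).
rewrite -(reindex_esum [set: nat] [set: nat * nat] b (fun ni => (L (G ni.1 ni.2))%:E))//.
rewrite setTE -(esum_esum (a := fun n i => (L (G n i))%:E)); last first.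
  by move=> n i _ _; rewrite lee_fin L_ge0.
rewrite nneseries_esumT; last first.
  by move=> n; rewrite adde_ge0// lee_fin divr_ge0// ltW.
by apply: le_esum => n _; have [] := hG n.
Qed.

Let mu : {outer_measure set 'rV[R]_d -> \bar R} := HB.pack daniell
  (isOuterMeasure.Build R _ daniell daniell0 daniell_ge0 le_daniell
    daniell_sigma_subadditive).

(* Dini's theorem and tightness: a countable cover may be truncated. *)
Lemma daniell_setT : daniell setT = 1%E.
Proof.
apply/eqP; rewrite eq_le; apply/andP; split.
  pose f i := if i is 0 then (fun=> 1) else (fun=> 0) : 'rV[R]_d -> R.
  have cf : covers f setT.
    split; [by case=> [|i]; exact: BL_cst|by case=> [|i] x //=|].
    move=> x _; apply: esum_ge; exists [set 0%N]; first by split.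
    by rewrite fsbig_set1.
  rewrite (le_trans (daniell_le cf))// (esumID [set 0%N])//=; last first.
    by have [? ? _] := cf; move=> i _; rewrite lee_fin L_ge0.
  rewrite setTI esum_set1/= ?L1 ?lee_fin// setTI esum1 ?adde0// => -[|i]//= _.
  by rewrite L0.
apply: le_ereal_inf_tmp => _ [f [bf f0 fT] <-].
(* Since 2 e <= e0, (1 - e)^2 >= 1 - e0: one factor 1 - e is lost in truncating the sum, the other
   in the plateau [p]. *)
apply/lee_addgt0Pr => e0 e00; pose e := Num.min e0 1 / 2.
have [e1 ee0 ege0] : [/\ e < 1, e + e <= e0 & 0 < e].
  have : 0 < Num.min e0 1 by rewrite lt_min e00/=.
  have : Num.min e0 1 <= e0 by rewrite ge_min lexx.
  have : Num.min e0 1 <= 1 by rewrite ge_min lexx orbT.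
  by rewrite /e => *; split; lra.
have [r hr] := L_tight ege0.
have cov : near_covering [set x : 'rV[R]_d | `|x| <= r + 1].
  exact/compact_near_coveringP/closed_ball_rV_compact.
(* Partial sums increase, so a neighbourhood on which one of them exceeds 1 - e serves for all later
   ones; compactness makes the index uniform on the ball. *)
have [n _ hn] : \forall n \near \oo,
    [set x : 'rV[R]_d | `|x| <= r + 1] `<=` [set x | 1 - e < \sum_(i < n) f i x].
  apply: cov => x _.
  have : (((1 - e)%:E < \esum_(i in [set: nat]) (f i x)%:E)%E).
    by apply: lt_le_trans (fT x I) => //; rewrite lte_fin; lra.
  rewrite -nneseries_esumT; last by move=> i; rewrite lee_fin.
  move=> hlt; have [n hn] : exists n, 1 - e < \sum_(i < n) f i x.
    apply: contrapT => /forallNP H; move: hlt; apply/negP; rewrite -leNgt.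
    apply: lime_le; first by apply: is_cvg_nneseries => i _ _; rewrite lee_fin.
    apply: nearW => n; rewrite sumEFin lee_fin leNgt big_mkord; apply/negP; exact: H.
  have cS : continuous (fun x => \sum_(i < n) f i x).
    by apply: continuous_sumr => i; exact: BL_continuous.
  have nx : \forall y \near x, 1 - e < \sum_(i < n) f i y.
    exact: (cvgr_gt _ (cS x) _ hn).
  near=> y k => /=; apply: (@lt_le_trans _ _ (\sum_(i < n) f i y)).
    by near: y.
  have nk : (n <= k)%N by near: k; exact: nbhs_infty_ge.
  rewrite -(subnKC nk) big_split_ord/= lerDl; apply: sumr_ge0 => i _; exact: f0.
have {}hn := hn n (leqnn n).
have bp := BL_plateau (d := d) r.
set p := (fun x => _) in bp.
have Lp : 1 - e <= L p.
  have : L (fun x => 1 - p x) <= e.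
    apply: hr.
    - by apply: BLB => //; exact: BL_cst.
    - by move=> x; rewrite subr_ge0 clip_le1 lerBlDr lerDl clip_ge0.
    - by move=> x xr; rewrite /p clip1 ?subrr// addrAC lerDr subr_ge0.
  rewrite LB ?L1//; last exact: BL_cst.
  lra.
have : L (fun x => (1 - e) * p x) <= L (fun x => \sum_(i < n) f i x).
  apply: L_le; [exact: BLZ|exact: BL_sum|].
  move=> x; have [xr|xr] := leP `|x| (r + 1).
    have /= h := ltW (hn x xr); apply: le_trans h.
    by rewrite ler_piMr ?clip_le1// subr_ge0 ltW.
  rewrite /p clip0 ?mulr0; last by rewrite subr_le0 ltW.
  by apply: sumr_ge0 => i _; exact: f0.
rewrite LZ// L_sum// => Lle.
apply: (@le_trans _ _ ((\sum_(i < n) L (f i))%:E + e0%:E)%E).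
  rewrite -EFinD lee_fin -lerBlDr; apply: le_trans Lle.
  have := ler_wpM2l (_ : 0 <= 1 - e) Lp; rewrite subr_ge0 ltW// => /(_ isT).
  by apply: le_trans; nra.
rewrite leeD2r// -nneseries_esumT; last by move=> i; rewrite lee_fin L_ge0.
rewrite -sumEFin -(big_mkord xpredT (fun i => (L (f i))%:E)).
by apply: nneseries_lim_ge => i _ _; rewrite lee_fin L_ge0.
Unshelve. all: by end_near. Qed.

(* The shell {0 < a < 2^-(J+1)} is covered by the telescoping family
   2 (u_(j+1) - u_j), j >= J, where u_j = clip (2^j a) increases to 1_{a > 0}. *)
Lemma daniell_shell (a : 'rV[R]_d -> R) (e : R) : BL a ->
  (forall x, 0 <= a x) -> 0 < e ->
  exists2 k : R, 0 <= k & (daniell [set x | (0 < a x)%R /\ (k * a x < 1)%R] <= e%:E)%E.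
Proof.
move=> ba a0 e0; pose u j x := clip (2 ^+ j * a x).
have bu j : BL (u j).
  rewrite [u j](_ : _ = fun x => clip (2 ^+ j * a x + 0)).
    exact: BL_clip_affine.
  by apply/funext => x; rewrite addr0.
have u_nd j x : u j x <= u j.+1 x.
  by apply: clip_le; rewrite ler_wpM2r// exprS ler_peMl ?exprn_ge0// ler1n.
pose v j := L (u j).
have v_nd : nondecreasing_seq v.
  by apply/nondecreasing_seqP => j; apply: L_le => // x; exact: u_nd.
have v1 j : v j <= 1.
  by rewrite -L1; apply: L_le => //; [exact: BL_cst|move=> x; exact: clip_le1].
have cv : cvgn v.
  apply: nondecreasing_is_cvgn => //; exists 1 => _ [j _ <-]; exact: v1.
have vl j : v j <= limn v by exact: nondecreasing_cvgn_le.
(* [v] is bounded and nondecreasing: beyond [J] it gains at most e / 2, which the factor 2 of the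
   family turns into e. *)
have [J _ hJ] : \forall j \near \oo, limn v - v j <= e / 2.
  have : v @ \oo --> limn v by [].
  move=> /cvgrPdist_le/(_ (e / 2)); rewrite divr_gt0// => /(_ isT).
  by apply: filterS => j; exact/le_trans/ler_norm.
have {}hJ := hJ J (leqnn J).
(* Where k a < 1, 2^J a < 1/2, so u J < 1/2 while u (J + n) reaches 1: twice the increment is at
   least 1. *)
exists (2 * 2 ^+ J); first by rewrite mulr_ge0 ?exprn_ge0.
pose f j x := 2 * (u (J + j).+1 x - u (J + j)%N x).
have bf j : BL (f j) by apply: BLZ; exact: BLB.
have f0 j x : 0 <= f j x by rewrite mulr_ge0// subr_ge0.
have telE (w : nat -> R) n :
    \sum_(0 <= i < n) (2 * (w (J + i).+1 - w (J + i)%N)) = 2 * (w (J + n)%N - w J).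
  rewrite -mulr_sumr; congr (_ * _).
  have := telescope_sumr (fun i => w (J + i)%N) (leq0n n); rewrite addn0 => <-.
  by apply: eq_bigr => i _; rewrite addnS.
have cf : covers f [set x | (0 < a x) /\ 2 * 2 ^+ J * a x < 1].
  split => // x [ax kax]; rewrite -nneseries_esumT; last by move=> i; rewrite lee_fin.
  have [n hn] : exists n, 1 <= 2 ^+ (J + n) * a x.
    have [n hn] : exists n, (a x)^-1 <= n%:R.
      by exists (Num.bound (a x)^-1); rewrite ltW// archi_boundP// invr_ge0.
    exists n; rewrite -ler_pdivrMr// div1r (le_trans hn)// -natrX ler_nat.
    by rewrite (leq_trans (ltnW (ltn_expl n (ltnSn 1))))// leq_exp2l// leq_addl.
  apply: (@le_trans _ _ (\sum_(0 <= i < n) (f i x)%:E)%E); last first.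
    by apply: nneseries_lim_ge => i _ _; rewrite lee_fin.
  rewrite sumEFin lee_fin (telE (u^~ x)) /u clip1// [clip (2 ^+ J * _)]clip_id.
    by lra.
  by rewrite mulr_ge0 ?exprn_ge0//=; lra.
apply: (le_trans (daniell_le cf)).
rewrite -nneseries_esumT; last by move=> i; rewrite lee_fin L_ge0.
apply: lime_le; first by apply: is_cvg_nneseries => i _ _; rewrite lee_fin L_ge0.
apply: nearW => n; rewrite sumEFin lee_fin.
rewrite (eq_bigr (fun i => 2 * (v (J + i).+1 - v (J + i)%N))); last first.
  by move=> i _; rewrite LZ ?LB//; exact: BLB.
by rewrite telE; have := vl (J + n)%N; lra.
Qed.

(** A cover [f] of [X] is split into f u and f (1 - u) with u = clip (k a). These cover the part of
    [X] where k a >= 1 and the part outside [U], for the same total cost; what remains of [X] in [U]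
    lies in the shell, which is small for a suitable [k]. *)
Lemma daniell_caratheodory (U : set 'rV[R]_d) : open U ->
  mu.-caratheodory U.
Proof.
move=> /open_BL_pos[a [ba a01 Ua]]; apply: le_caratheodory_measurable => X.
have a0 x : 0 <= a x by case/andP: (a01 x).
have [Xoo|] := ltP (daniell X) +oo%E; last first.
  by rewrite leye_eq => /eqP XE; rewrite [leRHS]XE leey.
apply/lee_addgt0Pr => e e0; have e20 : 0 < e / 2 by rewrite divr_gt0.
have [f [bf f0 fX] fe] := daniell_adherent e20 Xoo.
have [k k0 hk] := daniell_shell ba a0 e20.
pose u x := clip (k * a x).
have bu : BL u.
  rewrite [u](_ : _ = fun x => clip (k * a x + 0)); first exact: BL_clip_affine.
  by apply/funext => x; rewrite addr0.
have u0 x : 0 <= u x by exact: clip_ge0.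
have u1 x : 0 <= 1 - u x by rewrite subr_ge0 clip_le1.
have bu1 : BL (fun x => 1 - u x) by apply: BLB => //; exact: BL_cst.
have c1 : covers (fun i x => f i x * u x) (X `&` [set x | 1 <= k * a x]).
  split => [i|i x|x [Xx kax]]; [exact: BLM|exact: mulr_ge0|].
  by under eq_esum do rewrite /u clip1// mulr1; exact: fX.
have c2 : covers (fun i x => f i x * (1 - u x)) (X `&` ~` U).
  split => [i|i x|x [Xx Ux]]; [exact: BLM|exact: mulr_ge0|].
  have ax : a x = 0.
    by apply/eqP; rewrite eq_le a0 andbT leNgt; apply/negP => /Ua.
  by under eq_esum do rewrite /u ax mulr0 clip0// subr0 mulr1; exact: fX.
have XU : (daniell (X `&` U) <= daniell (X `&` [set x | (1 <= k * a x)%R]) +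
    daniell [set x | (0 < a x)%R /\ (k * a x < 1)%R])%E.
  apply: le_trans (outer_measureU2 mu _ _); apply: le_daniell => x [Xx /Ua ax].
  by have [?|?] := leP 1 (k * a x); [left|right].
rewrite [e]splitr EFinD addeA.
apply: (@le_trans _ _ ((daniell (X `&` [set x | (1 <= k * a x)%R]) + (e / 2)%:E) +
    daniell (X `&` ~` U))%E).
  by rewrite leeD2r// (le_trans XU)// leeD2l.
rewrite [leLHS]addeAC; apply: leeD2r; apply: le_trans fe.
rewrite (le_trans (leeD (daniell_le c1) (daniell_le c2)))// -esumD; last 2 first.
- by move=> i _; rewrite lee_fin L_ge0//; [exact: BLM|move=> x; exact: mulr_ge0].
- by move=> i _; rewrite lee_fin L_ge0//; [exact: BLM|move=> x; exact: mulr_ge0].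
apply: le_esum => i _; rewrite -EFinD -LD; [|exact: BLM|exact: BLM].
by rewrite lee_fin le_eqVlt; apply/orP; left; apply/eqP; congr L; apply/funext => x; ring.
Qed.

Lemma daniell_probability : exists P : probability (Borel R d) R,
  forall A, P A = daniell A.
Proof.
have borel_cara (A : set (Borel R d)) : measurable A -> mu.-cara.-measurable A.
  apply: (@smallest_sub _ (sigma_algebra setT) (@open 'rV[R]_d)).
    exact: (@sigma_algebra_measurable _ (caratheodory_type mu)).
  by move=> U oU; exact: daniell_caratheodory.
have sa : semi_sigma_additive (daniell : set (Borel R d) -> \bar R).
  move=> F mF tF mU.
  apply: (@caratheodory_measure_sigma_additive _ _ mu F) => // [i|].
    exact: borel_cara.
  exact: borel_cara.
pose M := isMeasure.Build _ (Borel R d) R (daniell : set (Borel R d) -> \bar R) daniell0 daniell_ge0 sa.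
pose PM : {measure set (Borel R d) -> \bar R} := HB.pack (daniell : set (Borel R d) -> \bar R) M.
pose Q := Measure_isProbability.Build _ _ _ PM daniell_setT.
pose P : probability (Borel R d) R := HB.pack (Measure.sort PM) Q.
by exists P.
Qed.

(** For f with values in [0, 1], (n + 1) f is cut into layers [g j]. The layer j + 1 vanishes off
    {(n + 1) f >= j + 1}, a set on which the layer j is 1 and hence alone a cover; so the integral
    of g (j + 1) is at most L (g j). Summing loses one layer, that is 1 / (n + 1). The same bound
    for 1 - f gives equality. *)
Lemma daniell_representation : exists P : probability (Borel R d) R,
  forall f, BL f -> \int[P]_x f x = L f.
Proof.
have [P PE] := daniell_probability; exists P.
have le01 f : BL f -> (forall x, 0 <= f x <= 1) -> \int[P]_x f x <= L f.
  move=> bf f01; apply/ler_addgt0Pr => e e0.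
  have [n hn] : exists n, e^-1 <= n.+1%:R.
    exists (Num.bound e^-1); rewrite ltW// (lt_trans (archi_boundP _)) ?invr_ge0 ?ltW//.
    by rewrite ltr_nat.
  pose g j x := clip (n.+1%:R * f x - j%:R).
  have bg j : BL (g j) by exact: BL_clip_affine.
  have gE x : \sum_(j < n.+1) g j x = n.+1%:R * f x.
    apply: sum_clip; have /andP[f0 f1] := f01 x.
    by rewrite mulr_ge0//= ler_piMr.
  have gle j : \int[P]_x g j.+1 x <= L (g j).
    rewrite -lee_fin (EFin_Rintegral (BL_integrable P (bg j.+1))).
    pose A := [set x : 'rV[R]_d | 1 <= n.+1%:R * f x - j%:R].
    have mA : measurable (A : set (Borel R d)).
      rewrite -[A]setCK; apply: measurableC; apply: sub_sigma_algebra.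
      rewrite (_ : ~` A = (fun x => n.+1%:R * f x - j%:R) @^-1` [set y | y < 1]).
        apply: open_comp => [x _|]; last exact: open_lt.
        by apply: BL_continuous; apply: BLB; [exact: BLZ|exact: BL_cst].
      by apply/seteqP; split => x /=; rewrite /A/= ltNge => /negP.
    apply: (@le_trans _ _ (\int[P]_x (\1_A x)%:E)%E).
      apply: ge0_le_integral => //.
      - by move=> x _; rewrite lee_fin clip_ge0.
      - by apply/measurable_EFinP; exact: BL_measurable.
      - by apply/measurable_EFinP; exact: measurable_indic.
      - move=> x _; rewrite lee_fin indicE; case: (asboolP (A x)) => Ax.
          by rewrite mem_set// clip_le1.
        rewrite memNset//; move: Ax => /negP; rewrite -ltNge => Ax.
        by rewrite /g clip0// -natr1; lra.
    rewrite integral_indic// setIT; have /= -> := PE A.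
    have cg : covers (fun i => if i is 0 then g j else fun=> 0) A.
      split; [by case=> [|i]//; exact: BL_cst|by case=> [|i] x //=; exact: clip_ge0|].
      move=> x Ax; apply: esum_ge; exists [set 0%N]; first by split.
      by rewrite fsbig_set1/= lee_fin /g clip1.
    apply: (le_trans (daniell_le cg)); rewrite (esumID [set 0%N])//=; last first.
      by have [? ? _] := cg; move=> i _; rewrite lee_fin L_ge0.
    rewrite setTI esum_set1/=; last first.
      by rewrite lee_fin L_ge0// => x; exact: clip_ge0.
    rewrite setTI esum1 ?adde0// => -[|i]//= _.
    by rewrite L0.
  have sg : n.+1%:R * \int[P]_x f x <= 1 + n.+1%:R * L f.
    rewrite -RintegralZl//; last exact: BL_integrable.
    under eq_Rintegral do rewrite -gE.
    rewrite Rintegral_sum; last by move=> j; exact: BL_integrable.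
    rewrite big_ord_recl lerD//.
      have := @Rintegral_le_bound _ _ _ P (g 0%N) 1 (BL_measurable (bg 0%N)).
      move=> /(_ _)/(le_trans (ler_norm _)); apply => x.
      by rewrite ger0_norm ?clip_ge0 ?clip_le1.
    rewrite -LZ//; under [in leRHS]eq_fun do rewrite -gE.
    rewrite L_sum// big_ord_recr/= -[leLHS]addr0 lerD//.
      by apply: ler_sum => j _; exact: gle.
    by apply: L_ge0 => // x; exact: clip_ge0.
  rewrite -(ler_pM2l (ltr0Sn R n)) (le_trans sg)// mulrDr addrC lerD2l.
  by rewrite -ler_pdivrMr// div1r.
have eq01 f : BL f -> (forall x, 0 <= f x <= 1) -> \int[P]_x f x = L f.
  move=> bf f01; apply/eqP; rewrite eq_le le01//=.
  have := le01 (fun x => 1 - f x); rewrite LB//; last exact: BL_cst.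
  rewrite RintegralB//; [|exact: BL_integrable (BL_cst 1)|exact: BL_integrable].
  rewrite Rintegral_cstT L1 lerD2l lerN2; apply.
    by apply: BLB => //; exact: BL_cst.
  by move=> x; have /andP[? ?] := f01 x; apply/andP; split; lra.
move=> f bf; have [[B fB] _] := bf.
pose K := `|B| + 1; have K0 : 0 < K by rewrite ltr_wpDl.
have fK x : `|f x| <= K by rewrite (le_trans (fB x))// (le_trans (ler_norm _))// lerDl.
(* As |f| <= K, c f + 1/2 has its values in [0, 1]. *)
pose c := (2 * K)^-1.
have bg : BL (fun x => c * f x + 1 / 2) by apply: BLD; [exact: BLZ|exact: BL_cst].
have bcf : BL (fun x => c * f x) by exact: BLZ.
have bh : BL (fun _ : 'rV[R]_d => (1 / 2 : R)) by exact: BL_cst.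
have := eq01 _ bg.
rewrite LD// RintegralD//; [|exact: BL_integrable bcf|exact: BL_integrable bh].
rewrite RintegralZl//; last exact: BL_integrable.
rewrite LZ// Rintegral_cstT.
have -> : L (fun=> 1 / 2) = 1 / 2.
  rewrite -[RHS]mulr1 -[X in _ = _ * X]L1 -(LZ _ (BL_cst 1)).
  by congr L; apply/funext => x; rewrite mulr1.
move=> h; have c0 : c != 0 by rewrite invr_neq0// mulf_neq0// gt_eqF.
apply: (mulfI c0); apply: (addIr (1 / 2)); apply: h => x.
have := fK x; rewrite ler_norml => /andP[h1 h2].
have cK : c * K = 1 / 2 by rewrite /c invfM -mulrA mulVf ?gt_eqF// mulr1 div1r.
have c_gt0 : 0 < c by rewrite invr_gt0 mulr_gt0.
have := ler_wpM2l (ltW c_gt0) h1; have := ler_wpM2l (ltW c_gt0) h2.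
by rewrite mulrN cK => ? ?; apply/andP; split; lra.
Qed.

End daniell.

(** * The distance d_1 and C^{1,1} functions *)

Section wasserstein_duality.
Context {R : realType} {d : nat}.

(** Proved through coordinates, because pairs carry the product of the two Borel sigma-algebras, to
    which continuity on the product space does not refer directly. *)
Lemma measurable_borel_dist :
  measurable_fun setT (fun z : Borel R d * Borel R d =>
    enorm ((z.1 : 'rV[R]_d) - (z.2 : 'rV[R]_d))).
Proof.
have msqrt : measurable_fun setT (@Num.sqrt R).
  by apply: continuous_measurable_fun; exact: sqrt_continuous.
suff : measurable_fun setT (fun z : Borel R d * Borel R d =>
    \sum_(i < 1) \sum_(j < d) ((z.1 : 'rV[R]_d) - (z.2 : 'rV[R]_d)) i j ^+ 2).
  by move=> h; exact: (measurableT_comp msqrt h).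
apply: measurable_sum => i; apply: measurable_sum => j.
apply: measurable_funX.
have mc : measurable_fun setT (fun x : Borel R d => (x : 'rV[R]_d) i j).
  rewrite (ord1 i); apply: continuous_borel; exact: coord_continuous_rV.
under eq_fun do rewrite !mxE.
apply: measurable_funB.
  by apply: (measurableT_comp (g := fst) mc); exact: measurable_fst.
by apply: (measurableT_comp (g := snd) mc); exact: measurable_snd.
Qed.

(** The easy half of Kantorovich duality: |f x - f y| <= C |x - y| is integrated against a coupling
    of cost less than [e]. *)
Lemma wass1_dual (mu nu : wprob R d 1) (f : 'rV[R]_d -> R) (B C e : R) :
  measurable_fun setT (f : Borel R d -> R) -> (forall x, `|f x| <= B) ->
  0 <= C -> (forall x y, `|f x - f y| <= C * enorm (x - y)) ->
  (wass1 mu nu < e%:E)%E -> `|\int[mu]_x f x - \int[nu]_x f x| <= C * e.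
Proof.
move=> mf fB C0 fC /ereal_inf_lt[_ [pi cpi <-]] pie.
have fi : mu.-integrable setT (EFin \o f) by exact: bounded_integrable mf fB.
have fi' : nu.-integrable setT (EFin \o f) by exact: bounded_integrable mf fB.
pose f1 (z : Borel R d * Borel R d) := f z.1.
pose f2 (z : Borel R d * Borel R d) := f z.2.
have mf1 : measurable_fun setT f1 by apply: measurableT_comp => //; exact: measurable_fst.
have mf2 : measurable_fun setT f2 by apply: measurableT_comp => //; exact: measurable_snd.
have i1 : pi.-integrable setT (EFin \o f1).
  exact: (@bounded_integrable _ _ _ pi f1 B mf1 (fun z => fB z.1)).
have i2 : pi.-integrable setT (EFin \o f2).
  exact: (@bounded_integrable _ _ _ pi f2 B mf2 (fun z => fB z.2)).
have mfE : measurable_fun setT (EFin \o (f : Borel R d -> R)) by exact/measurable_EFinP.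
have e1 : \int[mu]_x f x = \int[pi]_z f1 z.
  rewrite /Rintegral; congr fine.
  have := @integral_pushforward _ _ _ _ _ _ (@measurable_fst _ _ (Borel R d) (Borel R d)) pi setT (EFin \o f) mfE.
  rewrite preimage_setT => <- //.
  apply: eq_measure_integral => A mA _; have [/= <- _] := cpi A mA.
  by rewrite /pushforward; congr (pi _); apply/seteqP; split => -[x y]//= [].
have e2 : \int[nu]_x f x = \int[pi]_z f2 z.
  rewrite /Rintegral; congr fine.
  have := @integral_pushforward _ _ _ _ _ _ (@measurable_snd _ _ (Borel R d) (Borel R d)) pi setT (EFin \o f) mfE.
  rewrite preimage_setT => <- //.
  apply: eq_measure_integral => A mA _; have [/= _ <-] := cpi A mA.
  by rewrite /pushforward; congr (pi _); apply/seteqP; split => -[x y]//= [].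
rewrite e1 e2 -RintegralB//.
have i12 : pi.-integrable setT (EFin \o (f1 \- f2)).
  have := integrableB measurableT i1 i2; exact: eq_integrable.
apply: le_trans (le_normr_Rintegral _ i12) _ => //.
rewrite -lee_fin (EFin_Rintegral (integrable_norm i12)).
have menorm := measurable_borel_dist.
apply: (@le_trans _ _ (\int[pi]_z (C%:E * (enorm ((z.1 : 'rV[R]_d) - z.2))%:E))%E).
  apply: ge0_le_integral => //.
  - by move=> z _; rewrite lee_fin; exact: normr_ge0.
  - by apply/measurable_EFinP; apply: measurableT_comp; [exact: normr_measurable|exact: measurable_funB].
  - by apply: measurable_funeM; exact/measurable_EFinP.
  - by move=> z _; rewrite -EFinM lee_fin; exact: fC.
rewrite ge0_integralZl_EFin//; last 2 first.
- by move=> z _; rewrite lee_fin enorm_ge0.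
- exact/measurable_EFinP.
by rewrite EFinM lee_wpmul2l ?lee_fin// ltW.
Qed.

End wasserstein_duality.

(** * Smooth steps and C^{1,1} partitions of unity *)

Section smoothstep.
Context {R : realType}.

(** The cubic 3 c^2 - 2 c^3 has derivative 6 c (1 - c), zero at both ends of [0, 1], so the
    derivative stays Lipschitz when the argument is clipped. *)
Definition smoothstep (x : R) : R := clip x ^+ 2 * (3 - 2 * clip x).

Lemma smoothstep_le x y : x <= y -> smoothstep x <= smoothstep y.
Proof.
move=> /clip_le; rewrite /smoothstep.
have := clip_ge0 x; have := clip_le1 x; have := clip_ge0 y; have := clip_le1 y.
move: (clip x) (clip y) => a b b1 b0 a1 a0 ab.
rewrite -subr_ge0.
rewrite [leRHS](_ : _ = (b - a) * ((b * (1 - b) + a * (1 - a)) * 2 + (a + b - 2 * a * b))); last by ring.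
rewrite mulr_ge0 ?subr_ge0// addr_ge0//.
  by rewrite mulr_ge0// addr_ge0// mulr_ge0// subr_ge0.
have := mulr_ge0 a0 (_ : 0 <= 1 - b); rewrite subr_ge0 => /(_ b1).
have := mulr_ge0 b0 (_ : 0 <= 1 - a); rewrite subr_ge0 => /(_ a1).
by lra.
Qed.

Lemma smoothstep0 x : x <= 0 -> smoothstep x = 0.
Proof. by move=> x0; rewrite /smoothstep clip0// expr0n mul0r. Qed.

Lemma smoothstep1 x : 1 <= x -> smoothstep x = 1.
Proof. by move=> x0; rewrite /smoothstep clip1//; ring. Qed.

Lemma smoothstep_ge0 x : 0 <= smoothstep x.
Proof. by rewrite mulr_ge0 ?sqr_ge0// subr_ge0; have := clip_le1 x; lra. Qed.

Lemma smoothstep_le1 x : smoothstep x <= 1.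
Proof.
rewrite -(@smoothstep1 (Num.max x 1)); last by rewrite le_max lexx orbT.
by apply: smoothstep_le; rewrite le_max lexx.
Qed.

(** With y = clip x and z = clip (x + v) the remainder is (z - y)^2 (3 - 2 (z + 2 y)) - 6 y (1 - y)
    (v - (z - y)); the bounds 3 v^2 and 6 v^2 add up to 9 v^2. *)
Lemma smoothstep_taylor x v :
  `|smoothstep (x + v) - smoothstep x - 6 * clip x * (1 - clip x) * v|
    <= 9 * v ^+ 2.
Proof.
set y := clip x; set z := clip (x + v).
have [y0 y1] : 0 <= y /\ y <= 1 by rewrite clip_ge0 clip_le1.
have [z0 z1] : 0 <= z /\ z <= 1 by rewrite clip_ge0 clip_le1.
have zy : `|z - y| <= `|v|.
  by apply: le_trans (clip_lipschitz _ _) _; rewrite addrAC subrr add0r.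
have zy2 : (z - y) ^+ 2 <= v ^+ 2.
  by rewrite -[leLHS]real_normK ?num_real// -[leRHS]real_normK ?num_real// ler_pXn2r ?nnegrE.
(* The factor y (1 - y) vanishes when x is outside [0, 1]. If x is inside and x + v outside, the end
   crossed is within |v| of x, and both factors are at most |v|. *)
have dev : `|y * (1 - y) * (v - (z - y))| <= v ^+ 2.
  have [x0|x0] := leP x 0.
    by rewrite /y clip0// !mul0r normr0 sqr_ge0.
  have [x1|x1] := leP 1 x.
    by rewrite /y clip1// subrr mulr0 mul0r normr0 sqr_ge0.
  have xx0 : 0 <= x * (1 - x) by apply: mulr_ge0; lra.
  have yE : y = x by rewrite /y clip_id// !ltW.
  have [xv0|xv0] := leP (x + v) 0.
    rewrite /z clip0// yE -normrN ger0_norm; last first.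
      by rewrite -mulrN; apply: mulr_ge0 => //; lra.
    have xx : x * (1 - x) <= - v by nra.
    have -> : v ^+ 2 = (- v) * (- v) by ring.
    by rewrite -mulrN; apply: ler_pM => //; lra.
  have [xv1|xv1] := leP 1 (x + v).
    rewrite /z clip1// yE ger0_norm; last first.
      by apply: mulr_ge0 => //; lra.
    have xx : x * (1 - x) <= v by nra.
    by rewrite expr2; apply: ler_pM => //; lra.
  have -> : z = x + v by rewrite /z clip_id// !ltW.
  have -> : v - (x + v - y) = 0 by rewrite yE; ring.
  by rewrite mulr0 normr0 sqr_ge0.
rewrite [X in `|X|](_ : _ = (z - y) ^+ 2 * (3 - 2 * (z + 2 * y)) -
    6 * (y * (1 - y) * (v - (z - y)))); last by rewrite /smoothstep -/y -/z; ring.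
apply: (le_trans (ler_normB _ _)).
have b3 : `|3 - 2 * (z + 2 * y)| <= 3 by rewrite ler_norml; apply/andP; split; lra.
have h1 : `|(z - y) ^+ 2 * (3 - 2 * (z + 2 * y))| <= v ^+ 2 * 3.
  by rewrite normrM ger0_norm ?sqr_ge0//; apply: ler_pM => //; exact: sqr_ge0.
by rewrite [`|6 * _|]normrM [`|6|]ger0_norm//; lra.
Qed.

End smoothstep.

Section C11.
Context {R : realType}.

Lemma sum_normr_coord_le (d : nat) (v : 'rV[R]_d) :
  \sum_(l < d) `|v 0 l| <= d%:R * enorm v.
Proof.
rewrite mulr_natl -[X in _ *+ X](card_ord d) -sumr_const.
by apply: ler_sum => l _; exact: normr_le_enorm.
Qed.

(* Bounded C^{1,1} functions: [g] is the gradient. *)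
Definition C11 (d : nat) (f : 'rV[R]_d -> R) :=
  exists B, exists g : 'rV[R]_d -> 'I_d -> R,
  [/\ forall x, `|f x| <= B, forall x l, `|g x l| <= B &
      forall x v, `|f (x + v) - f x - \sum_(l < d) g x l * v 0 l| <= B * sq v].

Context {d : nat}.
Implicit Types f : 'rV[R]_d -> R.

Let linear_le (g : 'I_d -> R) (v : 'rV[R]_d) B : (forall l, `|g l| <= B) ->
  `|\sum_(l < d) g l * v 0 l| <= B * d%:R * enorm v.
Proof.
move=> gB; apply: (le_trans (ler_norm_sum _ _ _)).
apply: (@le_trans _ _ (B * \sum_(l < d) `|v 0 l|)).
  by rewrite mulr_sumr; apply: ler_sum => l _; rewrite normrM ler_wpM2r.
case: d g v gB => [|d'] g v gB; first by rewrite big_ord0 !(mulr0, mul0r).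
rewrite -mulrA ler_wpM2l ?sum_normr_coord_le//.
exact: le_trans (gB ord0).
Qed.

(** Taylor's bound serves for |v| <= 1; for longer increments the bound on [f] gives 2 B <= 2 B
    |v|. *)
Lemma C11_increment f B g :
  (forall x, `|f x| <= B) -> (forall x l, `|g x l| <= B) ->
  (forall x v, `|f (x + v) - f x - \sum_(l < d) g x l * v 0 l| <= B * sq v) ->
  forall x v, `|f (x + v) - f x| <= (B * d%:R + 2 * B) * enorm v.
Proof.
move=> fB gB ft x v; have B0 : 0 <= B by apply: le_trans (fB 0).
have e0 := enorm_ge0 v.
have [v1|v1] := leP (enorm v) 1.
  rewrite -[X in `|X|](subrK (\sum_(l < d) g x l * v 0 l)).
  rewrite (le_trans (ler_normD _ _))// addrC mulrDl lerD//; first exact: linear_le.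
  rewrite (le_trans (ft x v))// -enorm_sqr expr2 mulrA ler_wpM2r//.
  have := ler_wpM2l B0 v1; lra.
rewrite (le_trans (ler_normB _ _))//; have := fB (x + v); have := fB x => h1 h2.
have : 0 <= B * d%:R * enorm v by rewrite !mulr_ge0.
have := ler_wpM2l B0 (ltW v1).
by rewrite mulrDl; lra.
Qed.

Lemma C11_lipschitz f : C11 f ->
  exists2 C, 0 <= C & forall x y, `|f x - f y| <= C * enorm (x - y).
Proof.
move=> [B [g [fB gB ft]]]; exists (B * d%:R + 2 * B).
  have B0 : 0 <= B by apply: le_trans (fB 0).
  by rewrite addr_ge0 ?mulr_ge0.
by move=> x y; have := C11_increment fB gB ft y (x - y); rewrite subrKC.
Qed.

Lemma C11_BL f : C11 f -> BL f.
Proof.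
move=> cf; have [C C0 fC] := C11_lipschitz cf.
have [B [g [fB _ _]]] := cf; split; first by exists B.
exists (C * d%:R) => x y; rewrite (le_trans (fC x y))// -mulrA ler_wpM2l//.
exact: enorm_le_norm.
Qed.

Lemma C11_cst c : C11 (fun _ : 'rV[R]_d => c).
Proof.
exists `|c|, (fun _ _ => 0); split=> //; first by move=> *; rewrite normr0.
move=> x v; rewrite big1 ?subr0 ?subrr ?normr0 ?mulr_ge0 ?sq_ge0// => l _.
by rewrite mul0r.
Qed.

Lemma C11D f1 f2 : C11 f1 -> C11 f2 -> C11 (fun x => f1 x + f2 x).
Proof.
move=> [B [g [fB gB ft]]] [B' [g' [fB' gB' ft']]].
exists (B + B'), (fun x l => g x l + g' x l); split.
- by move=> x; rewrite (le_trans (ler_normD _ _))// lerD.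
- by move=> x l; rewrite (le_trans (ler_normD _ _))// lerD.
move=> x v; under eq_bigr do rewrite mulrDl; rewrite big_split/=.
rewrite [X in `|X|](_ : _ = (f1 (x + v) - f1 x - \sum_(l < d) g x l * v 0 l) +
  (f2 (x + v) - f2 x - \sum_(l < d) g' x l * v 0 l)); last by ring.
by rewrite mulrDl (le_trans (ler_normD _ _))// lerD.
Qed.

(** Besides the two weighted remainders there is the product of the two increments, quadratic
    because both factors are Lipschitz, with the constants [K] and [K']. *)
Lemma C11M f1 f2 : C11 f1 -> C11 f2 -> C11 (fun x => f1 x * f2 x).
Proof.
move=> [B [g [fB gB ft]]] [B' [g' [fB' gB' ft']]].
have B0 : 0 <= B by apply: le_trans (fB 0).
have B'0 : 0 <= B' by apply: le_trans (fB' 0).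
have inc := C11_increment fB gB ft; have inc' := C11_increment fB' gB' ft'.
set K := B * d%:R + 2 * B in inc; set K' := B' * d%:R + 2 * B' in inc'.
have K0 : 0 <= K by rewrite addr_ge0 ?mulr_ge0.
have K'0 : 0 <= K' by rewrite addr_ge0 ?mulr_ge0.
exists (2 * B * B' + K * K'), (fun x l => f1 x * g' x l + f2 x * g x l); split.
- move=> x; rewrite normrM (@le_trans _ _ (B * B'))//; first exact: ler_pM.
  have := mulr_ge0 B0 B'0; have := mulr_ge0 K0 K'0; lra.
- move=> x l; rewrite (le_trans (ler_normD _ _))// !normrM.
  rewrite (@le_trans _ _ (B * B' + B' * B))//; first by rewrite lerD// ler_pM.
  by have := mulr_ge0 K0 K'0; lra.
move=> x v; under eq_bigr do rewrite mulrDl -!mulrA; rewrite big_split/= -!mulr_sumr.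
set G := \sum_(l < d) _; set G' := \sum_(l < d) _.
rewrite [X in `|X|](_ : _ = f1 x * (f2 (x + v) - f2 x - G) +
  (f2 x * (f1 (x + v) - f1 x - G') +
  (f1 (x + v) - f1 x) * (f2 (x + v) - f2 x))); last by ring.
rewrite (le_trans (ler_normD _ _))//.
have h1 : `|f1 x * (f2 (x + v) - f2 x - G)| <= B * (B' * sq v) by rewrite normrM ler_pM.
have h2 : `|f2 x * (f1 (x + v) - f1 x - G')| <= B' * (B * sq v) by rewrite normrM ler_pM.
have h3 : `|(f1 (x + v) - f1 x) * (f2 (x + v) - f2 x)| <= K * K' * sq v.
  by rewrite normrM -enorm_sqr expr2 mulrACA ler_pM.
have := ler_normD (f2 x * (f1 (x + v) - f1 x - G')) ((f1 (x + v) - f1 x) * (f2 (x + v) - f2 x)).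
by lra.
Qed.

Lemma C11_prod I (s : seq I) (f : I -> 'rV[R]_d -> R) : (forall i, C11 (f i)) ->
  C11 (fun x => \prod_(i <- s) f i x).
Proof.
move=> cf; elim: s => [|i s IH].
  by under eq_fun do rewrite big_nil; exact: C11_cst.
by under eq_fun do rewrite big_cons; exact: C11M.
Qed.

Lemma C11_smoothstep (l : 'I_d) a c :
  C11 (fun x : 'rV[R]_d => smoothstep (a * x 0 l + c)).
Proof.
pose ds x : R := 6 * clip x * (1 - clip x).
have ds6 x : `|ds x| <= 6.
  have := clip_ge0 x; have := clip_le1 x; rewrite /ds => h1 h0.
  rewrite ger0_norm; last by rewrite !mulr_ge0// subr_ge0.
  by rewrite -[leRHS]mulr1 -mulrA ler_wpM2l// mulr_ile1//; lra.
pose B := 1 + 6 * `|a| + 9 * a ^+ 2.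
exists B, (fun x k => (k == l)%:R * (a * ds (a * x 0 l + c))); split.
- move=> x; rewrite ger0_norm ?smoothstep_ge0// (le_trans (smoothstep_le1 _))//.
  by rewrite /B -addrA lerDl addr_ge0// mulr_ge0// sqr_ge0.
- move=> x k; rewrite normrM (@le_trans _ _ (6 * `|a|))//.
    rewrite ger0_norm// -[leRHS]mul1r ler_pM//; first by case: (k == l).
    by rewrite normrM mulrC ler_wpM2r.
  by rewrite /B; have := sqr_ge0 a; lra.
move=> x v; rewrite (bigD1 l)//= eqxx mul1r big1 ?addr0; last first.
  by move=> k /negPf ->; rewrite !mul0r.
have := smoothstep_taylor (a * x 0 l + c) (a * v 0 l).
rewrite [a * x 0 l + c + _](_ : _ = a * (x + v) 0 l + c); last by rewrite mxE; ring.
rewrite -/(ds _) (_ : a * ds _ * _ = ds (a * x 0 l + c) * (a * v 0 l)); last by ring.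
move=> /le_trans; apply; rewrite exprMn mulrA.
have vl : v 0 l ^+ 2 <= sq v.
  by rewrite /sq (bigD1 l)//= lerDl sumr_ge0// => k _; exact: sqr_ge0.
have a2 := sqr_ge0 a; apply: ler_pM => //; [by rewrite mulr_ge0|exact: sqr_ge0|].
by rewrite /B; have := normr_ge0 a; lra.
Qed.

End C11.

Section smooth_partition.
Context {R : realType} {d : nat}.
Context (eta : R) (M : nat).
Hypothesis eta0 : 0 < eta.

(** A decreasing chain from 1 to 0: for j <= 2 M, [step j.+1] rises from 0 to 1 over an interval of
    length eta starting at (j - M) eta. The successive differences [bump j] telescope to 1. *)
Let step (j : nat) (t : R) : R :=
  if j is j'.+1 then
    if (j' <= M.*2)%N then smoothstep (eta^-1 * t + (M%:R - j'%:R)) else 0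
  else 1.

Let step_le j t : step j.+1 t <= step j t.
Proof.
rewrite /step; case: j => [|j]; first by rewrite leq0n; exact: smoothstep_le1.
have [jM|jM] := leqP j.+1 M.*2; last first.
  by case: (j <= M.*2)%N => //; exact: smoothstep_ge0.
rewrite (ltnW jM); apply: smoothstep_le; rewrite -natr1; lra.
Qed.

Let bump (j : nat) (t : R) : R := step j t - step j.+1 t.

Let bump_ge0 j t : 0 <= bump j t. Proof. by rewrite subr_ge0. Qed.

Let n := M.*2.+2.

Let sum_bump t : \sum_(j < n) bump j t = 1.
Proof.
rewrite -(big_mkord xpredT (bump^~ t)).
have := telescope_sumr (fun j => - step j t) (leq0n n) => h.
rewrite (eq_bigr (fun j => - step j.+1 t - - step j t)); last first.
  by move=> j _; rewrite /bump opprK addrC.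
by rewrite h /n /step ltnn oppr0 opprK add0r.
Qed.

Let C11_step j (l : 'I_d) : C11 (fun x : 'rV[R]_d => step j (x 0 l)).
Proof.
rewrite /step; case: j => [|j]; first exact: C11_cst.
by case: (j <= M.*2)%N; [exact: C11_smoothstep|exact: C11_cst].
Qed.

Let C11_bump j (l : 'I_d) : C11 (fun x : 'rV[R]_d => bump j (x 0 l)).
Proof.
rewrite /bump; under eq_fun do rewrite -mulN1r; apply: C11D; first exact: C11_step.
by apply: C11M; [exact: C11_cst|exact: C11_step].
Qed.

(** Interior bumps live on intervals of length 2 eta, the first and the last on half-lines where |t|
    >= (M - 1) eta. *)
Let bump_supp j s t : (j < n)%N -> bump j s != 0 -> bump j t != 0 ->
  `|s - t| <= 2 * eta \/
  ((M%:R - 1) * eta <= `|s| /\ (M%:R - 1) * eta <= `|t|).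
Proof.
move=> jn bs bt.
have up i u : bump i.+1 u != 0 -> (i <= M.*2)%N /\ - (M%:R - i%:R) < eta^-1 * u.
  move=> bu; have [iM|iM] := leqP i M.*2; last first.
    by move: bu; rewrite /bump /step leqNgt iM/= leqNgt ltnS (ltnW iM)/= subrr eqxx.
  split=> //; rewrite ltNge; apply/negP => ui; move: bu.
  rewrite /bump /step iM smoothstep0; last by lra.
  case: (i.+1 <= M.*2)%N; last by rewrite subrr eqxx.
  by rewrite smoothstep0 ?subrr ?eqxx// -natr1; lra.
have lo i u : (i <= M.*2)%N -> bump i u != 0 -> eta^-1 * u < 1 - (M%:R - i%:R).
  move=> iM bu; rewrite ltNge; apply/negP => ui; move: bu.
  rewrite /bump /step iM smoothstep1; last by lra.
  case: i iM ui => [|i] iM ui; first by rewrite subrr eqxx.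
  by rewrite (ltnW iM) smoothstep1 ?subrr ?eqxx//; move: ui; rewrite -natr1; lra.
have ei : 0 < eta^-1 by rewrite invr_gt0.
have em u : eta * (eta^-1 * u) = u by rewrite mulrA mulfV ?mul1r// gt_eqF.
have ge u c : c <= eta^-1 * u -> c * eta <= u.
  by move=> h; rewrite -[leRHS]em mulrC ler_pM2l.
have [j0|j0] := posnP j.
  right; move: bs bt; rewrite j0 => /(lo _ _ (leq0n _)) hs /(lo _ _ (leq0n _)) ht.
  by split; rewrite -normrN (le_trans _ (ler_norm _))//; apply: ge; rewrite mulrN; lra.
case: j j0 jn bs bt => // j _ jn bs bt.
have [jM hs] := up _ _ bs; have [_ ht] := up _ _ bt.
have [jM'|jM'] := leqP j.+1 M.*2.
  left; have := lo _ _ jM' bs; have := lo _ _ jM' bt.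
  rewrite -natr1 => ht' hs'.
  have -> : s - t = eta * (eta^-1 * s - eta^-1 * t) by rewrite mulrBr !em.
  rewrite normrM gtr0_norm// mulrC ler_pM2r// ler_norml; apply/andP; split; lra.
have jE : j = M.*2 by apply/eqP; rewrite eqn_leq jM -ltnS.
move: hs ht; rewrite jE -addnn natrD => hs ht; right.
by split; rewrite (le_trans _ (ler_norm _))//; apply: ge; lra.
Qed.

(** Products of one-dimensional bumps, with one index per coordinate; distributing the product over
    the sums gives total 1. *)
Lemma smooth_partition_existence :
  exists (I : finType) (chi : I -> 'rV[R]_d -> R),
  [/\ forall i, C11 (chi i), forall i x, 0 <= chi i x,
      forall x, \sum_i chi i x = 1 &
      forall i x y, chi i x != 0 -> chi i y != 0 ->
        (forall l, `|x 0 l - y 0 l| <= 2 * eta) \/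
        exists l, (M%:R - 1) * eta <= `|x 0 l| /\
                  (M%:R - 1) * eta <= `|y 0 l|].
Proof.
exists {ffun 'I_d -> 'I_n}, (fun (a : {ffun 'I_d -> 'I_n}) (x : 'rV[R]_d) =>
  \prod_(l < d) bump (a l) (x 0 l)); split.
- by move=> a; apply: C11_prod => l; exact: C11_bump.
- by move=> a x; apply: prodr_ge0 => l _; exact: bump_ge0.
- move=> x; rewrite -(bigA_distr_bigA (fun l (j : 'I_n) => bump j (x 0 l))).
  by rewrite big1// => l _; exact: sum_bump.
move=> a x y ax ay; rewrite -implyNp => /existsNP[l /negP xyl]; exists l.
have hx : bump (a l) (x 0 l) != 0 by move: ax; rewrite (bigD1 l)//= mulf_eq0 negb_or => /andP[].
have hy : bump (a l) (y 0 l) != 0 by move: ay; rewrite (bigD1 l)//= mulf_eq0 negb_or => /andP[].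
by have [h|//] := bump_supp (ltn_ord (a l)) hx hy; rewrite h in xyl.
Qed.

End smooth_partition.

(* On sets with bounded second moments, the distance d_1 is controlled by the
   integrals of finitely many C^{1,1} functions. *)
Lemma wass1_le_of_integrals (R : realType) (d : nat) (S e : R) :
  0 <= S -> 0 < e ->
  exists (I : finType) (chi : I -> 'rV[R]_d -> R) (delta : R),
  [/\ forall i, C11 (chi i), 0 < delta &
    forall mu nu : wprob R d 1,
      (\int[mu]_x (sq (x : 'rV[R]_d))%:E <= S%:E)%E ->
      (\int[nu]_x (sq (x : 'rV[R]_d))%:E <= S%:E)%E ->
      (forall i, `|\int[mu]_x chi i x - \int[nu]_x chi i x| <= delta) ->
      (wass1 mu nu <= e%:E)%E].
Proof.
move=> S0 e0.
(* The budget [e] is split into e/3 for the diameter of the patches, e/6 for the second moment of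
   each law and e/3 for the mass exchanged between patches; this fixes [K], [eta] and [delta]. *)
pose K := 12 * (S + 1) / e.
have K0 : 0 < K by rewrite divr_gt0// mulr_gt0// ltr_wpDl.
pose eta := e / (6 * (d%:R + 1)).
have d1 : 0 < d%:R + 1 :> R by rewrite ltr_wpDl.
have eta0 : 0 < eta by rewrite divr_gt0// mulr_gt0.
have [M hM] : exists M : nat, K / eta + 1 <= M%:R.
  exists (Num.bound (K / eta + 1)); rewrite ltW// archi_boundP//.
  by rewrite addr_ge0// divr_ge0// ltW.
have KM : K <= (M%:R - 1) * eta by rewrite -ler_pdivrMr// lerBrDr.
have [I [chi [cchi chi0 chi1 chis]]] := smooth_partition_existence (d := d) M eta0.
pose delta := e / (3 * K * (#|I|%:R + 1)).
have I1 : 0 < #|I|%:R + 1 :> R by rewrite ltr_wpDl.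
have delta0 : 0 < delta by apply: divr_gt0 => //; apply: mulr_gt0 => //; exact: mulr_gt0.
exists I, chi, delta; split=> // mu nu muS nuS munu.
(* A distance t >= K with t^2 <= 2 (|x|^2 + |y|^2) satisfies t <= t^2 / K <= a x + a y. *)
pose a (x : Borel R d) := 2 / K * sq (x : 'rV[R]_d).
have a0 x : 0 <= a x by rewrite mulr_ge0 ?sq_ge0// divr_ge0// ltW.
have msq : measurable_fun setT (fun x : Borel R d => sq (x : 'rV[R]_d)).
  exact: continuous_borel (@sq_continuous _ _).
have ma : measurable_fun setT a by exact: measurable_funM.
pose c := 2 * eta * d%:R.
have c0 : 0 <= c by rewrite !mulr_ge0// ltW.
pose en (z : Borel R d * Borel R d) := enorm ((z.1 : 'rV[R]_d) - (z.2 : 'rV[R]_d)).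
have large x y t : K <= t -> t ^+ 2 <= 2 * (sq x + sq y) ->
    t <= a x + a y.
  move=> Kt h; rewrite /a -mulrDr mulrAC ler_pdivlMr//.
  apply: le_trans h; rewrite expr2 ler_wpM2l// (le_trans _ Kt)// ltW//.
have eglob x y : en (x, y) <= K + (c + a x + a y).
  have [h|h] := leP K (en (x, y)).
    have := large x y _ h; rewrite enorm_sqr => /(_ (sqB_le _ _)); lra.
  by have := a0 x; have := a0 y; lra.
have eloc i x y : chi i x != 0 -> chi i y != 0 -> en (x, y) <= c + a x + a y.
  move=> cx cy; have [h|[l [hx hy]]] := chis i x y cx cy.
    apply: (@le_trans _ _ c); last by have := a0 x; have := a0 y; lra.
    rewrite (le_trans (enorm_le_norm _))// /c mulrC ler_wpM2r//.
    rewrite /Num.norm/= mx_normrE; apply/bigmax_leP; split; first by rewrite mulr_ge0// ltW.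
    by move=> [i' j'] _ /=; rewrite !mxE (ord1 i').
  (* In an outer patch |x|^2 and |y|^2 are both at least K^2, whence K <= a x + a y, which settles
     the distances below [K]. *)
  have coord (z : 'rV[R]_d) : K <= `|z 0 l| -> K ^+ 2 <= sq z.
    move=> Kz; rewrite /sq (bigD1 l)//= -[leLHS]addr0 lerD//; last first.
      by apply: sumr_ge0 => k _; exact: sqr_ge0.
    by rewrite -[leRHS]real_normK ?num_real// ler_pXn2r ?nnegrE// ltW.
  have sx := coord x (le_trans KM hx); have sy := coord y (le_trans KM hy).
  have := sqB_le x y; rewrite -enorm_sqr -/(en (x, y)) => h.
  have [Ke|Ke] := leP K (en (x, y)); first by have := large x y _ Ke h; lra.
  apply: (le_trans (ltW Ke)).
  have KE : K = (2 / K) * (K ^+ 2 / 2) by field; rewrite gt_eqF.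
  have : K <= a x + a y.
    rewrite {1}KE /a -mulrDr ler_wpM2l//; first by rewrite divr_ge0// ltW.
    by have := sqr_ge0 K; lra.
  by lra.
have mchi i : measurable_fun setT (chi i : Borel R d -> R).
  by apply: BL_measurable; exact: C11_BL.
have [pi cpi piE] := partition_coupling mchi chi0 chi1 mu nu (e := en) (a := a) (c := c) (K := K)
  (fun z => enorm_ge0 _) measurable_borel_dist a0 ma c0 (ltW K0) eloc eglob.
apply: (@le_trans _ _ (\int[pi]_z (en z)%:E)%E).
  by apply: ereal_inf_lbound; exists pi => //; exact: cpi.
apply: (le_trans piE).
have ia (P : wprob R d 1) : (\int[P]_x (sq (x : 'rV[R]_d))%:E <= S%:E)%E ->
    (\int[P]_x (a x)%:E <= (2 / K * S)%:E)%E.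
  move=> PS; under eq_integral do rewrite EFinM.
  rewrite ge0_integralZl_EFin//; last 3 first.
  - by move=> x _; rewrite lee_fin sq_ge0.
  - exact/measurable_EFinP.
  - by rewrite divr_ge0// ltW.
  by rewrite [leRHS]EFinM lee_wpmul2l// lee_fin divr_ge0// ltW.
apply: (@le_trans _ _ ((c%:E + (2 / K * S)%:E + (2 / K * S)%:E) + (K * (#|I|%:R * delta))%:E)%E).
  apply: leeD; first by rewrite leeD ?leeD2l ?ia.
  have -> : #|I|%:R * delta = \sum_(i : I) delta by rewrite sumr_const mulr_natl.
  rewrite lee_fin; apply: ler_wpM2l; [exact: ltW|apply: ler_sum => i _].
  exact: munu.
rewrite -!EFinD lee_fin.
have h1 : c <= e / 3.
  rewrite /c /eta [leLHS](_ : _ = e / 3 * (d%:R / (d%:R + 1))); last by field; rewrite gt_eqF.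
  by rewrite ler_piMr ?divr_ge0 ?ltW// ltr_pdivrMr// mul1r ltrDl.
have h2 : 2 / K * S <= e / 6.
  rewrite /K [leLHS](_ : _ = e / 6 * (S / (S + 1))); last by field; rewrite ?gt_eqF// ltr_wpDl.
  by rewrite ler_piMr ?divr_ge0 ?ltW// ltr_pdivrMr ?mul1r ?ltrDl// ltr_wpDl.
have h3 : K * (#|I|%:R * delta) <= e / 3.
  rewrite /delta [leLHS](_ : _ = e / 3 * (#|I|%:R / (#|I|%:R + 1))); last by field; rewrite !gt_eqF.
  by rewrite ler_piMr ?divr_ge0 ?ltW// ltr_pdivrMr// mul1r ltrDl.
lra.
Qed.

(** * Sums over the grid *)

Section countable_sums.
Context {R : realType}.
Local Open Scope ereal_scope.

Lemma esum_finsupp (T : choiceType) (J : finType) (node : J -> T)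
    (a : T -> \bar R) : injective node -> (forall i, 0 <= a i) ->
  (forall i, (forall j, node j <> i) -> a i = 0) ->
  \esum_(i in [set: T]) a i = \sum_j a (node j).
Proof.
move=> inj a0 aout; pose r := [seq node j | j <- enum J].
have -> : \esum_(i in [set: T]) a i = \esum_(i in [set` r]) a i.
  rewrite [RHS]esum_mkcond; apply: eq_esum => i _.
  case: ifPn => // ir; apply: aout => j ji; move/negP: ir; apply.
  by rewrite inE/= -ji; apply/mapP; exists j => //; rewrite mem_enum.
rewrite esum_fset; [|exact: finite_seq|by move=> i _].
rewrite -fsbig_seq//; last by rewrite map_inj_uniq// enum_uniq.
by rewrite big_map big_enum.
Qed.

(** Summing over the codes of the elements of [I] makes results on series available; numbers that
    are not codes contribute 0. *)
Lemma esum_nneseries (I : countType) (a : I -> \bar R) :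
  (forall i, 0 <= a i) ->
  \esum_(i in [set: I]) a i = \sum_(n <oo) oapp a 0 (pickle_inv n).
Proof.
move=> a0; have oa0 n : 0 <= oapp a 0 (pickle_inv n :> option I).
  by case: (pickle_inv n).
rewrite nneseries_esumT//.
transitivity (\esum_(n in range (@pickle I)) oapp a 0 (pickle_inv n)); last first.
  rewrite esum_mkcond; apply: eq_esum => n _; case: ifPn => // nI.
  case E : (pickle_inv n) => [i|//]; exfalso; move/negP: nI; apply.
  by rewrite inE; exists i => //; have := @pickle_invK I n; rewrite E.
rewrite (reindex_esum [set: I] (range (@pickle I)) (@pickle I)); last first.
  split; [by move=> i _; exists i|by move=> x y _ _; exact: (pcan_inj pickleK_inv)|].
  by move=> _ [i _ <-]; exists i.
by apply: eq_esum => i _; rewrite pickleK_inv.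
Qed.

Lemma esumZl (I : countType) (a : I -> \bar R) (c : R) : (0 <= c)%R ->
  (forall i, 0 <= a i) ->
  \esum_(i in [set: I]) (c%:E * a i) = c%:E * \esum_(i in [set: I]) a i.
Proof.
move=> c0 a0; rewrite !esum_nneseries//; last by move=> i; rewrite mule_ge0.
rewrite -nneseriesZl; last by move=> n _; case: (pickle_inv n).
by apply: eq_eseriesr => n _; case: (pickle_inv n) => //=; rewrite mule0.
Qed.

Lemma esum_swap (I J : choiceType) (a : I -> J -> \bar R) :
  (forall i j, 0 <= a i j) ->
  \esum_(i in [set: I]) \esum_(j in [set: J]) a i j =
  \esum_(j in [set: J]) \esum_(i in [set: I]) a i j.
Proof.
move=> a0; rewrite !esum_esum//.
rewrite (reindex_esum ([set: I] `*`` fun=> [set: J]) ([set: J] `*`` fun=> [set: I])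
  (fun ij => (ij.2, ij.1)))//.
split; [by move=> []|by move=> [? ?] [? ?] _ _ [-> ->]|].
by move=> [j i] _; exists (i, j).
Qed.

Lemma integral_esum_dirac dT (T : measurableType dT) (I : countType)
    (w : I -> R) (x : I -> T) (P : {measure set T -> \bar R}) (f : T -> \bar R) :
  (forall i, (0 <= w i)%R) ->
  (forall A, measurable A ->
    P A = \esum_(i in [set: I]) ((w i)%:E * \d_(x i) A)) ->
  (forall y, 0 <= f y) -> measurable_fun setT f ->
  \int[P]_y f y = \esum_(i in [set: I]) ((w i)%:E * f (x i)).
Proof.
move=> w0 PE f0 mf.
pose W i : {nonneg R} := NngNum (w0 i).
pose m n : {measure set T -> \bar R} :=
  if pickle_inv n is Some i then mscale (W i) \d_(x i) else mzero.
transitivity (\int[mseries m 0]_y f y).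
  apply: eq_measure_integral => A mA _.
  rewrite PE// /mseries esum_nneseries; last first.
    by move=> i; rewrite mule_ge0 ?lee_fin.
  by apply: eq_eseriesr => n _; rewrite /m; case: (pickle_inv n).
rewrite ge0_integral_measure_series// esum_nneseries; last first.
  by move=> i; rewrite mule_ge0 ?lee_fin.
apply: eq_eseriesr => n _; rewrite /m; case: (pickle_inv n) => [i|]/=.
  by rewrite ge0_integral_mscale// integral_dirac// diracT mul1e.
exact: integral_measure_zero.
Qed.

End countable_sums.

Section q1_interpolation.
Context {R : realType} {d : nat} (rho : R).
Hypothesis rho0 : 0 < rho.
Context (y : 'rV[R]_d).

Let base (l : 'I_d) : int := Num.floor (y 0 l / rho).
Let frac (l : 'I_d) : R := y 0 l / rho - (base l)%:~R.

Let frac01 l : 0 <= frac l <= 1.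
Proof.
rewrite subr_ge0 floor_le/= lerBlDl; have /andP[_] := floor_itv (y 0 l / rho).
by rewrite intrD => /ltW.
Qed.

(** The corners of the grid cube that contains [y]: [a l] tells whether the upper end is taken in
    the coordinate l. *)
Let node (a : {ffun 'I_d -> bool}) : 'rV[int]_d :=
  \row_l (base l + (a l : nat)%:Z).

Let weight (l : 'I_d) (b : bool) : R := if b then frac l else 1 - frac l.

Let shift (l : 'I_d) (b : bool) : R := (b%:R - frac l) * rho.

Let node_inj : injective node.
Proof.
move=> a a' /rowP e; apply/ffunP => l; have := e l; rewrite !mxE => /addrI.
by case: (a l); case: (a' l).
Qed.

Let grid_node a l : grid rho (node a) 0 l - y 0 l = shift l (a l).
Proof.
rewrite !mxE /shift /frac intrD mulrBl mulrBl divfK ?gt_eqF//.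
by rewrite -[in LHS]pmulrn; ring.
Qed.

Let beta_node a : beta rho (node a) y = \prod_l weight l (a l).
Proof.
apply: eq_bigr => l _; rewrite distrC grid_node /shift normrM (gtr0_norm rho0).
rewrite mulfK ?gt_eqF// /weight; have /andP[h0 h1] := frac01 l.
case: (a l); first by rewrite ger0_norm ?subr_ge0// subKr max_l.
by rewrite sub0r normrN ger0_norm// max_l// subr_ge0.
Qed.

Let beta_out i : (forall a, node a <> i) -> beta rho i y = 0.
Proof.
move=> ni; suff [l hl] : exists l, 1 <= `|y 0 l - grid rho i 0 l| / rho.
  by rewrite /beta (bigD1 l)//= max_r ?mul0r// subr_le0.
apply: contrapT => /forallNP h.
apply: (ni [ffun l => i 0 l == base l + 1]); apply/rowP => l; rewrite !mxE ffunE.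
have := h l => /negP; rewrite -ltNge.
have -> : y 0 l - grid rho i 0 l = (y 0 l / rho - (i 0 l)%:~R) * rho.
  by rewrite /grid mxE mulrBl divfK ?gt_eqF.
rewrite normrM (gtr0_norm rho0) mulfK ?lt0r_neq0// ltr_norml => /andP[h1 h2].
have /andP[f1 f2] := floor_itv (y 0 l / rho); rewrite -/(base l) in f1 f2.
have b1 : (base l - 1 < i 0 l)%R.
  by rewrite -(ltr_int R) intrB; lra.
have b2 : (i 0 l < base l + 1 + 1)%R.
  by rewrite -(ltr_int R) !intrD; move: f2; rewrite intrD; lra.
case: eqVneq => [->//|ne] /=.
lia.
Qed.

Let sum_weight l : \sum_b weight l b = 1.
Proof. by rewrite big_bool /= addrC subrK. Qed.

Let sum_prod_weight : \sum_(a : {ffun 'I_d -> bool}) \prod_l weight l (a l) = 1.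
Proof. by rewrite -bigA_distr_bigA big1. Qed.

Let weight_ge0 l b : 0 <= weight l b.
Proof. by rewrite /weight; have /andP[h0 h1] := frac01 l; case: b; lra. Qed.

(** In each coordinate the two weights balance the two displacements; this is the exactness of Q_1
    interpolation on affine functions. *)
Let sum_prod_shift k :
  \sum_(a : {ffun 'I_d -> bool}) (\prod_l weight l (a l)) * shift k (a k) = 0.
Proof.
transitivity (\sum_(a : {ffun 'I_d -> bool})
    \prod_l (weight l (a l) * if l == k then shift l (a l) else 1)).
  apply: eq_bigr => a _; rewrite big_split/=; congr (_ * _).
  by rewrite (bigD1 k)//= eqxx big1 ?mulr1// => l /negPf ->.
rewrite -(bigA_distr_bigA (fun l b => weight l b * if l == k then shift l b else 1)).
have E0 : \sum_b weight k b * shift k b = 0.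
  by rewrite big_bool /weight /shift /=; ring.
by rewrite (bigD1 k)//= eqxx E0 mul0r.
Qed.

Let shift_le l b : `|shift l b| <= rho.
Proof.
rewrite /shift normrM (gtr0_norm rho0); apply: ler_piMl; first exact: ltW.
have /andP[? ?] := frac01 l; rewrite ler_norml; case: b => /=; apply/andP; split; lra.
Qed.

(** The weights form a probability on the corners with mean [y], so the gradient term averages to 0
    and only the remainder is left, with |z - y|^2 <= d rho^2 at every corner z. The witness [v] is
    the value at [y] of the interpolant of [f]. *)
Lemma q1_interpolation (f : 'rV[R]_d -> R) (g : 'I_d -> R) (C : R) :
  (forall z, 0 <= f z) ->
  (forall z, `|f z - f y - \sum_(l < d) g l * (z - y) 0 l| <= C * sq (z - y)) ->
  exists v : R, [/\ (\esum_(i in [set: 'rV[int]_d])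
        (beta rho i y * f (grid rho i))%:E = v%:E)%E, 0 <= v &
      `|v - f y| <= C * d%:R * rho ^+ 2].
Proof.
move=> f0 ft.
have beta0 i : 0 <= beta rho i y.
  by apply: prodr_ge0 => l _; rewrite le_max lexx orbT.
pose p (a : {ffun 'I_d -> bool}) := \prod_l weight l (a l).
have p0 a : 0 <= p a by apply: prodr_ge0.
exists (\sum_a p a * f (grid rho (node a))); split.
- rewrite (esum_finsupp node_inj).
  + by rewrite sumEFin; congr EFin; apply: eq_bigr => a _; rewrite beta_node.
  + by move=> i; rewrite lee_fin mulr_ge0.
  + by move=> i /beta_out ->; rewrite mul0r.
- by apply: sumr_ge0 => a _; rewrite mulr_ge0.
pose G (a : {ffun 'I_d -> bool}) := \sum_(l < d) g l * shift l (a l).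
have nodeE a l : (grid rho (node a) - y) 0 l = shift l (a l).
  by rewrite -grid_node !mxE.
have GE a : \sum_(l < d) g l * (grid rho (node a) - y) 0 l = G a.
  by apply: eq_bigr => l _; rewrite nodeE.
have pG : \sum_a p a * G a = 0.
  under eq_bigr do rewrite mulr_sumr; rewrite exchange_big/= big1// => l _.
  under eq_bigr do rewrite mulrCA; by rewrite -mulr_sumr sum_prod_shift mulr0.
have sqn a : sq (grid rho (node a) - y) <= d%:R * rho ^+ 2.
  rewrite mulr_natl -[X in _ *+ X](card_ord d) -sumr_const; apply: ler_sum => l _.
  rewrite nodeE -[leLHS]real_normK ?num_real// ler_pXn2r ?nnegrE//.
  exact: ltW.
have -> : \sum_a p a * f (grid rho (node a)) - f y =
    \sum_a p a * (f (grid rho (node a)) - f y - G a).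
  under [in RHS]eq_bigr do rewrite 2!mulrBr.
  by rewrite !sumrB pG subr0 -[in RHS]mulr_suml sum_prod_weight mul1r.
(* The sign of [C] is not given: for d > 0 it follows from the Taylor bound at y + (1, ..., 1),
   while for d = 0 both sides vanish. *)
have [d0|d0] := posnP d.
  have s0 (z : 'rV[R]_d) : sq z = 0.
    by rewrite /sq big1// => l _; have := ltn_ord l; rewrite [X in (_ < X)%N]d0.
  rewrite big1 ?normr0 ?d0 ?mulr0 ?mul0r// => a _.
  have := ft (grid rho (node a)); rewrite s0 mulr0 normr_le0 GE => /eqP ->.
  by rewrite mulr0.
have C0 : 0 <= C.
  have := le_trans (normr_ge0 _) (ft (y + const_mx 1)); rewrite addrAC subrr add0r.
  rewrite pmulr_lge0// /sq (bigD1 (Ordinal d0))//= mxE expr1n ltr_wpDr//.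
  by apply: sumr_ge0 => l _; exact: sqr_ge0.
rewrite (le_trans (ler_norm_sum _ _ _))//.
apply: (@le_trans _ _ (\sum_a p a * (C * d%:R * rho ^+ 2))); last first.
  by rewrite -mulr_suml sum_prod_weight mul1r.
apply: ler_sum => a _; rewrite normrM (ger0_norm (p0 a)) ler_wpM2l//.
by rewrite -GE (le_trans (ft _))// -mulrA ler_wpM2l.
Qed.

End q1_interpolation.

(** * The random walk of the scheme *)

(** Inside a cell the increment of a piecewise affine function is a fraction of its nodal increment
    and inherits the slope bound; the increments are then added cell by cell. The slope bound is
    asked only of cells that meet [u, v], so that it can be a local one. *)
Lemma piecewise_affine_increment (R : realType) (A : R -> R) (h c eta u v : R)
    (N : nat) : 0 < h -> 0 <= eta ->
  (forall k t, (k < N)%N -> k%:R * h <= t <= k.+1%:R * h ->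
    A t = (t - k%:R * h) / h * A (k.+1%:R * h) +
          (k.+1%:R * h - t) / h * A (k%:R * h)) ->
  (forall k, (k < N)%N -> u <= k.+1%:R * h -> k%:R * h <= v ->
    `|A (k.+1%:R * h) - A (k%:R * h) - c * h| <= eta * h) ->
  0 <= u -> v <= N%:R * h ->
  forall s t, u <= s -> s <= t -> t <= v ->
  `|A t - A s - c * (t - s)| <= eta * (t - s).
Proof.
move=> h0 eta0 aff slope u0 vN s t us st tv.
have cell k s' t' : (k < N)%N -> k%:R * h <= s' -> s' <= t' -> t' <= k.+1%:R * h ->
    u <= s' -> t' <= v -> `|A t' - A s' - c * (t' - s')| <= eta * (t' - s').
  move=> kN ks st' tk us' tv'.
  rewrite (aff k t') ?(le_trans ks)// (aff k s') ?ks ?(le_trans st')//.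
  have hk := slope k kN (le_trans us' (le_trans st' tk)) (le_trans ks (le_trans st' tv')).
  have E : k.+1%:R * h = k%:R * h + h by rewrite -natr1; ring.
  rewrite [X in `|X|](_ : _ = (t' - s') / h *
      (A (k.+1%:R * h) - A (k%:R * h) - c * h)); last first.
    by rewrite E; field; rewrite gt_eqF.
  have ts0 : 0 <= t' - s' by rewrite subr_ge0.
  rewrite normrM ger0_norm ?divr_ge0// ?(ltW h0)//.
  rewrite -mulrA [eta * _]mulrC ler_wpM2l//.
  by rewrite mulrC ler_pdivrMr.
suff H k : (k <= N)%N -> forall t', s <= t' -> t' <= v -> t' <= k%:R * h ->
    `|A t' - A s - c * (t' - s)| <= eta * (t' - s).
  by apply: (H N) => //; exact: le_trans vN.
elim: k => [|k IH] kN t' st' tv' tk.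
  have -> : t' = s.
    apply/eqP; rewrite eq_le st' andbT (le_trans tk)// mul0r; exact: le_trans us.
  by rewrite !subrr mulr0 subrr normr0 mulr0.
have [tk'|tk'] := leP t' (k%:R * h); first exact: IH (ltnW kN) _ _ _ tk'.
have [sk|sk] := leP s (k%:R * h).
  have h1 := cell k (k%:R * h) t' kN (lexx _) (ltW tk') tk (le_trans us sk) tv'.
  have h2 := IH (ltnW kN) (k%:R * h) sk (le_trans (ltW tk') tv') (lexx _).
  rewrite [X in `|X|](_ : _ = (A t' - A (k%:R * h) - c * (t' - k%:R * h)) +
    (A (k%:R * h) - A s - c * (k%:R * h - s))); last by ring.
  by rewrite (le_trans (ler_normD _ _))//; lra.
exact: cell k s t' kN (ltW sk) st' tk us tv'.
Qed.

Lemma continuous_rV (R : realType) (d : nat) (T : topologicalType)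
    (F : T -> 'rV[R]_d) :
  (forall l, continuous (fun x => F x 0 l)) -> continuous F.
Proof.
move=> cF x P [Q hQ QP].
suff : \forall y \near x, forall i j, Q i j (F y i j).
  by apply: filterS => y hy; exact: QP.
apply: filter_forall => i; apply: filter_forall => j.
rewrite (ord1 i); exact: cF j x _ (hQ 0 j).
Qed.

Section random_walk.
Context {R : realType} {d r : nat}.
Hypothesis r0 : (0 < r)%N.
Context (h : R) (h0 : 0 < h).
Context (b : 'rV[R]_d -> 'rV[R]_d) (sigma : 'rV[R]_d -> 'M[R]_(d, r)).
Implicit Types f : 'rV[R]_d -> R.

Definition jump (e : R) (l : 'I_r) (x : 'rV[R]_d) : 'rV[R]_d :=
  h *: b x + (e * Num.sqrt (r%:R * h)) *: (col l (sigma x))^T.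

(** Transition operator of the walk whose 2 r jumps from [x] are equally likely, before
    interpolation on the grid. *)
Definition avg f (x : 'rV[R]_d) : R :=
  (2 * r%:R)^-1 * \sum_(l < r) (f (x + jump 1 l x) + f (x + jump (-1) l x)).

Let rR0 : 0 < r%:R :> R. Proof. by rewrite ltr0n. Qed.

Let r2 : 0 < 2 * r%:R :> R. Proof. by rewrite mulr_gt0. Qed.

Lemma avg_cst c x : avg (fun=> c) x = c.
Proof.
rewrite /avg sumr_const card_ord -mulr_natl; field; rewrite gt_eqF//.
Qed.

Lemma avgD f f' x : avg (fun x => f x + f' x) x = avg f x + avg f' x.
Proof.
rewrite /avg -mulrDr -big_split/=; congr (_ * _); apply: eq_bigr => l _; ring.
Qed.

Lemma avg_le f f' x : (forall x, f x <= f' x) -> avg f x <= avg f' x.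
Proof.
move=> ff; rewrite ler_wpM2l ?invr_ge0 ?(ltW r2)//.
by apply: ler_sum => l _; rewrite lerD.
Qed.

Lemma avg_bounded f B x : (forall x, `|f x| <= B) -> `|avg f x| <= B.
Proof.
move=> fB; have fB' y : - B <= f y <= B by rewrite -ler_norml.
rewrite ler_norml; apply/andP; split.
  by rewrite -(avg_cst (- B) x); apply: avg_le => y; have /andP[] := fB' y.
by rewrite -[leRHS](avg_cst _ x); apply: avg_le => y; have /andP[] := fB' y.
Qed.

(** The cross terms of drift and noise cancel between opposite jumps; the factor r in sqrt (r h)
    makes up for picking each column with probability 1/r. *)
Lemma sum_jump_sq x :
  \sum_(l < r) (sq (jump 1 l x) + sq (jump (-1) l x)) =
  2 * r%:R * (h ^+ 2 * sq (b x) + h * enorm (sigma x) ^+ 2).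
Proof.
have sE : Num.sqrt (r%:R * h) ^+ 2 = r%:R * h by rewrite sqr_sqrtr// mulr_ge0// ltW.
have jE l : sq (jump 1 l x) + sq (jump (-1) l x) =
    2 * (h ^+ 2 * sq (b x)) + 2 * (r%:R * h) * \sum_(i < d) sigma x i l ^+ 2.
  rewrite -sE /sq !mulr_sumr -!big_split/=; apply: eq_bigr => i _.
  by rewrite !mxE; ring.
under eq_bigr do rewrite jE; rewrite big_split/= sumr_const card_ord -mulr_sumr.
by rewrite enorm_sqrE exchange_big/= -mulr_natl; ring.
Qed.

(* The gradient contributions of the two symmetric jumps cancel up to the drift. *)
Lemma avg_taylor f g C x :
  (forall v, `|f (x + v) - f x - \sum_(l < d) g l * v 0 l| <= C * sq v) ->
  `|avg f x - f x - h * \sum_(i < d) g i * b x 0 i| <=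
     C * (h ^+ 2 * sq (b x) + h * enorm (sigma x) ^+ 2).
Proof.
move=> ft.
pose rem v := f (x + v) - f x - \sum_(l < d) g l * v 0 l.
have -> : avg f x - f x - h * \sum_(i < d) g i * b x 0 i =
    (2 * r%:R)^-1 * \sum_(l < r) (rem (jump 1 l x) + rem (jump (-1) l x)).
  transitivity ((2 * r%:R)^-1 * \sum_(l < r) ((f (x + jump 1 l x) + f (x + jump (-1) l x)) -
      (2 * (f x + h * \sum_(i < d) g i * b x 0 i)))).
    rewrite sumrB mulrBr -/(avg f x) sumr_const card_ord -[X in _ = _ - _ * X]mulr_natl.
    by field; rewrite gt_eqF.
  congr (_ * _); apply: eq_bigr => l _; rewrite /rem.
  suff -> : 2 * (f x + h * \sum_(i < d) g i * b x 0 i) = 2 * f x +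
      (\sum_(i < d) g i * (jump 1 l x) 0 i + \sum_(i < d) g i * (jump (-1) l x) 0 i) by ring.
  rewrite -big_split/= mulrDr; congr (_ + _); rewrite !mulr_sumr; apply: eq_bigr => i _.
  by rewrite !mxE; ring.
rewrite normrM ger0_norm ?invr_ge0 ?(ltW r2)//.
rewrite -ler_pdivlMl ?invr_gt0// invrK mulrCA -sum_jump_sq mulr_sumr.
apply: (le_trans (ler_norm_sum _ _ _)); apply: ler_sum => l _.
by rewrite (le_trans (ler_normD _ _))// mulrDr; apply: lerD; exact: ft.
Qed.

Lemma avg_continuous f : continuous b -> continuous sigma -> continuous f ->
  continuous (avg f).
Proof.
move=> cb cs cf; apply: (@continuous_mulr _ _ (fun=> (2 * r%:R)^-1) (fun x => \sum_(l < r) _)).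
  exact: continuous_cstr.
have cj e l : continuous (fun x : 'rV[R]_d => x + jump e l x).
  rewrite /jump; apply: continuous_rV => i.
  have cb' : continuous (fun x => b x 0 i).
    move=> x; apply: (@continuous_comp _ _ _ b (fun y => y 0 i)); first exact: cb.
    exact: coord_continuous_rV.
  have cs' : continuous (fun x => sigma x i l).
    move=> x; apply: (@continuous_comp _ _ _ sigma (fun y => y i l)); first exact: cs.
    exact: coord_continuous.
  under eq_fun do rewrite !mxE.
  apply: continuous_addr; first exact: coord_continuous_rV.
  by apply: continuous_addr; apply: continuous_mulr => //; exact: continuous_cstr.
have cfj e l : continuous (fun x : 'rV[R]_d => f (x + jump e l x)).
  move=> x; apply: (@continuous_comp _ _ _ (fun x : 'rV[R]_d => x + jump e l x) f); first exact: cj.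
  exact: cf.
by apply: continuous_sumr => l; apply: continuous_addr.
Qed.

Lemma growth_sq_le C x : 0 <= C ->
  enorm (b x) + enorm (sigma x) <= C * (1 + enorm x) ->
  sq (b x) <= 2 * C ^+ 2 * (1 + sq x) /\
  enorm (sigma x) ^+ 2 <= 2 * C ^+ 2 * (1 + sq x).
Proof.
move=> C0 gr; have eb := enorm_ge0 (b x); have es := enorm_ge0 (sigma x).
have ex := enorm_ge0 x.
have bd : (C * (1 + enorm x)) ^+ 2 <= 2 * C ^+ 2 * (1 + sq x).
  rewrite exprMn [leRHS](_ : _ = C ^+ 2 * (2 * (1 + sq x))); last by ring.
  rewrite ler_wpM2l ?sqr_ge0// -enorm_sqr.
  by have := sqr_ge0 (1 - enorm x); nra.
have c0 : 0 <= C * (1 + enorm x) by rewrite mulr_ge0// addr_ge0.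
split; apply: le_trans bd; rewrite -?enorm_sqr ler_pXn2r ?nnegrE//; lra.
Qed.

(** Taylor's formula for |x|^2 has remainder exactly |v|^2, so [avg_taylor] applies with constant 1;
    the drift is absorbed by 2 x.b <= |x|^2 + |b|^2. *)
Lemma avg_sq_le C T x : 0 <= C -> h <= T ->
  enorm (b x) + enorm (sigma x) <= C * (1 + enorm x) ->
  avg (@sq R d) x <= sq x + h * ((1 + 2 * C ^+ 2 * (2 + T)) * (1 + sq x)).
Proof.
move=> C0 hT gr; have [hb hs] := growth_sq_le C0 gr.
have sqE v : sq (x + v) - sq x - \sum_(l < d) (2 * x 0 l) * v 0 l = sq v.
  rewrite /sq -!sumrB; apply: eq_bigr => l _; rewrite !mxE; ring.
have /(_ _)/(le_trans (ler_norm _)) := @avg_taylor (@sq R d) (fun l => 2 * x 0 l) 1 x.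
rewrite mul1r => H.
have {}H : avg (@sq R d) x - sq x - h * \sum_(i < d) 2 * x 0 i * b x 0 i <=
    h ^+ 2 * sq (b x) + h * enorm (sigma x) ^+ 2.
  by apply: H => v; rewrite sqE mul1r ger0_norm ?sq_ge0.
have cross : \sum_(i < d) 2 * x 0 i * b x 0 i <= sq x + sq (b x).
  rewrite -big_split/=; apply: ler_sum => i _.
  by have := sqr_ge0 (x 0 i - b x 0 i); nra.
have := ler_wpM2l (ltW h0) cross; have sb := sq_ge0 (b x); have sx := sq_ge0 x.
have h2 : h ^+ 2 * sq (b x) <= h * (T * sq (b x)).
  by rewrite expr2 -mulrA ler_wpM2l ?(ltW h0)// ler_wpM2r.
have T0 : 0 <= T by apply: le_trans hT; exact: ltW.
have h3 : h * (sq x + sq (b x) + T * sq (b x) + enorm (sigma x) ^+ 2) <=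
    h * ((1 + 2 * C ^+ 2 * (2 + T)) * (1 + sq x)).
  rewrite ler_wpM2l ?(ltW h0)//.
  have := ler_wpM2l T0 hb.
  move: (sq (b x)) (enorm (sigma x) ^+ 2) hb hs => B S hb hs hTB.
  rewrite [leRHS](_ : _ = 1 + sq x + 2 * C ^+ 2 * (1 + sq x) + T * (2 * C ^+ 2 * (1 + sq x))
    + 2 * C ^+ 2 * (1 + sq x)); last by ring.
  lra.
by move: H h2 h3; rewrite !mulrDr; lra.
Qed.

Lemma avg_C11_le C T f B g x : 0 <= C -> h <= T -> 0 <= B ->
  enorm (b x) + enorm (sigma x) <= C * (1 + enorm x) ->
  (forall l, `|g l| <= B) ->
  (forall v, `|f (x + v) - f x - \sum_(l < d) g l * v 0 l| <= B * sq v) ->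
  `|avg f x - f x| <=
    h * ((2 * B * d%:R * C + B * (2 * C ^+ 2 * (T + 1))) * (1 + sq x)).
Proof.
move=> C0 hT B0 gr gB ft; have [hb hs] := growth_sq_le C0 gr.
have T0 : 0 <= T by apply: le_trans hT; exact: ltW.
have H := avg_taylor ft.
have drift : `|h * \sum_(i < d) g i * b x 0 i| <= h * (2 * B * d%:R * C * (1 + sq x)).
  rewrite normrM (gtr0_norm h0) ler_wpM2l ?(ltW h0)//.
  apply: (le_trans (ler_norm_sum _ _ _)).
  apply: (@le_trans _ _ (B * \sum_(l < d) `|b x 0 l|)).
    by rewrite mulr_sumr; apply: ler_sum => l _; rewrite normrM ler_wpM2r.
  rewrite [leRHS](_ : _ = B * (d%:R * (C * (2 * (1 + sq x))))); last by ring.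
  rewrite ler_wpM2l// (le_trans (sum_normr_coord_le _))// ler_wpM2l//.
  have es := enorm_ge0 (sigma x); apply: (@le_trans _ _ (C * (1 + enorm x))); first lra.
  rewrite ler_wpM2l// -enorm_sqr; have := enorm_ge0 x.
  by have := sqr_ge0 (1 - enorm x); nra.
have quad : B * (h ^+ 2 * sq (b x) + h * enorm (sigma x) ^+ 2) <=
    h * (B * (2 * C ^+ 2 * (T + 1)) * (1 + sq x)).
  rewrite [leLHS](_ : _ = h * (B * (h * sq (b x) + enorm (sigma x) ^+ 2))); last by ring.
  rewrite ler_wpM2l ?(ltW h0)// -mulrA ler_wpM2l//.
  have : h * sq (b x) <= T * (2 * C ^+ 2 * (1 + sq x)).
    by apply: ler_pM => //; [exact: ltW|exact: sq_ge0].
  by move: hs; move: (enorm _ ^+ 2) => S hs hh; lra.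
rewrite -[avg f x - f x](subrK (h * \sum_(i < d) g i * b x 0 i)).
rewrite (le_trans (ler_normD _ _))//.
by move: H drift quad; rewrite mulrDl mulrDr; lra.
Qed.

(** Exchanging the sums over target and source nodes moves the weights [beta] onto [f]: the new
    masses tested on [f] are the old ones tested on [avg V], where V y is the Q_1 interpolation of
    [f] at y. [A] is [avg V] on the grid. *)
Lemma scheme_step_esum (rho : R) (w w' : 'rV[int]_d -> R) f g C :
  0 < rho -> (forall j, 0 <= w j) ->
  (forall i, (w' i)%:E = (((2 * r%:R)^-1)%:E *
     \sum_(l < r) \esum_(j in [set: 'rV[int]_d])
       ((beta rho i (grid rho j + jump 1 l (grid rho j)) +
         beta rho i (grid rho j + jump (-1) l (grid rho j))) * w j)%:E)%E) ->
  (forall z, 0 <= f z) ->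
  (forall y z, `|f z - f y - \sum_(l < d) g y l * (z - y) 0 l| <= C * sq (z - y)) ->
  exists A : 'rV[int]_d -> R, [/\ forall j, 0 <= A j,
    forall j, `|A j - avg f (grid rho j)| <= C * d%:R * rho ^+ 2 &
    (\esum_(i in [set: 'rV[int]_d]) (w' i * f (grid rho i))%:E =
     \esum_(j in [set: 'rV[int]_d]) (w j * A j)%:E)%E].
Proof.
move=> rho0 w0 w'E f0 ft.
have beta0 i y : 0 <= beta rho i y.
  by apply: prodr_ge0 => l _; rewrite le_max lexx orbT.
pose Y e l j := grid rho j + jump e l (grid rho j).
have /choice[V hV] : forall y, exists v : R,
    [/\ (\esum_(i in [set: 'rV[int]_d]) (beta rho i y * f (grid rho i))%:E = v%:E)%E,
        0 <= v & `|v - f y| <= C * d%:R * rho ^+ 2].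
  by move=> y; apply: q1_interpolation rho0 y f (g y) C f0 (ft y).
have V1 y : (\esum_(i in [set: 'rV[int]_d]) (beta rho i y * f (grid rho i))%:E = (V y)%:E)%E.
  by have [] := hV y.
have V2 y : 0 <= V y by have [] := hV y.
have V3 y : `|V y - f y| <= C * d%:R * rho ^+ 2 by have [] := hV y.
exists (fun j => avg V (grid rho j)); split.
- move=> j; rewrite mulr_ge0 ?invr_ge0 ?(ltW r2)//.
  by apply: sumr_ge0 => l _; rewrite addr_ge0.
- move=> j; rewrite [X in `|X|](_ : _ = avg (fun y => V y - f y) (grid rho j)).
    exact: avg_bounded.
  by rewrite avgD; congr (_ + _); rewrite /avg -mulrN -sumrN; congr (_ * _); apply: eq_bigr => l _; rewrite opprD.
pose K i j := ((2 * r%:R)^-1 * \sum_(l < r) ((beta rho i (Y 1 l j) + beta rho i (Y (-1) l j)) * w j * f (grid rho i))).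
have rinv : 0 <= (2 * r%:R)^-1 :> R by rewrite invr_ge0 ltW.
have K0 i j : 0 <= K i j.
  by rewrite mulr_ge0//; apply: sumr_ge0 => l _; rewrite !mulr_ge0// addr_ge0.
have -> : \esum_(i in [set: 'rV[int]_d]) (w' i * f (grid rho i))%:E =
    \esum_(i in [set: 'rV[int]_d]) \esum_(j in [set: 'rV[int]_d]) (K i j)%:E.
  apply: eq_esum => i _; rewrite mulrC EFinM w'E muleCA.
  rewrite /K; under [RHS]eq_esum do rewrite EFinM -sumEFin.
  have t0 l j : (0 <= ((beta rho i (Y 1 l j) + beta rho i (Y (-1) l j)) * w j * f (grid rho i))%:E)%E.
    by rewrite lee_fin !mulr_ge0// addr_ge0.
  rewrite esumZl//; last by move=> j; apply: sume_ge0.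
  congr (_ * _)%E; rewrite esum_sum//.
  rewrite ge0_sume_distrr; last first.
    by move=> l _; apply: esum_ge0 => j _; rewrite lee_fin mulr_ge0// addr_ge0.
  apply: eq_bigr => l _; rewrite -esumZl//; last by move=> j; rewrite lee_fin mulr_ge0// addr_ge0.
  by apply: eq_esum => j _; rewrite -EFinM mulrC.
rewrite esum_swap; last by move=> i j; rewrite lee_fin.
apply: eq_esum => j _; rewrite /K.
have t0 l i : (0 <= ((beta rho i (Y 1 l j) + beta rho i (Y (-1) l j)) * w j * f (grid rho i))%:E)%E.
  by rewrite lee_fin !mulr_ge0// addr_ge0.
under eq_esum do rewrite EFinM -sumEFin.
rewrite esumZl//; last by move=> i; apply: sume_ge0.
rewrite esum_sum// /avg mulrCA EFinM; congr (_ * _)%E; rewrite mulr_sumr -sumEFin.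
apply: eq_bigr => l _.
under eq_esum => i _.
  rewrite [X in X%:E](_ : _ = w j * (beta rho i (Y 1 l j) * f (grid rho i) + beta rho i (Y (-1) l j) * f (grid rho i))); last by ring.
  rewrite EFinM; over.
rewrite esumZl//; last by move=> i; rewrite lee_fin addr_ge0// mulr_ge0.
under eq_esum do rewrite EFinD.
rewrite esumD; [|by move=> i _; rewrite lee_fin mulr_ge0|by move=> i _; rewrite lee_fin mulr_ge0].
by rewrite !V1 -EFinD -EFinM.
Qed.

End random_walk.

(** * Rounding to the grid *)

Section countable_partition.
Context {R : realType} {dT : measure_display} {T : measurableType dT}.
Context (P : {measure set T -> \bar R}) (I : countType) (E : I -> set T).
Hypothesis mE : forall i, measurable (E i).
Hypothesis tE : forall i j x, E i x -> E j x -> i = j.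
Hypothesis cE : forall x, exists i, E i x.

Lemma measure_countable_partition A : measurable A ->
  (P A = \esum_(i in [set: I]) P (E i `&` A))%E.
Proof.
move=> mA; rewrite esum_nneseries//.
pose F n := if pickle_inv n is Some i then E i `&` A else set0.
have AF : A = \bigcup_n F n.
  apply/seteqP; split => [x Ax|x [n _]]; last first.
    by rewrite /F; case: (pickle_inv n) => [i []|].
  by have [i Ei] := cE x; exists (pickle i) => //; rewrite /F pickleK_inv.
rewrite {1}AF measure_bigcup//.
- rewrite [LHS]eseries_mkcond; apply: eq_eseriesr => n _; rewrite in_setT /F.
  by case: (pickle_inv n) => //=; rewrite measure0.
- by move=> n _; rewrite /F; case: (pickle_inv n) => // i; exact: measurableI.
- move=> n p _ _ [x [] /=]; rewrite /F.
  case En : (pickle_inv n) => [i|//] [Ei _]; case Ep : (pickle_inv p) => [j|//] [Ej _].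
  have ij := tE Ei Ej; have := @pickle_invK I n; have := @pickle_invK I p.
  by rewrite En Ep /= ij => -> ->.
Qed.

End countable_partition.

Section rounding.
Context {R : realType} {d : nat} (rho : R).
Hypothesis rho0 : 0 < rho.

(* The index of a grid point nearest to [x]; the half-open cells
   [round @^-1` [set i]] partition the space. *)
Definition round (x : 'rV[R]_d) : 'rV[int]_d :=
  \row_l Num.floor (x 0 l / rho + 2^-1).

Lemma round_coord (x : 'rV[R]_d) l : `|x 0 l - grid rho (round x) 0 l| <= rho / 2.
Proof.
rewrite !mxE; set n := Num.floor _.
have /andP[n1 n2] := floor_itv (x 0 l / rho + 2^-1); rewrite -/n intrD in n1 n2.
have -> : x 0 l - n%:~R * rho = rho * (x 0 l / rho - n%:~R).
  by field; rewrite gt_eqF.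
rewrite normrM (gtr0_norm rho0) ler_wpM2l ?(ltW rho0)// ler_norml.
by apply/andP; split; lra.
Qed.

Lemma round_dist (x : 'rV[R]_d) : `|x - grid rho (round x)| <= rho / 2.
Proof.
rewrite /Num.norm/= mx_normrE; apply/bigmax_leP; split; first by rewrite divr_ge0// ltW.
by move=> [i j] _ /=; rewrite (ord1 i) [X in `|X|]mxE [X in _ + X]mxE; exact: round_coord.
Qed.

Lemma measurable_round i : measurable ([set x | round x = i] : set (Borel R d)).
Proof.
have -> : [set x : Borel R d | round x = i] = \bigcap_(l in [set: 'I_d])
    ((fun x : Borel R d => (x : 'rV[R]_d) 0 l) @^-1`
      `[((i 0 l)%:~R - 2^-1) * rho, ((i 0 l)%:~R + 2^-1) * rho[).
  apply/seteqP; split => [x <- l _|x xi].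
    rewrite /= in_itv/= mxE; set n := Num.floor _.
    have /andP[n1 n2] := floor_itv (x 0 l / rho + 2^-1); rewrite -/n intrD in n1 n2.
    by rewrite -ler_pdivlMr// -ltr_pdivrMr//; apply/andP; split; lra.
  apply/rowP => l; rewrite mxE; apply: floor_def; rewrite intrD.
  have := xi l I; rewrite /= in_itv/= -ler_pdivlMr// -ltr_pdivrMr// => /andP[? ?].
  by apply/andP; split; lra.
apply: fin_bigcap_measurable; first exact: finite_finset.
move=> l _; rewrite -[X in measurable X]setTI; apply: continuous_borel => //.
exact: coord_continuous_rV.
Qed.

(* The cells [cell rho i] overlap, but their masses sum to 1, hence they carry
   the same masses as the half-open cells. *)
Lemma cell_measure (P : probability (Borel R d) R) :
  (\esum_(i in [set: 'rV[int]_d]) P (cell rho i) = 1)%E ->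
  forall i, (P (cell rho i) = P [set x | round x = i])%E.
Proof.
move=> sum1; have mcell i : measurable (cell rho i : set (Borel R d)).
  have -> : cell rho i = ~` [set x | rho / 2 < `|x - grid rho i|].
    by apply/seteqP; split => x; rewrite /cell/= leNgt => /negP.
  apply: measurableC; apply: sub_sigma_algebra.
  apply: (@open_comp _ _ (fun x : 'rV[R]_d => `|x - grid rho i|) [set y | rho / 2 < y]) => [x _|]; last exact: open_gt.
  apply: (@lipschitz_continuous _ _ _ 1) => y z; rewrite mul1r.
  by rewrite (le_trans (ler_dist_dist _ _))// opprB addrA subrK.
have sub i : [set x | round x = i] `<=` cell rho i.
  by move=> x /= <-; exact: round_dist.
have le i : (P [set x | round x = i] <= P (cell rho i))%E.
  by apply: le_measure; rewrite ?inE//; exact: measurable_round.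
have sum1' : (\esum_(i in [set: 'rV[int]_d]) P [set x | round x = i] = 1)%E.
  have := @measure_countable_partition _ _ (Borel R d) P 'rV[int]_d (fun i => [set x | round x = i]) measurable_round.
  move=> /(_ _ _ setT measurableT) h.
  have /= <- := probability_setT P; rewrite h.
  - by apply: eq_esum => i _; rewrite setIT.
  - by move=> i j x /= -> .
  - by move=> x; exists (round x).
move=> i; apply/eqP; rewrite eq_le le andbT leNgt; apply/negP => lti.
have fin (A : set (Borel R d)) : measurable A -> P A \is a fin_num by move=> mA; exact: fin_num_measure.
(* A strict inequality at one index, with finite sums and <= at all the others, would give 1 < 1. *)
have : (\esum_(j in [set: 'rV[int]_d]) P [set x | round x = j] <
        \esum_(j in [set: 'rV[int]_d]) P (cell rho j))%E.
  rewrite (esumID [set i])// [ltRHS](esumID [set i])// !setTI !esum_set1//.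
  apply: lte_leD => //.
    rewrite ge0_fin_numE ?esum_ge0// (@le_lt_trans _ _ 1%E) ?ltry//.
    rewrite -sum1' [leRHS](esumID [set i])// !setTI -[leLHS]add0e; apply: leeD2r.
    by rewrite esum_set1.
  by apply: le_esum.
by rewrite sum1 sum1' ltxx.
Qed.

End rounding.

(** * A priori estimates *)

(** Carries identities and bounds for integrals of nonnegative functions over to a function bounded
    by [B], by adding the constant [B] to it. *)
Lemma integral_addr_cst (R : realType) dT (T : measurableType dT)
    (P : probability T R) (u : T -> R) (B c : R) :
  measurable_fun setT u -> (forall x, `|u x| <= B) ->
  (\int[P]_x (u x + c)%:E = (\int[P]_x u x + c)%:E)%E.
Proof.
move=> mu uB; have ui := @bounded_integrable _ _ _ P _ _ mu uB.
have ci : P.-integrable setT (EFin \o (fun=> c)).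
  by apply: (@bounded_integrable _ _ _ P (fun=> c) `|c|).
rewrite -[in RHS](Rintegral_cstT P c) -RintegralD// EFin_Rintegral//.
by have := integrableD measurableT ui ci; apply: eq_integrable.
Qed.

Definition tstep {R : realType} (T : R) (N : nat) : R := T / N%:R.

Definition tknot {R : realType} (T : R) (N k : nat) : R := k%:R * tstep T N.

Section solution.
Context {R : realType} {d r : nat} {T : R}.
Hypothesis r0 : (0 < r)%N.
Hypothesis T0 : 0 < T.
Context (b : curve d T -> 'rV[R]_d -> R -> 'rV[R]_d).
Context (sigma : curve d T -> 'rV[R]_d -> R -> 'M[R]_(d, r)).
Context (m0 : probability (Borel R d) R) (rho : R) (N : nat).
Context (mu : 'rV[int]_d -> nat -> R) (m : curve d T).
Hypothesis rho0 : 0 < rho.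
Hypothesis N0 : (0 < N)%N.
Hypothesis hm : scheme_solution b sigma m0 rho N mu m.

Local Notation h := (tstep T N).
Local Notation tk := (tknot T N).

Lemma tstep_gt0 : 0 < h. Proof. by rewrite divr_gt0// ltr0n. Qed.
Let h0 := tstep_gt0.

Lemma tknot_last : tk N = T.
Proof. by rewrite /tknot /tstep mulrC divfK// pnatr_eq0 -lt0n. Qed.
Let hN := tknot_last.

Lemma tknotS k : tk k.+1 = tk k + h.
Proof. by rewrite /tknot -natr1; ring. Qed.

Let tk0 : tk 0 = 0. Proof. by rewrite /tknot mul0r. Qed.

Let mu0 i k : (k <= N)%N -> 0 <= mu i k.
Proof. by move=> kN; have [/(_ k kN)[]] := hm. Qed.

Let mu1 k : (k <= N)%N -> (\esum_(i in [set: 'rV[int]_d]) (mu i k)%:E = 1)%E.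
Proof. by move=> kN; have [/(_ k kN)[]] := hm. Qed.

Lemma knot_in k : (k <= N)%N -> 0 <= tk k <= T.
Proof.
by move=> kN; rewrite mulr_ge0 ?(ltW h0)//= -[leRHS]hN ler_wpM2r ?(ltW h0)// ler_nat.
Qed.

Lemma time_cell t : 0 <= t <= T ->
  exists2 k, (k < N)%N & tk k <= t <= tk k.+1.
Proof.
move=> /andP[t0 tT]; pose P k := t <= tk k.+1.
have exP : exists k, P k by exists N.-1; rewrite /P prednK// hN.
case: (ex_minnP exP) => k Pk kmin; exists k.
  by rewrite -[N]prednK// ltnS; apply: kmin; rewrite /P prednK// hN.
apply/andP; split; last exact: Pk.
case: k Pk kmin => [|k] Pk kmin; first by rewrite tk0.
by rewrite leNgt; apply/negP => /ltW/kmin; rewrite ltnn.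
Qed.

(** Every knot but the last is the left end of a cell; the last one is reached as the right end of
    the cell N - 1. *)
Lemma knot_measure k (A : set (Borel R d)) : (k <= N)%N -> measurable A ->
  (m (tk k) A = grid_measure rho mu k A)%E.
Proof.
move=> kN mA; have [_ ext _ _] := hm.
have hS j : tk j.+1 - tk j = h by rewrite tknotS addrAC subrr add0r.
have le j : tk j <= tk j.+1 by rewrite -subr_ge0 hS ltW.
have hn : h != 0 by rewrite gt_eqF.
have extk p t : (p < N)%N -> tk p <= t <= tk p.+1 ->
    (m t A = ((t - tk p) / h)%:E * grid_measure rho mu p.+1 A +
             ((tk p.+1 - t) / h)%:E * grid_measure rho mu p A)%E.
  by move=> pN pt; exact: ext.
move: kN; rewrite leq_eqVlt => /orP[/eqP kE|kN].
  have [p pE] : exists p, N = p.+1 by exists N.-1; rewrite prednK.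
  have pN : (p < N)%N by rewrite pE.
  have -> : k = p.+1 by rewrite kE.
  by rewrite (extk p) ?le ?lexx// hS divff// subrr mul0r mul0e adde0 mul1e.
by rewrite (extk k) ?le ?lexx// hS divff// subrr mul0r mul0e add0e mul1e.
Qed.

Lemma knot_integral k (f : 'rV[R]_d -> R) : (k <= N)%N ->
  (forall x, 0 <= f x) -> measurable_fun setT (f : Borel R d -> R) ->
  (\int[m (tk k)]_x (f x)%:E =
   \esum_(i in [set: 'rV[int]_d]) (mu i k * f (grid rho i))%:E)%E.
Proof.
move=> kN f0 mf; under eq_esum do rewrite EFinM.
apply: (@integral_esum_dirac _ _ (Borel R d) _ (mu^~ k) (fun i => grid rho i : Borel R d)
  (m (tk k)) (fun x => (f x)%:E)).
- by move=> i; exact: mu0.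
- by move=> A mA; exact: knot_measure.
- by move=> y; rewrite lee_fin.
- exact/measurable_EFinP.
Qed.

Lemma cell_integral k t (f : 'rV[R]_d -> R) : (k < N)%N ->
  tk k <= t <= tk k.+1 ->
  (forall x, 0 <= f x) -> measurable_fun setT (f : Borel R d -> R) ->
  (\int[m t]_x (f x)%:E =
   ((t - tk k) / h)%:E * \int[m (tk k.+1)]_x (f x)%:E +
   ((tk k.+1 - t) / h)%:E * \int[m (tk k)]_x (f x)%:E)%E.
Proof.
move=> kN /andP[kt ktS] f0 mf; have [_ ext _ _] := hm.
have l0 : 0 <= (t - tk k) / h by rewrite divr_ge0 ?subr_ge0 ?(ltW h0).
have l1 : 0 <= (tk k.+1 - t) / h by rewrite divr_ge0 ?subr_ge0 ?(ltW h0).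
have mfE : measurable_fun setT (fun x : Borel R d => (f x)%:E) by exact/measurable_EFinP.
have f0E x : (0 <= (f x)%:E)%E by rewrite lee_fin.
pose m1 := mscale (NngNum l0) (m (tk k.+1)).
pose m2 := mscale (NngNum l1) (m (tk k)).
transitivity (\int[measure_add m1 m2]_x (f x)%:E)%E.
  apply: eq_measure_integral => A mA _; transitivity (m1 A + m2 A)%E; last exact/esym/measure_addE.
  have ktkS : k%:R * (T / N%:R) <= t <= k.+1%:R * (T / N%:R) by apply/andP.
  have /= -> := ext k t kN ktkS A mA; rewrite /m1 /m2 /mscale/=.
  have /= -> := knot_measure kN mA.
  by have /= -> := knot_measure (ltnW kN) mA.
by rewrite ge0_integral_measure_add// !ge0_integral_mscale.
Qed.

Lemma cell_Rintegral k t (f : 'rV[R]_d -> R) B : (k < N)%N ->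
  tk k <= t <= tk k.+1 ->
  (forall x, `|f x| <= B) -> measurable_fun setT (f : Borel R d -> R) ->
  \int[m t]_x f x =
   (t - tk k) / h * \int[m (tk k.+1)]_x f x +
   (tk k.+1 - t) / h * \int[m (tk k)]_x f x.
Proof.
move=> kN kt fB mf.
pose F x := f x + B.
have F0 x : 0 <= F x by have := fB x; rewrite ler_norml => /andP[? _]; rewrite /F; lra.
have mF : measurable_fun setT (F : Borel R d -> R) by exact: measurable_funD.
have FE s : (\int[m s]_x (F x)%:E = (\int[m s]_x f x + B)%:E)%E.
  exact: integral_addr_cst mf fB.
have := cell_integral kN kt F0 mF.
rewrite !FE -!EFinM -EFinD => -[E]; apply: (addIr B); rewrite E.
rewrite tknotS.
by field; rewrite gt_eqF.
Qed.

Let bk k x := b m x (tk k).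
Let sk k x := sigma m x (tk k).

(** Two inequalities in the extended reals rather than a bound on a difference, since [f] may be
    unbounded: the moment estimate takes [f] to be [sq]. *)
Lemma scheme_step_integral k (f : 'rV[R]_d -> R) g C : (k < N)%N ->
  continuous (bk k) -> continuous (sk k) -> continuous f ->
  (forall z, 0 <= f z) -> 0 <= C ->
  (forall y z, `|f z - f y - \sum_(l < d) g y l * (z - y) 0 l| <= C * sq (z - y)) ->
  (\int[m (tk k.+1)]_x (f x)%:E <=
     \int[m (tk k)]_x (avg h (bk k) (sk k) f x)%:E + (C * d%:R * rho ^+ 2)%:E)%E /\
  (\int[m (tk k)]_x (avg h (bk k) (sk k) f x)%:E <=
     \int[m (tk k.+1)]_x (f x)%:E + (C * d%:R * rho ^+ 2)%:E)%E.
Proof.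
move=> kN cb cs cf f0 C0 ft; have [_ _ _ sch] := hm.
have w0 j : 0 <= mu j k by exact: mu0 (ltnW kN).
set S := avg h (bk k) (sk k) f; set c := C * d%:R * rho ^+ 2.
have c0 : 0 <= c by apply: mulr_ge0; [exact: mulr_ge0|exact: sqr_ge0].
have S0 x : 0 <= S x.
  rewrite mulr_ge0 ?invr_ge0 ?mulr_ge0//.
  by apply: sumr_ge0 => l _; rewrite addr_ge0.
have mS : measurable_fun setT (S : Borel R d -> R).
  by apply: continuous_borel; exact: avg_continuous.
have wE i : ((mu i k.+1)%:E = ((2 * r%:R)^-1)%:E *
    \sum_(l < r) \esum_(j in [set: 'rV[int]_d])
      ((beta rho i (grid rho j + jump h (bk k) (sk k) 1 l (grid rho j)) +
        beta rho i (grid rho j + jump h (bk k) (sk k) (-1) l (grid rho j))) * mu j k)%:E)%E.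
  rewrite (sch i k kN); congr (_ * _)%E; apply: eq_bigr => l _.
  by apply: eq_esum => j _; rewrite /Phi /jump !addrA.
have [A [A0 AS AE]] := scheme_step_esum r0 rho0 w0 wE f0 ft.
rewrite (knot_integral kN f0 (continuous_borel cf)) AE.
have mc : (\esum_(j in [set: 'rV[int]_d]) (mu j k * c)%:E = c%:E)%E.
  under eq_esum do rewrite mulrC EFinM.
  by rewrite esumZl// mu1 ?mule1// ltnW.
rewrite (knot_integral (ltnW kN) S0 mS).
have AS' j : A j <= S (grid rho j) + c /\ S (grid rho j) <= A j + c.
  by have := AS j; rewrite ler_norml -/S -/c => /andP[? ?]; split; lra.
rewrite -mc -!esumD; try by move=> j _; rewrite lee_fin mulr_ge0.
by split; apply: le_esum => j _; rewrite -EFinD lee_fin -mulrDr ler_wpM2l//; case: (AS' j).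
Qed.

Lemma scheme_step_Rintegral k (f : 'rV[R]_d -> R) g B C : (k < N)%N ->
  continuous (bk k) -> continuous (sk k) -> continuous f ->
  (forall x, `|f x| <= B) -> 0 <= C ->
  (forall y z, `|f z - f y - \sum_(l < d) g y l * (z - y) 0 l| <= C * sq (z - y)) ->
  `|\int[m (tk k.+1)]_x f x -
    \int[m (tk k)]_x avg h (bk k) (sk k) f x| <= C * d%:R * rho ^+ 2.
Proof.
move=> kN cb cs cf fB C0 ft.
pose F x := f x + B.
have F0 x : 0 <= F x by have := fB x; rewrite ler_norml => /andP[? _]; rewrite /F; lra.
have cF : continuous F by apply: continuous_addr => //; exact: continuous_cstr.
have Ft y z : `|F z - F y - \sum_(l < d) g y l * (z - y) 0 l| <= C * sq (z - y).
  by rewrite /F opprD addrACA subrr addr0; exact: ft.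
have mf : measurable_fun setT (f : Borel R d -> R) by exact: continuous_borel.
set S := avg h (bk k) (sk k) f.
have SF x : avg h (bk k) (sk k) F x = S x + B.
  by rewrite /F avgD avg_cst.
have mS : measurable_fun setT (S : Borel R d -> R).
  by apply: continuous_borel; exact: avg_continuous.
have SB x : `|S x| <= B by exact: avg_bounded.
have [] := scheme_step_integral kN cb cs cF F0 C0 Ft.
under [X in (_ <= X + _)%E]eq_integral do rewrite SF.
under [X in _ -> (X <= _)%E -> _]eq_integral do rewrite SF.
rewrite !(integral_addr_cst _ _ mf fB) !(integral_addr_cst _ _ mS SB) -!EFinD !lee_fin ler_norml => h1 h2; apply/andP; split; lra.
Qed.

End solution.

Section initial.
Context {R : realType} {d r : nat} {T : R}.
Context (b : curve d T -> 'rV[R]_d -> R -> 'rV[R]_d).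
Context (sigma : curve d T -> 'rV[R]_d -> R -> 'M[R]_(d, r)).
Context (m0 : probability (Borel R d) R) (rho : R) (N : nat).
Context (mu : 'rV[int]_d -> nat -> R) (m : curve d T).
Hypothesis rho0 : 0 < rho.
Hypothesis N0 : (0 < N)%N.
Hypothesis T0 : 0 < T.
Hypothesis hm : scheme_solution b sigma m0 rho N mu m.

Let rnd (x : Borel R d) : Borel R d := grid rho (round rho x).

Let mrnd : measurable_fun setT rnd.
Proof.
move=> _ A mA; rewrite setTI.
pose F n : set (Borel R d) := if pickle_inv n is Some i then
  (if grid rho i \in A then [set x | round rho x = i] else set0) else set0.
rewrite (_ : _ @^-1` A = \bigcup_n F n).
  apply: bigcupT_measurable => n; rewrite /F; case: (pickle_inv n) => [i|//].
  by case: ifP => // _; exact: measurable_round.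
apply/seteqP; split => [x Ax|x [n _]].
  exists (pickle (round rho x)) => //; rewrite /F pickleK_inv.
  by rewrite mem_set.
rewrite /F; case: (pickle_inv n) => [i|//]; case: ifPn => // /set_mem Ai /= xi.
by rewrite /preimage/= /rnd xi.
Qed.

(** Closed cells carry the same masses as half-open ones, so the initial law of the scheme is the
    image of [m0] under rounding. *)
Lemma initial_measure (A : set (Borel R d)) : measurable A ->
  m 0 A = m0 (rnd @^-1` A).
Proof.
move=> mA; have [gf _ init _] := hm.
have [mu0 mu1 _] := gf 0%N (leq0n _).
have -> : 0 = tknot T N 0 by rewrite /tknot mul0r.
have /= -> := knot_measure T0 N0 hm (leq0n N) mA.
have mpre : measurable (rnd @^-1` A) by rewrite -[X in measurable X]setTI; exact: mrnd.
have cellE i : ((mu i 0%N)%:E = m0 [set x | round rho x = i])%E.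
  rewrite init; apply: (cell_measure rho0).
  by under eq_esum do rewrite -init.
have -> : (m0 (rnd @^-1` A) = \esum_(i in [set: 'rV[int]_d])
    m0 ([set x | round rho x = i] `&` rnd @^-1` A))%E.
  apply: measure_countable_partition => //.
  - by move=> i; exact: measurable_round.
  - by move=> i j x /= -> .
  - by move=> x; exists (round rho x).
apply: eq_esum => i _; rewrite cellE diracE.
have [iA|iA] := boolP (_ \in A).
  rewrite mule1; congr (m0 _); apply/seteqP; split => [x /= xi|x []//].
  by split=> //; rewrite /preimage/= /rnd xi; exact: set_mem.
rewrite mule0 -(measure0 m0); congr (m0 _); apply/seteqP; split => // x [/= xi].
rewrite /preimage/= /rnd xi => Ai; move: iA; apply/negP/negPn.
exact: mem_set.
Qed.

Lemma initial_integral (f : Borel R d -> \bar R) :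
  (forall x, (0 <= f x)%E) -> measurable_fun setT f ->
  (\int[m 0%R]_x f x = \int[m0]_x f (rnd x))%E.
Proof.
move=> f0 mf.
have := ge0_integral_pushforward mrnd m0 measurableT mf.
rewrite preimage_setT => <-//.
by apply: eq_measure_integral => A mA _; have /= -> := initial_measure mA.
Qed.

Let rnd_dist (x : 'rV[R]_d) : enorm (rnd x - x) <= d%:R * rho.
Proof.
rewrite -enormN opprB (le_trans (enorm_le_norm _))// ler_wpM2l//.
apply: (le_trans (round_dist rho0 x)); have := rho0; lra.
Qed.

(** Rounding moves a point by at most d rho, and |x + v|^2 <= 2 |x|^2 + 2 |v|^2. *)
Lemma initial_moment :
  (\int[m 0%R]_x (sq (x : 'rV[R]_d))%:E <=
   2%:E * \int[m0]_x (sq (x : 'rV[R]_d))%:E + (2 * (d%:R * rho) ^+ 2)%:E)%E.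
Proof.
have msq : measurable_fun setT (fun x : Borel R d => (sq (x : 'rV[R]_d))%:E).
  by apply/measurable_EFinP; apply: continuous_borel; exact: sq_continuous.
rewrite initial_integral//; last by move=> x; rewrite lee_fin sq_ge0.
rewrite -ge0_integralZl_EFin//; last by move=> x _; rewrite lee_fin sq_ge0.
have ci : (\int[m0]_x (2 * (d%:R * rho) ^+ 2)%:E = (2 * (d%:R * rho) ^+ 2)%:E)%E.
  by rewrite integral_cst//; have /= -> := probability_setT m0; rewrite mule1.
have c0 : 0 <= 2 * (d%:R * rho) ^+ 2 by rewrite mulr_ge0// sqr_ge0.
rewrite -[X in (_ + X)%E]ci -ge0_integralD//; last 2 first.
- by move=> x _; rewrite mule_ge0// lee_fin sq_ge0.
- exact: measurable_funeM.
apply: ge0_le_integral => //.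
- by move=> x _; rewrite lee_fin sq_ge0.
- exact: (measurableT_comp msq mrnd).
- by apply: emeasurable_funD => //; exact: measurable_funeM.
move=> x _; rewrite -EFinM -EFinD lee_fin.
have -> : rnd x = (x : 'rV[R]_d) + (rnd x - (x : 'rV[R]_d)) by rewrite subrKC.
rewrite (le_trans (sqD_le _ _))// mulrDr lerD2l ler_wpM2l// -enorm_sqr.
by rewrite ler_pXn2r ?nnegrE ?enorm_ge0 ?mulr_ge0 ?rnd_dist// ltW.
Qed.

Lemma initial_Rintegral (f : 'rV[R]_d -> R) B C :
  measurable_fun setT (f : Borel R d -> R) -> (forall x, `|f x| <= B) -> 0 <= C ->
  (forall x y, `|f x - f y| <= C * enorm (x - y)) ->
  `|\int[m 0%R]_x f x - \int[m0]_x f x| <= C * (d%:R * rho).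
Proof.
move=> mf fB C0 fC.
have mfE : measurable_fun setT (EFin \o (f : Borel R d -> R)) by exact/measurable_EFinP.
have mfr : measurable_fun setT (f \o rnd) by exact: measurableT_comp.
have fri : m0.-integrable setT (EFin \o (f \o rnd)).
  by apply: (@bounded_integrable _ _ _ m0 _ B mfr) => x; exact: fB.
have -> : \int[m 0%R]_x f x = \int[m0]_x (f \o rnd) x.
  rewrite /Rintegral; congr fine.
  have := @integral_pushforward _ _ _ _ _ _ mrnd m0 setT (EFin \o f) mfE.
  rewrite preimage_setT => <- //.
  by apply: eq_measure_integral => A mA _; have /= -> := initial_measure mA.
apply: Rintegral_dist_le => //; first exact: bounded_integrable mf fB.
move=> x; rewrite (le_trans (fC _ _))// ler_wpM2l//; exact: rnd_dist.
Qed.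

End initial.

Lemma integral_le_cst (R : realType) dT (T : measurableType dT)
    (P : probability T R) (u : T -> R) (a c S : R) (q : T -> R) :
  (forall x, 0 <= u x) -> measurable_fun setT u ->
  (forall x, 0 <= q x) -> measurable_fun setT q -> 0 <= a -> 0 <= c ->
  (forall x, u x <= c + a * q x) -> (\int[P]_x (q x)%:E <= S%:E)%E ->
  (\int[P]_x (u x)%:E <= (c + a * S)%:E)%E.
Proof.
move=> u0 mu q0 mq a0 c0 uq qS.
apply: (@le_trans _ _ (\int[P]_x (c%:E + a%:E * (q x)%:E))%E).
  apply: ge0_le_integral => //.
  - by move=> x _; rewrite lee_fin.
  - exact/measurable_EFinP.
  - apply: emeasurable_funD => //; apply: measurable_funeM; exact/measurable_EFinP.
  - by move=> x _; rewrite -EFinM -EFinD lee_fin.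
rewrite ge0_integralD//; last 2 first.
- by move=> x _; rewrite -EFinM lee_fin mulr_ge0.
- by apply: measurable_funeM; exact/measurable_EFinP.
rewrite integral_cst//; have /= -> := probability_setT P; rewrite mule1.
rewrite ge0_integralZl_EFin//; last 2 first.
- by move=> x _; rewrite lee_fin.
- exact/measurable_EFinP.
by rewrite EFinD EFinM leeD2l// lee_wpmul2l.
Qed.

Section estimates.
Context {R : realType} {d r : nat} {T : R}.
Hypothesis r0 : (0 < r)%N.
Hypothesis T0 : 0 < T.
Context (b : curve d T -> 'rV[R]_d -> R -> 'rV[R]_d).
Context (sigma : curve d T -> 'rV[R]_d -> R -> 'M[R]_(d, r)).
Hypothesis b_cont_x : forall m t, 0 <= t <= T -> continuous (fun x => b m x t).
Hypothesis s_cont_x : forall m t, 0 <= t <= T -> continuous (fun x => sigma m x t).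
Context (C : R).
Hypothesis C0 : 0 <= C.
Hypothesis growth : forall m x t, 0 <= t <= T ->
  enorm (b m x t) + enorm (sigma m x t) <= C * (1 + enorm x).
Context (m0 : probability (Borel R d) R) (rho : R) (N : nat).
Context (mu : 'rV[int]_d -> nat -> R) (m : curve d T).
Hypothesis rho0 : 0 < rho.
Hypothesis N0 : (0 < N)%N.
Hypothesis hm : scheme_solution b sigma m0 rho N mu m.
Local Notation h := (tstep T N).
Local Notation tk := (tknot T N).
Hypothesis rho_h : rho ^+ 2 <= h.

Let h0 : 0 < h. Proof. exact: tstep_gt0. Qed.
Let hT : h <= T.
Proof. by rewrite ler_pdivrMr ?ltr0n// ler_peMr ?(ltW T0)// ler1n. Qed.
Let tkT k : (k <= N)%N -> 0 <= tk k <= T. Proof. exact: knot_in. Qed.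

Let msq : measurable_fun setT (@sq R d : Borel R d -> R).
Proof. by apply: continuous_borel; exact: sq_continuous. Qed.

(** Growth rate in time of 1 plus the second moment: the constant of [avg_sq_le], plus [d] for the
    interpolation error d rho^2 <= d h. *)
Definition moment_rate : R := 1 + 2 * C ^+ 2 * (2 + T) + d%:R.

Let rate0 : 0 <= moment_rate.
Proof. by rewrite /moment_rate !addr_ge0// mulr_ge0 ?mulr_ge0 ?sqr_ge0// addr_ge0// ltW. Qed.

Lemma moment_step k S : (k < N)%N -> 0 <= S ->
  (\int[m (tk k)]_x (sq (x : 'rV[R]_d))%:E <= S%:E)%E ->
  (\int[m (tk k.+1)]_x (sq (x : 'rV[R]_d))%:E <=
    (S + h * moment_rate * (1 + S))%:E)%E.
Proof.
move=> kN S0 kS.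
have sqt (y z : 'rV[R]_d) : `|sq z - sq y - \sum_(l < d) (2 * y 0 l) * (z - y) 0 l| <= 1 * sq (z - y).
  rewrite mul1r le_eqVlt; apply/orP; left; apply/eqP.
  rewrite -[RHS]ger0_norm ?sq_ge0//; congr `|_|.
  by rewrite /sq -!sumrB; apply: eq_bigr => l _; rewrite !mxE; ring.
have cb := @b_cont_x m _ (tkT (ltnW kN)); have cs := @s_cont_x m _ (tkT (ltnW kN)).
have [up _] := scheme_step_integral r0 T0 rho0 N0 hm kN cb cs (@sq_continuous _ _)
  (@sq_ge0 _ _) ler01 sqt.
apply: (le_trans up).
pose c1 := 1 + 2 * C ^+ 2 * (2 + T).
have c10 : 0 <= c1 by rewrite addr_ge0// mulr_ge0 ?mulr_ge0 ?sqr_ge0// addr_ge0// ltW.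
have avg0 x : 0 <= avg h (fun x => b m x (tk k)) (fun x => sigma m x (tk k)) (@sq R d) x.
  by rewrite mulr_ge0 ?invr_ge0 ?mulr_ge0//; apply: sumr_ge0 => l _; rewrite addr_ge0// sq_ge0.
have mavg : measurable_fun setT (avg h (fun x => b m x (tk k)) (fun x => sigma m x (tk k)) (@sq R d) : Borel R d -> R).
  by apply: continuous_borel; apply: avg_continuous => //; exact: sq_continuous.
have hc : 0 <= h * c1 by rewrite mulr_ge0// ltW.
have ha : 0 <= 1 + h * c1 by rewrite addr_ge0.
have := @integral_le_cst _ _ _ (m (tk k)) _ (1 + h * c1) (h * c1) S (@sq R d) avg0 mavg
  (@sq_ge0 _ _) msq ha hc.
move=> /(_ _ kS) H.
apply: (@le_trans _ _ ((h * c1 + (1 + h * c1) * S)%:E + (1 * d%:R * rho ^+ 2)%:E)%E).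
  apply: leeD2r; apply: H => x.
  have := @avg_sq_le R d r r0 h h0 (fun x => b m x (tk k)) (fun x => sigma m x (tk k))
    C T x C0 hT (@growth m x _ (tkT (ltnW kN))).
  by rewrite -/c1 => /le_trans; apply; rewrite le_eqVlt; apply/orP; left; apply/eqP; ring.
rewrite -EFinD lee_fin mul1r.
have : d%:R * rho ^+ 2 <= d%:R * h by rewrite ler_wpM2l.
have : 0 <= h * d%:R * S by rewrite !mulr_ge0// ltW.
by rewrite /moment_rate -/c1; lra.
Qed.

Lemma moment_bound S : 0 <= S ->
  (\int[m 0%R]_x (sq (x : 'rV[R]_d))%:E <= S%:E)%E ->
  forall t, 0 <= t <= T ->
  (\int[m t]_x (sq (x : 'rV[R]_d))%:E <= (expR (moment_rate * T) * (1 + S))%:E)%E.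
Proof.
move=> S0 mS.
(* Exact solution of 1 + a (k + 1) = (1 + h moment_rate) (1 + a k) with a 0 = S; its powers are
   bounded through 1 + x <= exp x. *)
pose a k := (1 + h * moment_rate) ^+ k * (1 + S) - 1.
have h1 : 1 <= 1 + h * moment_rate by rewrite lerDl mulr_ge0// ltW.
have a0 k : 0 <= a k.
  by rewrite subr_ge0 mulr_ege1 ?exprn_ege1// lerDl.
have ak k : (k <= N)%N -> (\int[m (tk k)]_x (sq (x : 'rV[R]_d))%:E <= (a k)%:E)%E.
  elim: k => [|k IH] kN.
    by rewrite /tknot mul0r (le_trans mS)// lee_fin /a expr0; lra.
  apply: (le_trans (moment_step kN (a0 k) (IH (ltnW kN)))).
  by rewrite lee_fin le_eqVlt; apply/orP; left; apply/eqP; rewrite /a exprS; ring.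
pose L := expR (moment_rate * T) * (1 + S).
have aL k : (k <= N)%N -> a k <= L.
  move=> kN; rewrite /a /L (@le_trans _ _ ((1 + h * moment_rate) ^+ k * (1 + S)))//.
    by rewrite lerBlDr lerDl.
  rewrite ler_wpM2r ?addr_ge0//.
  apply: (@le_trans _ _ (expR (h * moment_rate) ^+ k)).
    apply: lerXn2r; rewrite ?nnegrE ?expR_ge0//; last exact: expR_ge1Dx.
    exact: le_trans ler01 h1.
  rewrite -expRM_natl ler_expR mulrA [leRHS]mulrC ler_wpM2r//.
  by have /andP[] := tkT kN.
move=> t tT; have [k kN kt] := time_cell N0 tT.
have f0 (x : 'rV[R]_d) : 0 <= sq x by exact: sq_ge0.
rewrite (cell_integral T0 N0 hm kN kt f0 msq).
have /andP[kt1 kt2] := kt.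
have l0 : 0 <= (t - tk k) / h by rewrite divr_ge0 ?subr_ge0// ltW.
have l1 : 0 <= (tk k.+1 - t) / h by rewrite divr_ge0 ?subr_ge0// ltW.
have e1 := le_trans (ak _ kN) (_ : ((a k.+1)%:E <= L%:E)%E).
have e2 := le_trans (ak _ (ltnW kN)) (_ : ((a k)%:E <= L%:E)%E).
rewrite !lee_fin in e1 e2.
apply: (@le_trans _ _ (((t - tk k) / h)%:E * L%:E + ((tk k.+1 - t) / h)%:E * L%:E)%E).
  by apply: leeD; apply: lee_wpmul2l => //; [apply: e1; exact: aL|apply: e2; apply: aL; exact: ltnW].
rewrite -!EFinM -EFinD lee_fin tknotS -mulrDl -mulrDl.
rewrite (_ : _ / h = 1) ?mul1r//.
by rewrite (_ : t - tk k + (tk k + h - t) = h) ?divff ?gt_eqF//; ring.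
Qed.

(** Bound on the slopes of t |-> int f dm(t): drift and variance of a jump, integrated against a law
    with second moment at most [S], plus the interpolation error B d rho^2 <= B d h. *)
Definition C11_rate (B S : R) : R :=
  (2 * B * d%:R * C + B * (2 * C ^+ 2 * (T + 1))) * (1 + S) + B * d%:R.

(** By [piecewise_affine_increment] with c = 0 it suffices to bound the nodal increments. *)
Lemma time_lipschitz S B (f : 'rV[R]_d -> R) g : 0 <= S ->
  (forall t, 0 <= t <= T -> (\int[m t]_x (sq (x : 'rV[R]_d))%:E <= S%:E)%E) ->
  (forall x, `|f x| <= B) -> (forall x l, `|g x l| <= B) ->
  (forall x v, `|f (x + v) - f x - \sum_(l < d) g x l * v 0 l| <= B * sq v) ->
  forall s t, 0 <= s -> s <= t -> t <= T ->
  `|\int[m t]_x f x - \int[m s]_x f x| <= C11_rate B S * (t - s).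
Proof.
move=> S0 mS fB gB ft.
have B0 : 0 <= B by apply: le_trans (fB 0).
pose c := 2 * B * d%:R * C + B * (2 * C ^+ 2 * (T + 1)).
have c0 : 0 <= c.
  apply: addr_ge0; first by rewrite !mulr_ge0.
  by rewrite !mulr_ge0 ?sqr_ge0// addr_ge0// ltW.
have rate_ge0 : 0 <= C11_rate B S.
  by rewrite /C11_rate -/c addr_ge0// mulr_ge0// addr_ge0.
have cf : C11 f by exists B, g.
have bf := C11_BL cf; have mf := BL_measurable bf.
have ft' y z : `|f z - f y - \sum_(l < d) g y l * (z - y) 0 l| <= B * sq (z - y).
  by have := ft y (z - y); rewrite subrKC.
move=> s t s0 st tT.
suff slope k : (k < N)%N -> `|\int[m (tk k.+1)]_x f x - \int[m (tk k)]_x f x| <=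
    C11_rate B S * h.
  have H := @piecewise_affine_increment R (fun t => \int[m t]_x f x) h 0 (C11_rate B S) 0 T N
    h0 rate_ge0.
  have := H _ _ (lexx 0) _ s t s0 st tT; rewrite [0 * (t - s)]mul0r subr0; apply.
  - by move=> k u kN ku; exact: (cell_Rintegral T0 N0 hm kN ku fB mf).
  - by move=> k kN _ _; rewrite mul0r subr0; exact: slope.
  - by rewrite -[X in X <= _](@tknot_last R T N N0).
move=> kN.
have kT := tkT (ltnW kN).
have cb := @b_cont_x m _ kT; have cs := @s_cont_x m _ kT.
have step := scheme_step_Rintegral r0 T0 rho0 N0 hm kN cb cs (BL_continuous bf) fB B0 ft'.
set A := avg _ _ _ f in step.
have mA : measurable_fun setT (A : Borel R d -> R).
  by apply: continuous_borel; apply: avg_continuous => //; exact: BL_continuous.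
have AB x : `|A x| <= B by exact: avg_bounded.
have Ai : (m (tk k)).-integrable setT (EFin \o A) by exact: bounded_integrable mA AB.
have fi : (m (tk k)).-integrable setT (EFin \o f) by exact: bounded_integrable mf fB.
have drift : `|\int[m (tk k)]_x A x - \int[m (tk k)]_x f x| <= h * c * (1 + S).
  rewrite -RintegralB//.
  have mAf : measurable_fun setT (fun x : Borel R d => A x - f x) by exact: measurable_funB.
  have Afi : (m (tk k)).-integrable setT (EFin \o (fun x => A x - f x)).
    apply: (@bounded_integrable _ _ _ _ _ (B + B) mAf) => x.
    by rewrite (le_trans (ler_normB _ _))// lerD.
  apply: (le_trans (le_normr_Rintegral _ Afi)) => //.
  rewrite -lee_fin (EFin_Rintegral (integrable_norm Afi)).
  have hc : 0 <= h * c by rewrite mulr_ge0// ltW.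
  have n0 (x : Borel R d) : 0 <= `|A x - f x| by exact: normr_ge0.
  have mn : measurable_fun setT (fun x : Borel R d => `|A x - f x|).
    by apply: measurableT_comp => //; exact: normr_measurable.
  have H := @integral_le_cst _ _ _ (m (tk k)) _ (h * c) (h * c) S (@sq R d) n0 mn
    (@sq_ge0 _ _) msq hc hc.
  rewrite mulrDr mulr1; apply: H; last exact: mS.
  move=> x; have := @avg_C11_le R d r r0 h h0 (fun x => b m x (tk k)) (fun x => sigma m x (tk k))
    C T f B (g x) x C0 hT B0 (@growth m x _ kT) (gB x) (ft x).
  by rewrite -/c -/A => /le_trans; apply; rewrite le_eqVlt; apply/orP; left; apply/eqP; ring.
rewrite -[X in `|X|](subrKA (\int[m (tk k)]_x A x)).
apply: (le_trans (ler_normD _ _)).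
have : B * d%:R * rho ^+ 2 <= B * d%:R * h by rewrite ler_wpM2l// mulr_ge0.
by move: step drift; rewrite /C11_rate -/c; lra.
Qed.

End estimates.

(** * Compactness of curves *)

Lemma fmap_ultra (T S : Type) (f : T -> S) (U : set_system T) :
  UltraFilter U -> UltraFilter (f @ U).
Proof.
move=> UU; apply: Build_UltraFilter => G GG fUG; apply/seteqP; split => A; last exact: fUG.
move=> GA; have [//|UnA] := in_ultra_setVsetC (f @^-1` A) UU.
have GnA : G (~` A) by exact: fUG.
by have [x [Ax nAx]] := filter_ex (filterI GA GnA).
Qed.

Lemma ultra_bounded_cvg (R : realType) (U : set_system nat) (u : nat -> R) (B : R) :
  UltraFilter U -> (forall n, `|u n| <= B) -> cvg (u n @[n --> U]).
Proof.
move=> UU uB; have := @segment_compact R (- B) B; rewrite compact_ultra => cpt.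
have [|l [_ ul]] := cpt _ (fmap_ultra u UU).
  by apply: (@filterE _ U) => n; rewrite /= in_itv/= -ler_norml.
by apply/cvg_ex; exists l.
Qed.

Lemma nbhs_wass1 (R : realType) (d : nat) (x : wprob R d 1) A : nbhs x A ->
  exists2 e : R, 0 < e & forall y, (wass1 x y < e%:E)%E -> A y.
Proof.
rewrite nbhsE => -[B [oB Bx] BA]; have [e e0 h] := oB x Bx.
by exists e => // y /h /BA.
Qed.

Lemma nbhs_curve_dist (R : realType) (d : nat) (T : R) (x : curve d T) A :
  nbhs x A ->
  exists2 e : R, 0 < e & forall y, (curve_dist x y < e%:E)%E -> A y.
Proof.
rewrite nbhsE => -[B [oB Bx] BA]; have [e e0 h] := oB x Bx.
by exists e => // y /h /BA.
Qed.

Section second_moment.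
Context {R : realType} {d : nat}.

(** Truncating the coordinates gives bounded Lipschitz functions that increase to [sq]: weak limits
    apply to each of them, and monotone convergence recovers the second moment. *)
Let trunc (k : nat) (x : 'rV[R]_d) : R :=
  \sum_(l < d) Num.min `|x 0 l| k%:R ^+ 2.

Let trunc_BL k : BL (trunc k).
Proof.
have bm l : BL (fun x : 'rV[R]_d => Num.min `|x 0 l| k%:R).
  split.
    exists k%:R => x; rewrite ger0_norm ?ge_min ?lexx ?orbT// le_min normr_ge0//.
  exists 1 => x y; rewrite mul1r.
  apply: (@le_trans _ _ `| `|x 0 l| - `|y 0 l| |).
    move: `|x 0 l| `|y 0 l| => a c; rewrite ler_norml.
    have := ler_norm (a - c); have := ler_norm (c - a); rewrite [`|c - a|]distrC.
    rewrite /Num.min; case: ifPn; case: ifPn; rewrite -?leNgt => ? ? ? ?;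
      apply/andP; split; lra.
  apply: (le_trans (ler_dist_dist _ _)).
  by have := normr_coord_le (x - y) l; rewrite !mxE.
by apply: BL_sum => l; under eq_fun do rewrite expr2; exact: BLM.
Qed.

Let trunc_ge0 k x : 0 <= trunc k x.
Proof. by apply: sumr_ge0 => l _; exact: sqr_ge0. Qed.

Let trunc_le k x : trunc k x <= sq x.
Proof.
apply: ler_sum => l _; rewrite -[leRHS]real_normK ?num_real//.
by rewrite ler_pXn2r ?nnegrE// ?le_min ?normr_ge0//= ge_min lexx.
Qed.

Let trunc_nd x : nondecreasing_seq (trunc ^~ x).
Proof.
move=> i j ij; apply: ler_sum => l _.
rewrite ler_pXn2r ?nnegrE// ?le_min ?normr_ge0//=.
by rewrite !ge_min lexx/= ler_nat ij orbT.
Qed.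

Lemma second_moment_le (P : probability (Borel R d) R) (S : R) :
  (forall k, \int[P]_x trunc k x <= S) ->
  (\int[P]_x (sq (x : 'rV[R]_d))%:E <= S%:E)%E.
Proof.
move=> PS.
have mt k : measurable_fun setT (fun x : Borel R d => (trunc k x)%:E).
  by apply/measurable_EFinP; exact: BL_measurable.
have -> : (\int[P]_x (sq (x : 'rV[R]_d))%:E =
    lim (\int[P]_x (trunc k x)%:E @[k --> \oo]))%E.
  rewrite -monotone_convergence//.
  - apply: eq_integral => x _; apply/esym/cvg_lim => //.
    apply: cvg_near_cst.
    pose n := (\max_(l < d) Num.bound `|(x : 'rV[R]_d) 0%R l|%R)%N.
    exists n => // k /= nk; congr EFin; apply: eq_bigr => l _.
    rewrite min_l ?real_normK ?num_real// ltW// (lt_le_trans (archi_boundP (normr_ge0 _)))//.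
    by rewrite ler_nat (leq_trans _ nk)// /n (leq_bigmax l).
  - by move=> k x _; rewrite lee_fin.
  - by move=> x _ i j ij; rewrite lee_fin; exact: trunc_nd.
apply: lime_le.
  apply: ereal_nondecreasing_is_cvgn => i j ij; apply: ge0_le_integral => //.
  - by move=> x _; rewrite lee_fin.
  - by move=> x _; rewrite lee_fin; exact: trunc_nd.
by apply: nearW => k; rewrite -EFin_Rintegral ?lee_fin//; exact: BL_integrable.
Qed.

Lemma second_moment_lim (U : set_system nat) (P : nat -> probability (Borel R d) R)
    (Q : probability (Borel R d) R) (S : R) : ProperFilter U ->
  (\forall n \near U, (\int[P n]_x (sq (x : 'rV[R]_d))%:E <= S%:E)%E) ->
  (forall f, BL f -> \int[P n]_x f x @[n --> U] --> \int[Q]_x f x) ->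
  (\int[Q]_x (sq (x : 'rV[R]_d))%:E <= S%:E)%E.
Proof.
move=> UU PS PQ; apply: second_moment_le => k.
have ck := PQ _ (trunc_BL k); rewrite -(cvg_lim _ ck)//.
apply: limr_le; first by apply/cvg_ex; eexists; exact: ck.
apply: filterS PS => n PnS; rewrite -lee_fin EFin_Rintegral; last exact: BL_integrable.
apply: le_trans PnS; apply: ge0_le_integral => //.
- by move=> x _; rewrite lee_fin.
- by apply/measurable_EFinP; exact: BL_measurable.
- by apply/measurable_EFinP; apply: continuous_borel; exact: sq_continuous.
- by move=> x _; rewrite lee_fin.
Qed.

Lemma first_moment_lt (P : probability (Borel R d) R) (S : R) :
  (\int[P]_x (sq (x : 'rV[R]_d))%:E <= S%:E)%E ->
  (\int[P]_x (enorm (x : 'rV[R]_d) ^+ 1)%:E < +oo)%E.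
Proof.
move=> PS; apply: (@le_lt_trans _ _ (1 + 1 * S)%:E); last exact: ltry.
have msq : measurable_fun setT (@sq R d : Borel R d -> R).
  by apply: continuous_borel; exact: sq_continuous.
have msqrt : measurable_fun setT (@Num.sqrt R).
  by apply: continuous_measurable_fun; exact: sqrt_continuous.
apply: (@integral_le_cst _ _ _ P _ _ _ _ (@sq R d)) => //.
- by move=> x; rewrite expr1 enorm_ge0.
- rewrite (_ : (fun x => _) = Num.sqrt \o (@sq R d : Borel R d -> R)).
    exact: measurableT_comp.
  by apply/funext => x; rewrite /= expr1 /enorm big_ord1.
- exact: sq_ge0.
- move=> x; rewrite mul1r expr1 -enorm_sqr.
  by have := enorm_ge0 (x : 'rV[R]_d); have := sqr_ge0 (1 - enorm (x : 'rV[R]_d)); nra.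
Qed.

End second_moment.

Section weak_limit.
Context {R : realType} {d : nat}.
Context (U : set_system nat) (UU : UltraFilter U).
Context (P : nat -> probability (Borel R d) R) (S : R).
Hypothesis S0 : 0 <= S.
Hypothesis PS : \forall n \near U, (\int[P n]_x (sq (x : 'rV[R]_d))%:E <= S%:E)%E.

(** Linearity, positivity and mass 1 pass to the limit along [U], and the second moments give the
    tightness that Daniell's construction asks for. *)
Lemma ultra_weak_limit : exists Q : probability (Borel R d) R,
  forall f, BL f -> \int[P n]_x f x @[n --> U] --> \int[Q]_x f x.
Proof.
pose L (f : 'rV[R]_d -> R) := lim (\int[P n]_x f x @[n --> U]).
have PU : ProperFilter U by exact: ultra_proper.
have cL f : BL f -> \int[P n]_x f x @[n --> U] --> L f.
  move=> bf; have [[B fB] _] := bf.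
  apply: (@ultra_bounded_cvg _ _ (fun n => \int[P n]_x f x) B) => // n.
  exact: Rintegral_le_bound (BL_measurable bf) fB.
have LE f l : \int[P n]_x f x @[n --> U] --> l -> L f = l.
  by move=> fl; apply: cvg_lim.
have [Q QL] : exists Q : probability (Borel R d) R, forall f, BL f -> \int[Q]_x f x = L f.
  apply: daniell_representation.
  - move=> f g bf bg; apply: LE.
    rewrite (_ : (fun n => _) = fun n => \int[P n]_x f x + \int[P n]_x g x).
      exact: cvgD (cL _ bf) (cL _ bg).
    by apply/funext => n; rewrite RintegralD//; exact: BL_integrable.
  - move=> c f bf; apply: LE.
    rewrite (_ : (fun n => _) = fun n => c * \int[P n]_x f x).
      exact: cvgM (cvg_cst _) (cL _ bf).
    by apply/funext => n; rewrite RintegralZl//; exact: BL_integrable.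
  - move=> f bf f0; apply: limr_ge; first by apply/cvg_ex; exists (L f); exact: cL.
    by apply: nearW => n; exact: Rintegral_ge0.
  - apply: LE; rewrite (_ : (fun n => _) = fun=> 1); first exact: cvg_cst.
    by apply/funext => n; rewrite Rintegral_cstT.
  (* Chebyshev: since r >= 1, a function with values in [0, 1] that vanishes on the ball of radius r
     is at most |x|^2 / r, with integral at most S / r <= e. *)
  - move=> e e0; pose r := S / e + 1.
    have r1 : 1 <= r by rewrite lerDr divr_ge0// ltW.
    have rr : S / r <= e.
      rewrite ler_pdivrMr ?(lt_le_trans ltr01)// /r mulrDr mulrC divfK ?gt_eqF//.
      by rewrite lerDl mulr1 ltW.
    exists r => f bf f01 fr; apply: limr_le; first by apply/cvg_ex; exists (L f); exact: cL.
    apply: filterS PS => n PnS; rewrite (le_trans _ rr)//.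
    rewrite -lee_fin EFin_Rintegral; last exact: BL_integrable.
    have f0 x : 0 <= f x by case/andP: (f01 x).
    have r0 : 0 < r by exact: lt_le_trans r1.
    have := @integral_le_cst _ _ _ (P n) f r^-1 0 S (@sq R d) f0 (BL_measurable bf) (@sq_ge0 _ _).
    rewrite add0r mulrC; apply => //.
    + by apply: continuous_borel; exact: sq_continuous.
    + by rewrite invr_ge0 ltW.
    move=> x; rewrite add0r; have [xr|xr] := leP `|x : 'rV[R]_d| r.
      by rewrite fr// mulr_ge0 ?sq_ge0// invr_ge0 ltW.
    apply: (@le_trans _ _ 1); first by case/andP: (f01 x).
    rewrite mulrC ler_pdivlMr// mul1r -enorm_sqr expr2.
    have re : r <= enorm (x : 'rV[R]_d) by rewrite (le_trans (ltW xr))// norm_le_enorm.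
    by rewrite (le_trans re)// ler_peMl// ?enorm_ge0// (le_trans r1).
by exists Q => f bf; rewrite QL//; exact: cL.
Qed.

End weak_limit.

Section curve_compactness.
Context {R : realType} {d : nat} {T : R}.
Hypothesis T0 : 0 < T.
Context (m : nat -> curve d T) (S : R).
Hypothesis S0 : 0 <= S.
Hypothesis mS : \forall n \near \oo, forall t, 0 <= t <= T ->
  (\int[m n t]_x (sq (x : 'rV[R]_d))%:E <= S%:E)%E.
Hypothesis mLip : forall f : 'rV[R]_d -> R, C11 f -> exists2 K : R, 0 <= K &
  \forall n \near \oo, forall s t, 0 <= s -> s <= t -> t <= T ->
    `|\int[m n t]_x f x - \int[m n s]_x f x| <= K * (t - s).

(** A curve is a function on all of R; freezing the times outside [0, T] lets a limit law with the
    same moment bound be chosen for every real t. *)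
Let clampT (t : R) : R := Num.max 0 (Num.min T t).

Let clampT_in t : 0 <= clampT t <= T.
Proof. by rewrite /clampT le_max lexx/= ge_max ge_min lexx (ltW T0). Qed.

Let clampT_id t : 0 <= t <= T -> clampT t = t.
Proof. by move=> /andP[t0 tT]; rewrite /clampT min_r// max_r. Qed.

Lemma curve_compactness : exists mbar : curve d T, cluster (m @ \oo) mbar.
Proof.
have [U [UU ooU]] := ultraFilterLemma (eventually_filter).
have PU : ProperFilter U by exact: ultra_proper.
have mSU : \forall n \near U, forall t, 0 <= t <= T ->
    (\int[m n t]_x (sq (x : 'rV[R]_d))%:E <= S%:E)%E by exact: ooU.
have /choice[Q hQ] : forall t, exists Q : probability (Borel R d) R, forall f, BL f ->
    \int[m n (clampT t)]_x f x @[n --> U] --> \int[Q]_x f x.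
  move=> t; apply: (@ultra_weak_limit _ _ U UU (fun n => m n (clampT t)) S S0).
  by apply: filterS mSU => n; apply; exact: clampT_in.
have QS t : (\int[Q t]_x (sq (x : 'rV[R]_d))%:E <= S%:E)%E.
  apply: (@second_moment_lim _ _ U (fun n => m n (clampT t))) => //; last exact: hQ.
  by apply: filterS mSU => n; apply; exact: clampT_in.
pose q t : wprob R d 1 := WProb (first_moment_lt (QS t)).
have qlim t f : 0 <= t <= T -> BL f -> \int[m n t]_x f x @[n --> U] --> \int[q t]_x f x.
  by move=> tT bf; have := hQ t f bf; rewrite clampT_id.
have qLip (f : 'rV[R]_d -> R) : C11 f -> exists2 K : R, 0 <= K & forall s t, 0 <= s <= T -> 0 <= t <= T ->
    `|\int[q t]_x f x - \int[q s]_x f x| <= K * `|t - s|.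
  move=> cf; have [K K0 mK] := mLip cf; exists K => // s t sT tT.
  have bf := C11_BL cf.
  wlog st : s t sT tT / s <= t.
    move=> H; have [st|st] := leP s t; first exact: H.
    by rewrite distrC [`|t - s|]distrC; apply: H => //; exact: ltW.
  have c : `|\int[m n t]_x f x - \int[m n s]_x f x| @[n --> U] -->
      `|\int[q t]_x f x - \int[q s]_x f x|.
    by apply: cvg_norm; apply: cvgB; exact: qlim.
  rewrite -(cvg_lim _ c)//; apply: limr_le; first by apply/cvg_ex; eexists; exact: c.
  have ts : 0 <= t - s by rewrite subr_ge0.
  apply: filterS (ooU _ mK) => n; rewrite (ger0_norm ts); apply => //.
    by case/andP: sT.
  by case/andP: tT.
(* Convergence at finitely many knots and Lipschitz bounds common to all large n give uniformity in
   t; [M] keeps the oscillations between knots below e / 3 in total. *)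
have qunif (f : 'rV[R]_d -> R) e : C11 f -> 0 < e -> \forall n \near U, forall t, 0 <= t <= T ->
    `|\int[q t]_x f x - \int[m n t]_x f x| <= e.
  move=> cf e0; have bf := C11_BL cf.
  have [K K0 mK] := mLip cf; have [K' K'0 qK] := qLip f cf.
  pose M := (Num.bound (3 * T * (K + K') / e)).+1.
  have M0 : (0 < M)%N by [].
  have hM : (K + K') * tstep T M <= e / 3.
    have : 3 * T * (K + K') / e <= M%:R.
      rewrite (le_trans (ltW (archi_boundP _)))//; last by rewrite ler_nat.
      by rewrite divr_ge0 ?(ltW e0)// !mulr_ge0 ?addr_ge0// ltW.
    rewrite ler_pdivrMr// => h; rewrite /tstep mulrA ler_pdivrMr ?ltr0n//; lra.
  have tkT k : (k <= M)%N -> 0 <= tknot T M k <= T by exact: knot_in.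
  have grid : \forall n \near U, forall k : 'I_M,
      `|\int[q (tknot T M k)]_x f x - \int[m n (tknot T M k)]_x f x| <= e / 3.
    apply: filter_forall => k.
    have /cvgrPdist_le := qlim _ f (tkT k (ltnW (ltn_ord k))) bf.
    by apply; rewrite divr_gt0.
  apply: filterS2 grid (ooU _ mK) => n gr nK t tT.
  have [k kM /andP[kt tk]] := time_cell M0 tT.
  have kT := tkT k (ltnW kM); have [k0 kT'] := andP kT; have [t0 tT'] := andP tT.
  have h1 := nK _ _ k0 kt tT'.
  have ts : 0 <= t - tknot T M k by rewrite subr_ge0.
  have h2 := qK _ _ kT tT; rewrite (ger0_norm ts) in h2.
  have h3 := gr (Ordinal kM).
  have dt : t - tknot T M k <= tstep T M by rewrite lerBlDl -tknotS.
  have dt0 : 0 <= t - tknot T M k by rewrite subr_ge0.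
  have h4 : (K + K') * (t - tknot T M k) <= e / 3.
    by apply: le_trans hM; rewrite ler_wpM2l// addr_ge0.
  have -> : \int[q t]_x f x - \int[m n t]_x f x =
    (\int[q t]_x f x - \int[q (tknot T M k)]_x f x) +
    (\int[q (tknot T M k)]_x f x - \int[m n (tknot T M k)]_x f x) -
    (\int[m n t]_x f x - \int[m n (tknot T M k)]_x f x) by ring.
  rewrite (le_trans (ler_normB _ _))//.
  have := ler_normD (\int[q t]_x f x - \int[q (tknot T M k)]_x f x)
    (\int[q (tknot T M k)]_x f x - \int[m n (tknot T M k)]_x f x).
  rewrite /= in h3; lra.
have qcont : {within `[0, T], continuous q}.
  apply/subspace_continuousP => t; rewrite /= in_itv/= => tT A /nbhs_wass1[e e0 eA].
  have e20 : 0 < e / 2 by rewrite divr_gt0.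
  have [I [chi [delta [cchi delta0 Hchi]]]] := wass1_le_of_integrals d S0 e20.
  have near_t : \forall s \near t, forall i, 0 <= s <= T ->
      `|\int[q t]_x chi i x - \int[q s]_x chi i x| <= delta.
    apply: (@filter_forall _ I (fun i s => 0 <= s <= T ->
      `|\int[q t]_x chi i x - \int[q s]_x chi i x| <= delta) (nbhs t)) => i.
    have [K K0 qK] := qLip _ (cchi i).
    have K1 : 0 < K + 1 by rewrite ltr_wpDl.
    near=> s => sT; rewrite (le_trans (qK _ _ sT tT))//.
    apply: (@le_trans _ _ ((K + 1) * `|t - s|)); first by rewrite ler_wpM2r// lerDl.
    rewrite mulrC -ler_pdivlMr//; near: s.
    rewrite -nbhs_ballE; exists (delta / (K + 1)); first exact: divr_gt0.
    by move=> s; rewrite -ball_normE => /ltW.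
  rewrite /nbhs/= /within/=; apply: filterS near_t => s hs sT; apply: eA.
  rewrite in_itv/= in sT.
  apply: (@le_lt_trans _ _ (e / 2)%:E); last by rewrite lte_fin ltr_pdivrMr// ltr_pMr// ltr1n.
  by apply: Hchi => [||i]; [exact: QS|exact: QS|exact: hs].
(* The indices n with m n in [A] form an element of [U], so some of them also satisfy the closeness
   and moment conditions, which hold on elements of [U]. *)
pose mbar := Curve qcont; exists mbar => A B /ooU UA /nbhs_curve_dist[e e0 eB].
have e20 : 0 < e / 2 by rewrite divr_gt0.
have [I [chi [delta [cchi delta0 Hchi]]]] := wass1_le_of_integrals d S0 e20.
have close : \forall n \near U, forall i t, 0 <= t <= T ->
    `|\int[q t]_x chi i x - \int[m n t]_x chi i x| <= delta.
  by apply: filter_forall => i; exact: qunif.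
have [n [An [hn Sn]]] := filter_ex (filterI UA (filterI close mSU)).
exists (m n); split => //; apply: eB.
apply: (@le_lt_trans _ _ (e / 2)%:E); last by rewrite lte_fin ltr_pdivrMr// ltr_pMr// ltr1n.
apply: ge_ereal_sup => _ [t tT <-]; rewrite /= in_itv/= in tT.
by apply: Hchi => [||i]; [exact: QS|exact: Sn|exact: hn].
Unshelve. all: by end_near. Qed.

End curve_compactness.

(** * Taylor expansion of test functions *)

Lemma quadratic_is_derive (R : realType) (f : R -> R) (t D C : R) :
  (forall s, `|f (t + s) - f t - s * D| <= C * s ^+ 2) -> is_derive t 1 f D.
Proof.
move=> fC; have lim : h^-1 *: ((f \o shift t) (h *: 1) - f t) @[h --> 0^'] --> D.
  apply/cvgrPdist_le => e e0.
  have C0 : 0 < `|C| + 1 by rewrite ltr_wpDl.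
  near=> h; have h0 : h != 0 by near: h; exact: nbhs_dnbhs_neq.
  have hn : 0 < `|h| by rewrite normr_gt0.
  rewrite /= /GRing.scale/= mulr1 [h + t]addrC.
  rewrite (_ : D - _ = - (h^-1 * (f (t + h) - f t - h * D))); last by field.
  rewrite normrN normrM normfV ler_pdivrMl//.
  rewrite (le_trans (fC h))// -[h ^+ 2]real_normK ?num_real// expr2 mulrCA ler_wpM2l//.
  apply: (@le_trans _ _ ((`|C| + 1) * `|h|)).
    by rewrite ler_wpM2r// (le_trans (ler_norm _))// lerDl.
  rewrite mulrC -ler_pdivlMr//; near: h; apply: dnbhs0_le; exact: divr_gt0.
by apply: DeriveDef; [apply/cvg_ex; exists D|exact: cvg_lim].
Unshelve. all: by end_near. Qed.

Section coordinate_increments.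
Context {R : realType} {d : nat}.
Implicit Types g : 'rV[R]_d -> R.
Local Notation ei i := (delta_mx 0 i : 'rV[R]_d).

Lemma line_is_derive g y i s : derivable g (y + s *: ei i) (ei i) ->
  is_derive s 1 (fun s => g (y + s *: ei i)) (partial i g (y + s *: ei i)).
Proof.
move=> dg.
have E : (fun h : R => h^-1 *: (((fun s => g (y + s *: ei i)) \o shift s) (h *: 1) - g (y + s *: ei i))) =
    (fun h : R => h^-1 *: ((g \o shift (y + s *: ei i)) (h *: ei i) - g (y + s *: ei i))).
  apply/funext => h /=; congr (_ *: (g _ - _)).
  by rewrite [h *: 1]mulr1 scalerDl addrCA.
by apply: DeriveDef; [rewrite /derivable E|rewrite /derive E].
Qed.

Lemma coord_mvt g y i a : (forall x, derivable g x (ei i)) ->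
  exists2 c : R, `|c| <= `|a| &
    g (y + a *: ei i) - g y = a * partial i g (y + c *: ei i).
Proof.
move=> dg; pose psi (s : R) := g (y + s *: ei i).
have dpsi (s : R) : is_derive s (1 : R) psi (partial i g (y + s *: ei i)) by exact: line_is_derive.
have cpsi u v : {within `[u, v], continuous psi}.
  by apply: derivable_within_continuous => x _; have [] := dpsi x.
have psi0 : psi 0 = g y by rewrite /psi scale0r addr0.
have [a0|a0] := leP 0 a.
  have [c c_in cE] := MVT_segment a0 (fun x _ => dpsi x) (cpsi 0 a).
  move: c_in; rewrite in_itv/= => /andP[c0 ca]; exists c; first by rewrite !ger0_norm.
  by rewrite -/(psi a) -psi0 cE subr0 mulrC.
have [c c_in cE] := MVT_segment (ltW a0) (fun x _ => dpsi x) (cpsi a 0).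
move: c_in; rewrite in_itv/= => /andP[ca c0]; exists c.
  by rewrite !ler0_norm ?lerN2// ltW.
by rewrite -/(psi a) -psi0 -opprB cE sub0r mulrN opprK mulrC.
Qed.

Let head (v : 'rV[R]_d) (k : nat) : 'rV[R]_d :=
  \row_l (if (l < k)%N then v 0 l else 0).

(** The coordinates are changed one at a time, along the points x + [head v k], with the mean value
    theorem on each segment; only partial derivatives enter, as in [smooth]. *)
Lemma increment_mvt g x v : (forall i x, derivable g x (ei i)) ->
  exists xi : 'I_d -> 'rV[R]_d, (forall k, `|xi k| <= `|v|) /\
    g (x + v) - g x = \sum_(k < d) v 0 k * partial k g (x + xi k).
Proof.
move=> dg.
have /choice[c hc] : forall k : 'I_d, exists c : R, `|c| <= `|v 0 k| /\
    g (x + head v k + v 0 k *: ei k) - g (x + head v k) =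
    v 0 k * partial k g (x + head v k + c *: ei k).
  by move=> k; have [c h1 h2] := coord_mvt (x + head v k) (v 0 k) (dg k); exists c.
exists (fun k : 'I_d => head v k + c k *: ei k); split.
  move=> k; rewrite [leLHS]/Num.norm/= mx_normrE; apply/bigmax_leP; split => //.
  move=> [i j] _ /=; rewrite (ord1 i) !mxE eqxx/=.
  have [->|jk] := eqVneq j k.
    rewrite ltnn add0r mulr1; have [ck _] := hc k.
    exact: le_trans ck (normr_coord_le _ _).
  by rewrite mulr0 addr0; case: ifP => _; rewrite ?normr0//; exact: normr_coord_le.
have headS (k : 'I_d) : head v k.+1 = head v k + v 0 k *: ei k.
  apply/rowP => l; rewrite !mxE eqxx/=; have [->|lk] := eqVneq l k.
    by rewrite ltnSn ltnn add0r mulr1.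
  rewrite mulr0 addr0 ltnS leq_eqVlt.
  by rewrite (_ : (l == k :> nat) = false)//; apply/negbTE.
under [RHS]eq_bigr => k _.
  rewrite addrA; have [_ <-] := hc k; rewrite -addrA -headS; over.
have h0 : head v 0 = 0 by apply/rowP => l; rewrite !mxE.
have hd : head v d = v by apply/rowP => l; rewrite !mxE ltn_ord.
rewrite -(big_mkord xpredT (fun k => g (x + head v k.+1) - g (x + head v k))).
by rewrite (telescope_sumr (fun k => g (x + head v k)) (leq0n d)) h0 hd addr0.
Qed.

End coordinate_increments.

Section test_function_estimates.
Context {R : realType} {d : nat} (phi : 'rV[R]_d -> R).
Hypothesis tphi : test_function phi.
Local Notation ei i := (delta_mx 0 i : 'rV[R]_d).
Local Notation D s := (foldr partial phi s).

Let Dc s : continuous (D s). Proof. by have [+ _] := tphi => /(_ s)[]. Qed.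
Let Dd s i x : derivable (D s) x (ei i).
Proof. by have [+ _] := tphi => /(_ s)[]. Qed.

(** One radius serves for all derivatives: on the open complement of the closed support phi is
    locally zero, and so are its iterated partial derivatives. *)
Lemma test_supp : exists2 r : R, 0 <= r & forall s x, r < `|x| -> D s x = 0.
Proof.
have [_ cK] := tphi; set K := closure _ in cK.
have out s x : ~ K x -> D s x = 0.
  elim: s x => [|i s IH] x Kx.
    apply: contrapT => /eqP phix; apply: Kx; exact: subset_closure.
  rewrite /= /partial (@near_eq_derive _ _ _ _ (cst 0)) ?derive_cst//.
  have oK : open (~` K) by apply: closed_openC; exact: closed_closure.
  by apply: filterS (open_nbhs_nbhs (conj oK Kx)) => y; exact: IH.
have [M [_ hM]] := compact_bounded cK.
exists (`|M| + 1); first by rewrite addr_ge0.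
move=> s x xM; apply: out => Kx; move: xM; apply/negP; rewrite -leNgt.
by apply: (hM (`|M| + 1)) => //; rewrite (le_lt_trans (ler_norm _))// ltrDl.
Qed.

Lemma test_bounded s : exists2 B : R, 0 <= B & forall x, `|D s x| <= B.
Proof.
have [r r0 supp] := test_supp.
have ci : compact [set D s x | x in [set x | `|x| <= r]].
  apply: continuous_compact; first by apply: continuous_subspaceT; exact: Dc.
  exact: closed_ball_rV_compact.
have [M [_ hM]] := compact_bounded ci.
exists (`|M| + 1); first by rewrite addr_ge0.
move=> x; have [xr|xr] := leP `|x| r; last by rewrite supp// normr0 addr_ge0.
by apply: (hM (`|M| + 1)); [rewrite (le_lt_trans (ler_norm _))// ltrDl|exists x].
Qed.

Lemma test_lipschitz s : exists2 L : R, 0 <= L &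
  forall x y, `|D s x - D s y| <= L * enorm (x - y).
Proof.
have /choice[B hB] : forall i, exists B : R, forall x, `|partial i (D s) x| <= B.
  by move=> i; have [B _ hB] := test_bounded (i :: s); exists B.
have B0 i : 0 <= B i by apply: le_trans (hB i 0).
exists (\sum_i B i); first by apply: sumr_ge0.
move=> x y; have [xi [_ E]] := increment_mvt y (x - y) (@Dd s).
rewrite subrKC in E; rewrite E (le_trans (ler_norm_sum _ _ _))// mulr_suml.
apply: ler_sum => k _; rewrite normrM mulrC ler_pM//; exact: normr_le_enorm.
Qed.

(** The derivatives in [increment_mvt] are taken at points within |v| of x in sup norm, and they are
    Lipschitz. *)
Lemma test_taylor1 s : exists2 C : R, 0 <= C & forall x v,
  `|D s (x + v) - D s x - \sum_(k < d) v 0 k * partial k (D s) x| <= C * sq v.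
Proof.
have /choice[L hL] : forall i, exists L : R, 0 <= L /\
    forall x y, `|partial i (D s) x - partial i (D s) y| <= L * enorm (x - y).
  by move=> i; have [L L0 hL] := test_lipschitz (i :: s); exists L.
have L0 i : 0 <= L i by have [] := hL i.
exists (\sum_i L i * d%:R); first by apply: sumr_ge0 => i _; rewrite mulr_ge0.
move=> x v; have [xi [xiv E]] := increment_mvt x v (@Dd s).
rewrite E -sumrB (le_trans (ler_norm_sum _ _ _))// mulr_suml.
apply: ler_sum => k _; rewrite -mulrBr normrM -enorm_sqr expr2 mulrA mulrC.
rewrite ler_pM//; last exact: normr_le_enorm.
have [_ /(_ (x + xi k) x)] := hL k; rewrite addrAC subrr add0r => /le_trans; apply.
rewrite -mulrA ler_wpM2l// (le_trans (enorm_le_norm _))// ler_wpM2l//.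
exact: le_trans (xiv k) (norm_le_enorm _).
Qed.

Definition hess_form (x v : 'rV[R]_d) : R :=
  \sum_(i < d) \sum_(j < d) v 0 i * v 0 j * partial j (partial i phi) x.

(* Taylor's formula along the segment from x to x + v: the derivative of
   t |-> phi (x + t v) - t grad phi(x).v - t^2/2 D^2 phi(x)[v, v] is O(t^2 |v|^3). *)
Lemma test_taylor2 : exists2 C : R, 0 <= C & forall x v,
  `|phi (x + v) - phi x - \sum_(k < d) v 0 k * partial k phi x
      - 2^-1 * hess_form x v| <= C * enorm v ^+ 3.
Proof.
have [C0 C00 hC0] := test_taylor1 [::].
have /choice[C hC] : forall i, exists C : R, 0 <= C /\ forall x v,
    `|partial i phi (x + v) - partial i phi x -
      \sum_(k < d) v 0 k * partial k (partial i phi) x| <= C * sq v.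
  by move=> i; have [C ? ?] := test_taylor1 [:: i]; exists C.
have C_ge0 i : 0 <= C i by have [] := hC i.
exists (\sum_i C i); first by apply: sumr_ge0.
move=> x v; set G := \sum_(k < d) _; set Q := hess_form x v.
pose h (t : R) := phi (x + t *: v).
pose h' (t : R) := \sum_(k < d) v 0 k * partial k phi (x + t *: v).
(* This quadratic bound shows directly that [h] has derivative [h'], in place of a chain rule for
   partial derivatives. *)
have hq t s : `|h (t + s) - h t - s * h' t| <= C0 * sq v * s ^+ 2.
  have := hC0 (x + t *: v) (s *: v); rewrite /= sqZ.
  have -> : x + t *: v + s *: v = x + (t + s) *: v by rewrite scalerDl addrA.
  rewrite -/(h (t + s)) -/(h t).
  rewrite (_ : \sum_(k < d) _ = s * h' t); last first.
    by rewrite mulr_sumr; apply: eq_bigr => k _; rewrite mxE mulrA.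
  by move/le_trans; apply; rewrite -mulrA [s ^+ 2 * _]mulrC.
pose k (t : R) := h t - (t * G + t ^+ 2 * (2^-1 * Q)).
have dk (t : R) : is_derive t (1 : R) k (h' t - (G + t * Q)).
  apply: (@quadratic_is_derive _ _ _ _ (C0 * sq v + `|2^-1 * Q|)) => s.
  rewrite [X in `|X|](_ : _ = (h (t + s) - h t - s * h' t) - s ^+ 2 * (2^-1 * Q)); last first.
    by rewrite /k; field.
  rewrite (le_trans (ler_normB _ _))// mulrDl lerD//.
  by rewrite normrM ger0_norm ?sqr_ge0// mulrC.
have ck : {within `[0, 1], continuous k}.
  by apply: derivable_within_continuous => t _; have [] := dk t.
have [t t01 tE] := MVT_segment ler01 (fun t _ => dk t) ck.
move: t01; rewrite in_itv/= => /andP[t0 t1].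
have -> : phi (x + v) - phi x - G - 2^-1 * Q = h' t - (G + t * Q).
  by move: tE; rewrite /k /h scale1r scale0r addr0 subr0 mulr1 => <-; field.
rewrite /h' /G /Q /hess_form opprD addrA -sumrB mulr_sumr -sumrB.
apply: (le_trans (ler_norm_sum _ _ _)); rewrite mulr_suml; apply: ler_sum => i _.
have [_ /(_ x (t *: v))] := hC i.
rewrite [X in `|_ - _ - X|](_ : _ = t * \sum_(k < d) v 0 k * partial k (partial i phi) x); last first.
  by rewrite mulr_sumr; apply: eq_bigr => j _; rewrite mxE mulrA.
move=> hi.
rewrite [X in `|X|](_ : _ = v 0 i * (partial i phi (x + t *: v) - partial i phi x -
    t * \sum_(k < d) v 0 k * partial k (partial i phi) x)); last first.
  rewrite 2!mulrBr; congr (_ - _); rewrite mulrCA; congr (_ * _).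
  by rewrite mulr_sumr; apply: eq_bigr => j _; rewrite mulrA.
rewrite normrM exprS mulrCA ler_pM//; first exact: normr_le_enorm.
rewrite (le_trans hi)// ler_wpM2l// sqZ enorm_sqr ler_piMl ?sq_ge0//.
by rewrite exprn_ile1.
Qed.

End test_function_estimates.

(** The expression in [generator] with the coefficients as free values, so that it applies to frozen
    or truncated coefficients as well. *)
Definition second_order_form (R : realType) (d r : nat) (phi : 'rV[R]_d -> R)
    (bx : 'rV[R]_d) (sx : 'M[R]_(d, r)) (x : 'rV[R]_d) : R :=
  \sum_(i < d) bx 0 i * partial i phi x +
  2^-1 * \sum_(i < d) \sum_(j < d)
    (\sum_(k < r) sx i k * sx j k) * partial i (partial j phi) x.

Section consistency.
Context {R : realType} {d r : nat}.
Hypothesis r0 : (0 < r)%N.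
Context (b : 'rV[R]_d -> 'rV[R]_d) (sigma : 'rV[R]_d -> 'M[R]_(d, r)).
Context (h : R) (h0 : 0 < h).
Local Notation jump := (jump h b sigma).
Local Notation avg := (avg h b sigma).

(** Adding the expansions along opposite jumps cancels the terms odd in the noise. The gradient
    leaves the drift, the Hessian along the noise averages over the columns to the diffusion matrix,
    and the Hessian along the drift is the h^2 term. *)
Lemma avg_second_order (phi : 'rV[R]_d -> R) C x :
  (forall v, `|phi (x + v) - phi x - \sum_(k < d) v 0 k * partial k phi x
      - 2^-1 * hess_form phi x v| <= C * enorm v ^+ 3) ->
  `|avg phi x - phi x - h * second_order_form phi (b x) (sigma x) x| <=
    h ^+ 2 * `|2^-1 * hess_form phi x (b x)| + (2 * r%:R)^-1 *
     \sum_(l < r) (C * enorm (jump 1 l x) ^+ 3 + C * enorm (jump (-1) l x) ^+ 3).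
Proof.
move=> ht.
pose rem v := phi (x + v) - phi x - \sum_(k < d) v 0 k * partial k phi x
      - 2^-1 * hess_form phi x v.
have rR0 : 0 < r%:R :> R by rewrite ltr0n.
have sE : Num.sqrt (r%:R * h) ^+ 2 = r%:R * h by rewrite sqr_sqrtr// mulr_ge0// ltW.
have remE l : phi (x + jump 1 l x) + phi (x + jump (-1) l x) =
    rem (jump 1 l x) + rem (jump (-1) l x) +
    2 * (phi x + h * \sum_(i < d) b x 0 i * partial i phi x +
      h ^+ 2 * (2^-1 * hess_form phi x (b x))) +
    r%:R * h * \sum_(i < d) \sum_(j < d) (sigma x i l * sigma x j l) * partial j (partial i phi) x.
  have g2 : 2 * (h * \sum_(i < d) b x 0 i * partial i phi x) =
      \sum_(k < d) jump 1 l x 0 k * partial k phi x +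
      \sum_(k < d) jump (-1) l x 0 k * partial k phi x.
    rewrite -big_split/= !mulr_sumr; apply: eq_bigr => i _; rewrite !mxE; ring.
  have q2 : 2 * h ^+ 2 * hess_form phi x (b x) + 2 * (r%:R * h) * \sum_(i < d) \sum_(j < d) (sigma x i l * sigma x j l) * partial j (partial i phi) x =
      hess_form phi x (jump 1 l x) + hess_form phi x (jump (-1) l x).
    rewrite -sE /hess_form !mulr_sumr -!big_split/=; apply: eq_bigr => i _.
    rewrite !mulr_sumr -!big_split/=; apply: eq_bigr => j _; rewrite !mxE; ring.
  rewrite /rem; move: g2 q2; lra.
have -> : avg phi x - phi x - h * second_order_form phi (b x) (sigma x) x =
    h ^+ 2 * (2^-1 * hess_form phi x (b x)) +
    (2 * r%:R)^-1 * \sum_(l < r) (rem (jump 1 l x) + rem (jump (-1) l x)).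
  rewrite /avg; under eq_bigr do rewrite remE.
  rewrite big_split/= big_split/= sumr_const card_ord -mulr_sumr.
  (* The two sides differentiate in opposite orders; since sigma sigma^T is symmetric, renaming i
     and j is enough. *)
  have -> : \sum_(l < r) \sum_(i < d) \sum_(j < d) (sigma x i l * sigma x j l) * partial j (partial i phi) x =
     \sum_(i < d) \sum_(j < d) (\sum_(k < r) sigma x i k * sigma x j k) * partial i (partial j phi) x.
    rewrite exchange_big/= [RHS]exchange_big/=; apply: eq_bigr => i _.
    rewrite exchange_big/=; apply: eq_bigr => j _; rewrite mulr_suml.
    by apply: eq_bigr => l _; rewrite [sigma x i l * _]mulrC.
  rewrite /second_order_form -mulr_natl; field; rewrite gt_eqF//.
rewrite (le_trans (ler_normD _ _))// lerD//.
  by rewrite normrM ger0_norm// sqr_ge0.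
rewrite normrM ger0_norm ?invr_ge0 ?mulr_ge0// ler_wpM2l ?invr_ge0 ?mulr_ge0//.
apply: (le_trans (ler_norm_sum _ _ _)); apply: ler_sum => l _.
by rewrite (le_trans (ler_normD _ _))// lerD// ht.
Qed.

(** The square of one jump is at most the sum over all 2 r jumps, known from [sum_jump_sq]; for h <=
    1 the h^2 of its drift part is at most h. *)
Lemma jump_le e l M x : e = 1 \/ e = -1 -> h <= 1 ->
  enorm (b x) + enorm (sigma x) <= M ->
  enorm (jump e l x) <= 2 * r%:R * M * Num.sqrt h.
Proof.
move=> e1 h1 gr; have b0 := enorm_ge0 (b x); have s0 := enorm_ge0 (sigma x).
have rR1 : 1 <= r%:R :> R by rewrite ler1n.
have M0 : 0 <= M by lra.
have le1 : sq (jump e l x) <= \sum_(l < r) (sq (jump 1 l x) + sq (jump (-1) l x)).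
  apply: (@le_trans _ _ (sq (jump 1 l x) + sq (jump (-1) l x))).
    by case: e1 => ->; rewrite ?lerDl ?lerDr sq_ge0.
  rewrite (bigD1 l)//= lerDl; apply: sumr_ge0 => k _; apply: addr_ge0; exact: sq_ge0.
rewrite -(ler_pXn2r (n := 2))// ?nnegrE ?enorm_ge0 ?mulr_ge0 ?sqrtr_ge0// enorm_sqr.
apply: (le_trans le1); rewrite sum_jump_sq// -enorm_sqr.
rewrite [leRHS]exprMn [Num.sqrt h ^+ 2]sqr_sqrtr ?(ltW h0)//.
have bM : enorm (b x) ^+ 2 <= M ^+ 2.
  by rewrite ler_pXn2r ?nnegrE//; apply: le_trans gr; rewrite lerDl.
have sM : enorm (sigma x) ^+ 2 <= M ^+ 2.
  by rewrite ler_pXn2r ?nnegrE//; apply: le_trans gr; rewrite lerDr.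
have hb : h ^+ 2 * enorm (b x) ^+ 2 <= h * M ^+ 2.
  rewrite expr2 -mulrA ler_wpM2l ?(ltW h0)//.
  by apply: le_trans bM; rewrite ler_piMl ?sqr_ge0.
have hs := ler_wpM2l (ltW h0) sM.
apply: (@le_trans _ _ (2 * r%:R * (2 * (h * M ^+ 2)))).
  by rewrite ler_wpM2l ?mulr_ge0// mulr_natl mulr2n lerD.
rewrite [leLHS](_ : _ = 2 ^+ 2 * (r%:R * (M ^+ 2 * h))); last by ring.
rewrite !exprMn -!mulrA !ler_wpM2l// ler_peMl// mulrA -expr2.
by rewrite mulr_ge0 ?sqr_ge0 ?(ltW h0).
Qed.

End consistency.

Section test_consistency.
Context {R : realType} {d r : nat}.
Hypothesis r0 : (0 < r)%N.
Context (phi : 'rV[R]_d -> R).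
Hypothesis tphi : test_function phi.

Lemma hess_form_bounded : exists2 H : R, 0 <= H &
  forall x v, `|2^-1 * hess_form phi x v| <= H * enorm v ^+ 2.
Proof.
have /choice[B hB] : forall ij : 'I_d * 'I_d, exists B : R,
    forall x, `|partial ij.2 (partial ij.1 phi) x| <= B.
  by move=> ij; have [B _ hB] := test_bounded tphi [:: ij.2; ij.1]; exists B.
have B0 ij : 0 <= B ij by apply: le_trans (hB ij 0).
exists (\sum_i \sum_j B (i, j)).
  by do 2 apply: sumr_ge0 => ? _.
move=> x v; rewrite normrM [X in X * _]ger0_norm ?invr_ge0//.
apply: (@le_trans _ _ (`|hess_form phi x v|)).
  by rewrite ler_piMl// invf_le1// ler1n.
rewrite /hess_form mulr_suml (le_trans (ler_norm_sum _ _ _))//; apply: ler_sum => i _.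
rewrite mulr_suml (le_trans (ler_norm_sum _ _ _))//; apply: ler_sum => j _.
rewrite normrM mulrC ler_pM//; first exact: hB (i, j) x.
by rewrite normrM expr2 ler_pM//; exact: normr_le_enorm.
Qed.

Lemma second_order_form0 : exists2 rad : R, 0 <= rad &
  forall (bx : 'rV[R]_d) (sx : 'M[R]_(d, r)) x, rad < `|x| ->
    phi x = 0 /\ second_order_form phi bx sx x = 0.
Proof.
have [rad rad0 hr] := test_supp tphi; exists rad => // bx sx x xr.
split; first exact: hr [::] x xr.
rewrite /second_order_form !big1 ?mulr0 ?addr0// => i _.
  by rewrite big1// => j _; have /= -> := hr [:: i; j] x xr; rewrite mulr0.
by have /= -> := hr [:: i] x xr; rewrite mulr0.
Qed.

(* Far from the support of phi both sides vanish, since a step of the walk from x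
   has length O(sqrt h (1 + |x|)); elsewhere the coefficients are bounded. *)
Lemma avg_consistency (C eps : R) : 0 <= C -> 0 < eps ->
  exists2 h0 : R, 0 < h0 & forall h (b : 'rV[R]_d -> 'rV[R]_d)
    (sigma : 'rV[R]_d -> 'M[R]_(d, r)) x, 0 < h -> h <= h0 ->
    enorm (b x) + enorm (sigma x) <= C * (1 + enorm x) ->
    `|avg h b sigma phi x - phi x - h * second_order_form phi (b x) (sigma x) x|
      <= eps * h.
Proof.
move=> C0 eps0; have [rad rad0 supp] := second_order_form0.
have [C3 C30 ht] := test_taylor2 tphi; have [H H0 hH] := hess_form_bounded.
(* Bound on the coefficients where |x| <= 2 rad + 2; the factor [d] compares the Euclidean norm with
   the sup norm. *)
pose M := C * (1 + d%:R * (2 * rad + 2)).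
have M0 : 0 <= M by rewrite !mulr_ge0 ?addr_ge0 ?mulr_ge0 ?addr_ge0 ?mulr_ge0.
have rR1 : 1 <= r%:R :> R by rewrite ler1n.
pose A := H * M ^+ 2 + C3 * (2 * r%:R * M) ^+ 3.
have A0 : 0 <= A.
  apply: addr_ge0; apply: mulr_ge0 => //; first exact: sqr_ge0.
  by apply: exprn_ge0; apply: mulr_ge0 => //; exact: mulr_ge0.
pose L := 2 * (2 * r%:R * C * (1 + d%:R)).
have L0 : 0 <= L by rewrite !mulr_ge0 ?addr_ge0.
(* [c] bounds sqrt h. L c <= 1 makes a jump from x with |x| > 2 rad + 2 at most |x| / 2 long, so
   that it lands outside the support; A c <= eps controls the remainders elsewhere. *)
pose c := Num.min 1 (Num.min (eps / (A + 1)) (1 / (L + 1))).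
have c0 : 0 < c by rewrite !lt_min ltr01 !divr_gt0//; lra.
have [c1 cA cL] : [/\ c <= 1, c <= eps / (A + 1) & c <= 1 / (L + 1)].
  by split; rewrite !ge_min lexx ?orbT.
exists (c ^+ 2) => [|h b sigma x h0 hc gr]; first exact: exprn_gt0.
have q0 : 0 < Num.sqrt h by rewrite sqrtr_gt0.
have qc : Num.sqrt h <= c.
  by rewrite -[leRHS]ger0_norm ?(ltW c0)// -sqrtr_sqr ler_sqrt ?sqr_ge0.
have hE : h = Num.sqrt h ^+ 2 by rewrite sqr_sqrtr// ltW.
have h1 : h <= 1 by rewrite (le_trans hc)// exprn_ile1// ltW.
have ex := enorm_ge0 x; have exn := enorm_le_norm x.
have [xr|xr] := leP `|x| (2 * rad + 2); last first.
  have xr1 : rad < `|x| by lra.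
  have x1 : 1 <= `|x| by lra.
  have [-> ->] := supp (b x) (sigma x) x xr1.
  have jz e l : e = 1 \/ e = -1 -> phi (x + jump h b sigma e l x) = 0.
    move=> e1; suff hj : rad < `|x + jump h b sigma e l x| by have [] := supp (b x) (sigma x) _ hj.
    have := jump_le r0 h0 l e1 h1 gr.
    have := norm_le_enorm (jump h b sigma e l x).
    have := lerB_normD x (jump h b sigma e l x).
    move: (jump h b sigma e l x) => v nv ve.
    have gx : C * (1 + enorm x) <= C * ((1 + d%:R) * `|x|).
      by rewrite ler_wpM2l//; lra.
    move=> ej; suff : `|v| <= `|x| / 2 by lra.
    rewrite (le_trans ve)// (le_trans ej)//.
    apply: (@le_trans _ _ (2 * r%:R * (C * ((1 + d%:R) * `|x|)) * Num.sqrt h)).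
      by rewrite ler_wpM2r ?(ltW q0)// ler_wpM2l// mulr_ge0.
    rewrite [leLHS](_ : _ = (L * Num.sqrt h) * (`|x| / 2)); last by rewrite /L; field.
    rewrite ler_piMl//.
    apply: (@le_trans _ _ (L * (1 / (L + 1)))).
      by rewrite ler_wpM2l//; apply: le_trans cL.
    exact: ratio_le.
  rewrite /avg big1 => [|l _]; last by rewrite !jz ?addr0//; [right|left].
  by rewrite !(mulr0, subr0) normr0 mulr_ge0// ltW.
have gM : enorm (b x) + enorm (sigma x) <= M.
  apply: (le_trans gr); rewrite ler_wpM2l// lerD2l (le_trans exn)// ler_wpM2l//.
have := @avg_second_order _ _ _ r0 b sigma h h0 phi C3 x (ht x); move/le_trans; apply.
have j3 e l : e = 1 \/ e = -1 ->
    C3 * enorm (jump h b sigma e l x) ^+ 3 <= C3 * (2 * r%:R * M * Num.sqrt h) ^+ 3.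
  move=> e1; rewrite ler_wpM2l// ler_pXn2r// ?nnegrE ?enorm_ge0//.
    exact: jump_le gM.
  by do 2?apply: mulr_ge0 => //.
have hb : `|2^-1 * hess_form phi x (b x)| <= H * M ^+ 2.
  rewrite (le_trans (hH _ _))// ler_wpM2l// ler_pXn2r// ?nnegrE ?enorm_ge0//.
  by apply: le_trans gM; rewrite lerDl enorm_ge0.
apply: (@le_trans _ _ (h ^+ 2 * (H * M ^+ 2) + (2 * r%:R)^-1 *
    \sum_(l < r) (C3 * (2 * r%:R * M * Num.sqrt h) ^+ 3 + C3 * (2 * r%:R * M * Num.sqrt h) ^+ 3))).
  rewrite lerD// ?ler_wpM2l ?sqr_ge0 ?invr_ge0 ?mulr_ge0//.
  by apply: ler_sum => l _; rewrite lerD// j3//; [left|right].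
have rn0 : r%:R != 0 :> R by rewrite pnatr_eq0 -lt0n.
rewrite sumr_const card_ord -mulr_natl.
apply: (@le_trans _ _ (h * (A * Num.sqrt h))).
  rewrite [X in _ + X](_ : _ = h * (C3 * (2 * r%:R * M) ^+ 3 * Num.sqrt h)); last first.
    transitivity (Num.sqrt h ^+ 2 * (C3 * (2 * r%:R * M) ^+ 3 * Num.sqrt h)); first by field.
    by rewrite -hE.
  rewrite [X in X + _](_ : _ = h * (H * M ^+ 2 * h)); last by ring.
  rewrite -mulrDr ler_wpM2l ?(ltW h0)// /A [X in _ <= X]mulrDl lerD2r ler_wpM2l//.
    by rewrite mulr_ge0 ?sqr_ge0.
  by rewrite [leLHS]hE expr2 ler_piMl ?(ltW q0)// (le_trans qc).
rewrite mulrC ler_wpM2r ?(ltW h0)//.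
apply: (@le_trans _ _ (A * (eps / (A + 1)))).
  by rewrite ler_wpM2l//; apply: le_trans cA.
by rewrite ratio_le// ltW.
Qed.

End test_consistency.

(** * Continuity of the generator *)

Section truncation.
Context {R : realType} {d : nat} (rad : R).
Hypothesis rad0 : 0 < rad.
Implicit Types f : 'rV[R]_d -> R.

Definition truncate (x : 'rV[R]_d) : 'rV[R]_d :=
  \row_l (2 * rad * clip ((x 0 l + rad) / (2 * rad)) - rad).

Lemma truncate_le x : `|truncate x| <= rad.
Proof.
rewrite [leLHS]/Num.norm/= mx_normrE; apply/bigmax_leP; split; first exact: ltW.
move=> [i l] _ /=; rewrite (ord1 i) mxE ler_norml.
have := clip_ge0 ((x 0 l + rad) / (2 * rad)); have := clip_le1 ((x 0 l + rad) / (2 * rad)).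
by move: (clip _) rad0 => c ? ? ?; apply/andP; split; nra.
Qed.

Lemma truncate_id x : `|x| <= rad -> truncate x = x.
Proof.
move=> xr; apply/rowP => l; rewrite mxE.
have := le_trans (normr_coord_le x l) xr; rewrite ler_norml => /andP[x1 x2].
rewrite clip_id; first by field; rewrite gt_eqF.
by rewrite divr_ge0 ?ler_pdivrMr ?mulr_gt0//=; lra.
Qed.

Lemma truncate_dist x y : `|truncate x - truncate y| <= `|x - y|.
Proof.
rewrite [leLHS]/Num.norm/= mx_normrE; apply/bigmax_leP; split => //.
move=> [i l] _ /=; rewrite (ord1 i) !mxE.
apply: le_trans (normr_coord_le (x - y) l); rewrite !mxE.
rewrite opprD addrACA subrr addr0 -mulrBr normrM ger0_norm ?mulr_ge0 ?(ltW rad0)//.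
rewrite -ler_pdivlMl ?mulr_gt0//; apply: (le_trans (clip_lipschitz _ _)).
by rewrite -mulrBl opprD addrACA subrr addr0 normrM mulrC normfV [`|2 * rad|]ger0_norm// mulr_ge0// ltW.
Qed.

(** [truncate] is the projection onto a sup-norm ball and is 1-Lipschitz, so composing with it turns
    a Lipschitz bound on the ball into a global one, and boundedness comes for free. *)
Lemma BL_truncate f L :
  (forall x y, `|x| <= rad -> `|y| <= rad -> `|f x - f y| <= L * `|x - y|) ->
  BL (f \o truncate).
Proof.
move=> fL; have {}fL x y : `|x| <= rad -> `|y| <= rad -> `|f x - f y| <= `|L| * `|x - y|.
  by move=> xr yr; rewrite (le_trans (fL x y xr yr))// ler_wpM2r// ler_norm.
split; last first.
  exists `|L| => x y /=; rewrite (le_trans (fL _ _ (truncate_le _) (truncate_le _)))//.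
  by rewrite ler_wpM2l// truncate_dist.
exists (`|f 0| + `|L| * rad) => x /=; rewrite -[f (truncate x)](subrK (f 0)) addrC.
rewrite (le_trans (ler_normD _ _))// lerD2l (le_trans (fL _ _ (truncate_le _) _))//.
  by rewrite normr0 ltW.
by rewrite subr0 ler_wpM2l// truncate_le.
Qed.

End truncation.

(** The set itself is shown to be open, by the triangle inequality in R and [wass1_dual]; this
    bypasses the triangle inequality for [wass1] and the gluing of couplings. *)
Lemma wass1_weak_nbhs (R : realType) (d : nat) (f : 'rV[R]_d -> R)
    (x : wprob R d 1) (e : R) : BL f -> 0 < e ->
  nbhs x [set y : wprob R d 1 | `|\int[y]_z f z - \int[x]_z f z| < e].
Proof.
move=> bf e0; have [[B fB] [L fL]] := bf.
have L1 : 0 < `|L| + 1 by rewrite ltr_wpDl.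
have fL' y z : `|f y - f z| <= (`|L| + 1) * enorm (y - z).
  apply: (le_trans (fL y z)); apply: (@le_trans _ _ ((`|L| + 1) * `|y - z|)).
    by rewrite ler_wpM2r// (le_trans (ler_norm L))// lerDl.
  by rewrite ler_wpM2l ?(ltW L1)// norm_le_enorm.
set A := [set y : wprob R d 1 | `|\int[y]_z f z - \int[x]_z f z| < e].
suff oA : open A.
  by apply: (open_nbhs_nbhs (conj oA _)); rewrite /A/= subrr normr0.
have : dist_open (@wass1 R d) A; last by [].
move=> y Ay; pose e' := (e - `|\int[y]_z f z - \int[x]_z f z|) / 2.
have e'0 : 0 < e' by rewrite divr_gt0// subr_gt0.
exists (e' / (`|L| + 1)); first exact: divr_gt0.
move=> z /(wass1_dual (BL_measurable bf) fB (ltW L1) fL').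
rewrite mulrC divfK ?gt_eqF// distrC => h; rewrite /A/=.
rewrite -[_ - _](subrKA (\int[y]_z f z)) (le_lt_trans (ler_normD _ _))//.
by move: h e'0; rewrite /e'; lra.
Qed.

(** Openness asks for a margin common to all times, hence the set [A] with a uniform bound e' <
    e. *)
Lemma curve_weak_nbhs (R : realType) (d : nat) (T : R) (f : 'rV[R]_d -> R)
    (x : curve d T) (e : R) : BL f -> 0 < e ->
  nbhs x [set y : curve d T | forall s, s \in `[0, T] ->
    `|\int[y s]_z f z - \int[x s]_z f z| <= e].
Proof.
move=> bf e0; have [[B fB] [L fL]] := bf.
have L1 : 0 < `|L| + 1 by rewrite ltr_wpDl.
have fL' y z : `|f y - f z| <= (`|L| + 1) * enorm (y - z).
  apply: (le_trans (fL y z)); apply: (@le_trans _ _ ((`|L| + 1) * `|y - z|)).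
    by rewrite ler_wpM2r// (le_trans (ler_norm L))// lerDl.
  by rewrite ler_wpM2l ?(ltW L1)// norm_le_enorm.
set A := [set y : curve d T | exists2 e' : R, e' < e & forall s, s \in `[0, T] ->
  `|\int[y s]_z f z - \int[x s]_z f z| <= e'].
suff oA : open A.
  apply: filterS (open_nbhs_nbhs (conj oA _)) => [y [e' /ltW e'e h] s sT|].
    by apply: le_trans e'e; exact: h.
  by exists 0 => // s _; rewrite subrr normr0.
have : dist_open (@curve_dist R d T) A; last by [].
move=> y [e' e'e Ay]; pose e1 := (e - e') / 2.
have e10 : 0 < e1 by rewrite divr_gt0// subr_gt0.
exists (e1 / (`|L| + 1)); first exact: divr_gt0.
move=> z yz; exists (e' + e1); first by rewrite /e1; lra.
move=> s sT; have : (wass1 (y s) (z s) < (e1 / (`|L| + 1))%:E)%E.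
  by apply: le_lt_trans yz; apply: ereal_sup_ubound; exists s.
move/(wass1_dual (BL_measurable bf) fB (ltW L1) fL').
rewrite mulrC divfK ?gt_eqF// distrC => h; have := Ay s sT.
by rewrite -[X in _ -> `|X| <= _](subrKA (\int[y s]_z f z)) => ?; rewrite (le_trans (ler_normD _ _))// addrC lerD.
Qed.

Section generator_regularity.
Context {R : realType} {d r : nat} {T : R}.
Context (b : curve d T -> 'rV[R]_d -> R -> 'rV[R]_d).
Context (sigma : curve d T -> 'rV[R]_d -> R -> 'M[R]_(d, r)).
Hypothesis b_cont : {within [set z : curve d T * 'rV[R]_d * R | z.2 \in `[0, T]],
  continuous (fun z => b z.1.1 z.1.2 z.2)}.
Hypothesis sigma_cont : {within [set z : curve d T * 'rV[R]_d * R | z.2 \in `[0, T]],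
  continuous (fun z => sigma z.1.1 z.1.2 z.2)}.
Hypothesis loc_lip : forall (mu : curve d T) (K : set 'rV[R]_d), compact K ->
  exists2 CK : R, 0 < CK & forall x y t, K x -> K y -> t \in `[0, T] ->
    enorm (b mu y t - b mu x t) + enorm (sigma mu y t - sigma mu x t)
      <= CK * enorm (y - x).
Context (phi : 'rV[R]_d -> R).
Hypothesis tphi : test_function phi.
Local Notation G m x s := (generator b sigma m phi x s).

Lemma test_BL s : BL (foldr partial phi s).
Proof.
have [B _ hB] := test_bounded tphi s; have [L L0 hL] := test_lipschitz tphi s.
split; first by exists B.
exists (L * d%:R) => x y; rewrite (le_trans (hL _ _))// -mulrA ler_wpM2l//.
exact: enorm_le_norm.
Qed.

(** Where phi and its derivatives vanish the coefficients may be changed at will, so their argument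
    is projected onto a ball, on which they are Lipschitz; sums and products of bounded Lipschitz
    functions remain such. The radius rad + 1 is positive even if rad is 0. *)
Lemma generator_BL m s : s \in `[0, T] -> BL (fun x => G m x s).
Proof.
move=> sT; have [rad rad0 supp] := @second_order_form0 R d r phi tphi.
have rp0 : 0 < rad + 1 by lra.
have [L L0 hL] := loc_lip m (@closed_ball_rV_compact R d (rad + 1)).
have cL x y : `|x| <= rad + 1 -> `|y| <= rad + 1 ->
    enorm (b m x s - b m y s) + enorm (sigma m x s - sigma m y s) <= L * d%:R * `|x - y|.
  move=> xr yr; apply: (le_trans (hL y x s yr xr sT)).
  by rewrite -mulrA ler_wpM2l ?(ltW L0)// enorm_le_norm.
have Bb i : BL ((fun x => b m x s 0 i) \o truncate (rad + 1)).
  apply: (@BL_truncate _ _ _ rp0 _ (L * d%:R)) => x y xr yr; apply: le_trans (cL x y xr yr).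
  have := normr_le_enorm (b m x s - b m y s) 0 i; rewrite !mxE => /le_trans; apply.
  by rewrite lerDl enorm_ge0.
have Bs i k : BL ((fun x => sigma m x s i k) \o truncate (rad + 1)).
  apply: (@BL_truncate _ _ _ rp0 _ (L * d%:R)) => x y xr yr; apply: le_trans (cL x y xr yr).
  have := normr_le_enorm (sigma m x s - sigma m y s) i k; rewrite !mxE => /le_trans; apply.
  by rewrite lerDr enorm_ge0.
rewrite (_ : (fun x => _) = (fun x => second_order_form phi
    (b m (truncate (rad + 1) x) s) (sigma m (truncate (rad + 1) x) s) x)).
  rewrite /second_order_form; apply: BLD.
    by apply: BL_sum => i; apply: BLM; [exact: Bb|exact: test_BL [:: i]].
  apply: BLZ; apply: BL_sum => i; apply: BL_sum => j.
  apply: BLM; last exact: test_BL [:: i; j].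
  by apply: BL_sum => k; apply: BLM; exact: Bs.
apply/funext => x; have [xr|xr] := leP `|x| (rad + 1); first by rewrite truncate_id.
have {}xr : rad < `|x| by lra.
have [_ ->] := supp (b m (truncate (rad + 1) x) s) (sigma m (truncate (rad + 1) x) s) x xr.
by have [_] := supp (b m x s) (sigma m x s) x xr.
Qed.

Let A := [set z : curve d T * 'rV[R]_d * R | z.2 \in `[0, T]].

Lemma generator_continuous :
  {within A, continuous (fun z => G z.1.1 z.1.2 z.2)}.
Proof.
have cx s : {within A, continuous (fun z : curve d T * 'rV[R]_d * R => foldr partial phi s z.1.2)}.
  apply: continuous_subspaceT => z.
  apply: (@continuous_comp _ _ _ (fun z : curve d T * 'rV[R]_d * R => z.1.2) (foldr partial phi s)).
    apply: (@continuous_comp _ _ _ fst snd); first exact: cvg_fst.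
    exact: cvg_snd.
  by have [+ _] := tphi => /(_ s)[+ _]; exact.
have cb i : {within A, continuous (fun z : curve d T * 'rV[R]_d * R => b z.1.1 z.1.2 z.2 0 i)}.
  move=> z; apply: (@continuous_comp (subspace A) _ _ (fun z => b z.1.1 z.1.2 z.2) (fun x => x 0 i)); first exact: b_cont.
  exact: coord_continuous_rV.
have cs i k : {within A, continuous (fun z : curve d T * 'rV[R]_d * R => sigma z.1.1 z.1.2 z.2 i k)}.
  move=> z; apply: (@continuous_comp (subspace A) _ _ (fun z => sigma z.1.1 z.1.2 z.2) (fun x => x i k)); first exact: sigma_cont.
  exact: coord_continuous.
apply: continuous_addr.
  by apply: continuous_sumr => i; apply: continuous_mulr; [exact: cb|exact: cx [:: i]].
apply: continuous_mulr; first exact: continuous_cstr.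
apply: continuous_sumr => i; apply: continuous_sumr => j.
apply: continuous_mulr; last exact: cx [:: i; j].
by apply: continuous_sumr => k; apply: continuous_mulr; exact: cs.
Qed.

(** Uniformity in x comes from joint continuity and the compactness of the ball that carries phi;
    off that ball both generators vanish. *)
Lemma generator_near (m : curve d T) (s e : R) : s \in `[0, T] -> 0 < e ->
  \forall z \near (m, s), z.2 \in `[0, T] ->
    forall x, `|G z.1 x z.2 - G m x s| <= e.
Proof.
move=> sT e0; have [rad rad0 supp] := @second_order_form0 R d r phi tphi.
have := @closed_ball_rV_compact R d rad; move=> /compact_near_coveringP cov.
have := cov _ (nbhs (m, s)) (fun z x => z.2 \in `[0, T] -> `|G z.1 x z.2 - G m x s| <= e) _ _.
move/(_ (nbhs_filter (m, s))) => H; apply: filterS (H _).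
  move=> z hz zT x; have [xr|xr] := leP `|x| rad; first exact: hz.
  have [_] := supp (b m x s) (sigma m x s) x xr.
  have [_] := supp (b z.1 x z.2) (sigma z.1 x z.2) x xr.
  by rewrite /second_order_form /generator /diffusion => -> ->; rewrite subrr normr0 ltW.
move=> x _.
have e20 : 0 < e / 2 by rewrite divr_gt0.
have /subspace_continuousP/(_ (m, x, s) sT)/cvgrPdist_lt/(_ _ e20) := generator_continuous.
case=> -[U V] /= [[[U1 U2] /= [nU1 nU2] UU] nV] UV.
exists (U2, (U1 `*` V)) => /=; first by split=> //; exists (U1, V).
move=> [x' [m' s']] /= [Ux' [Um' Vs'] s'T].
have h1 : `|G m x s - G m' x' s'| < e / 2 :=
  UV ((m', x'), s') (conj (UU (m', x') (conj Um' Ux')) Vs') s'T.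
have h2 : `|G m x s - G m x' s| < e / 2 :=
  UV ((m, x'), s) (conj (UU (m, x') (conj (nbhs_singleton nU1) Ux')) (nbhs_singleton nV)) sT.
rewrite /=; move: h1 h2; move: (generator _ _ m' _ _ _) (generator _ _ m _ x' _) (generator _ _ _ _ _ _) => u v w h1 h2.
by rewrite -(subrKA w) (le_trans (ler_normD _ _))// distrC; lra.
Qed.

Definition mean_generator (m : curve d T) s := \int[m s]_x G m x s.

(** Three changes, each worth e / 3: of the integrand, uniformly in x; of the curve, with the
    integrand frozen at (m, s) and hence bounded Lipschitz; of the time, along [m]. *)
Lemma mean_generator_near (m : curve d T) (s e : R) : s \in `[0, T] -> 0 < e ->
  \forall z \near (m, s), z.2 \in `[0, T] ->
    `|mean_generator z.1 z.2 - mean_generator m s| <= e.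
Proof.
move=> sT e0; have e3 : 0 < e / 3 by rewrite divr_gt0.
have bg := generator_BL m sT.
have n1 := generator_near m sT e3.
have n2 := curve_weak_nbhs m bg e3.
have n3 : \forall s' \near s, s' \in `[0, T] ->
    `|\int[m s']_x G m x s - \int[m s]_x G m x s| < e / 3.
  have /subspace_continuousP/(_ s sT) := @curve_cont _ _ _ m.
  by move/(_ _ (wass1_weak_nbhs (m s) bg e3)).
have n23 : nbhs (m, s) [set z : curve d T * R |
    (forall s0, s0 \in `[0, T] -> `|\int[z.1 s0]_x G m x s - \int[m s0]_x G m x s| <= e / 3) /\
    (z.2 \in `[0, T] -> `|\int[m z.2]_x G m x s - \int[m s]_x G m x s| < e / 3)].
  by exists ([set y : curve d T | forall s0, s0 \in `[0, T] -> `|\int[y s0]_x G m x s - \int[m s0]_x G m x s| <= e / 3],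
    [set s' | s' \in `[0, T] -> `|\int[m s']_x G m x s - \int[m s]_x G m x s| < e / 3]).
apply: filterS (filterI n1 n23) => -[m' s'] /= [h1 [h2 h3]] s'T.
have i1 : `|mean_generator m' s' - \int[m' s']_x G m x s| <= e / 3.
  apply: Rintegral_dist_le; last exact: h1.
    by apply: BL_integrable; exact: generator_BL.
  exact: BL_integrable.
have := h2 s' s'T; have := h3 s'T => i3 i2.
rewrite -(subrKA (\int[m' s']_x G m x s)) -[X in _ + X](subrKA (\int[m s']_x G m x s)).
rewrite (le_trans (ler_normD _ _))// (@le_trans _ _ (e / 3 + (e / 3 + e / 3)))//; last by lra.
by rewrite lerD// (le_trans (ler_normD _ _))// lerD// ltW.
Qed.

Lemma mean_generator_continuous (m : curve d T) : {within `[0, T], continuous (mean_generator m)}.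
Proof.
apply/subspace_continuousP => s sT; apply/cvgrPdist_le => e e0.
have [[U V] /= [nU nV] UV] := mean_generator_near m sT e0.
apply: filterS nV => s' Vs' s'T; rewrite distrC.
exact: UV (m, s') (conj (nbhs_singleton nU) Vs') s'T.
Qed.

(** [mean_generator_near] at every s and the compactness of [0, T]; the comparison passes through
    the value at (m, s), hence e / 2. *)
Lemma mean_generator_uniform (m : curve d T) (e : R) : 0 < e ->
  \forall m' \near m, forall s, s \in `[0, T] ->
    `|mean_generator m' s - mean_generator m s| <= e.
Proof.
move=> e0; have e2 : 0 < e / 2 by rewrite divr_gt0.
have /compact_near_coveringP cov := @segment_compact R 0 T.
have := cov _ (nbhs m) (fun m' s => s \in `[0, T] ->
  `|mean_generator m' s - mean_generator m s| <= e) _ _.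
move/(_ (nbhs_filter m)) => H; apply: filterS (H _) => [m' hm s sT|s sT]; first exact: hm.
have [[U V] /= [nU nV] UV] := mean_generator_near m sT e2.
exists (V, U) => // -[s' m'] /= [Vs' Um'] s'T.
have h1 := UV (m', s') (conj Um' Vs') s'T.
have h2 := UV (m, s') (conj (nbhs_singleton nU) Vs') s'T.
move: h1 h2 => /=; move: (mean_generator m' s') (mean_generator m s') (mean_generator m s) => u v w h1 h2.
by rewrite -(subrKA w) (le_trans (ler_normD _ _))// [`|w - v|]distrC; lra.
Qed.

End generator_regularity.

(** * Identification of the limit points *)

Section slice_continuity.
Context {R : realType} {d : nat} {T : R}.

Lemma continuous_slice (X : topologicalType) (f : curve d T -> 'rV[R]_d -> R -> X) :
  {within [set z : curve d T * 'rV[R]_d * R | z.2 \in `[0, T]],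
    continuous (fun z => f z.1.1 z.1.2 z.2)} ->
  forall m t, 0 <= t <= T -> continuous (fun x => f m x t).
Proof.
move=> cf m t tT x; have tT' : t \in `[0, T] by rewrite in_itv.
have /subspace_continuousP/(_ (m, x, t) tT') := cf.
move=> h P /h [[U V] /= [[[U1 U2] /= [nU1 nU2] UU] nV] UV].
apply: filterS nU2 => y Uy.
exact: UV ((m, y), t) (conj (UU (m, y) (conj (nbhs_singleton nU1) Uy)) (nbhs_singleton nV)) tT'.
Qed.

End slice_continuity.

Section one_step.
Context {R : realType} {d r : nat} {T : R}.
Hypothesis r0 : (0 < r)%N.
Hypothesis T0 : 0 < T.
Context (b : curve d T -> 'rV[R]_d -> R -> 'rV[R]_d).
Context (sigma : curve d T -> 'rV[R]_d -> R -> 'M[R]_(d, r)).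
Hypothesis b_cont_x : forall m t, 0 <= t <= T -> continuous (fun x => b m x t).
Hypothesis s_cont_x : forall m t, 0 <= t <= T -> continuous (fun x => sigma m x t).
Context (m0 : probability (Borel R d) R) (rho : R) (N : nat).
Context (mu : 'rV[int]_d -> nat -> R) (m : curve d T).
Hypothesis rho0 : 0 < rho.
Hypothesis N0 : (0 < N)%N.
Hypothesis hm : scheme_solution b sigma m0 rho N mu m.
Local Notation h := (tstep T N).
Local Notation tk := (tknot T N).
Context (phi : 'rV[R]_d -> R).
Hypothesis tphi : test_function phi.

(** One e h pays for the interpolation, the other for the deviation of [avg] from phi + h L[m]
    phi. *)
Lemma one_step_error k e C : (k < N)%N -> 0 <= C ->
  (forall x v, `|phi (x + v) - phi x - \sum_(l < d) v 0 l * partial l phi x| <= C * sq v) ->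
  BL (fun x => generator b sigma m phi x (tk k)) ->
  (forall x, `|avg h (fun x => b m x (tk k)) (fun x => sigma m x (tk k)) phi x - phi x
     - h * generator b sigma m phi x (tk k)| <= e * h) ->
  C * d%:R * rho ^+ 2 <= e * h ->
  `|\int[m (tk k.+1)]_x phi x - \int[m (tk k)]_x phi x
     - h * mean_generator b sigma phi m (tk k)| <= 2 * e * h.
Proof.
move=> kN C0 hC Bg cons rhoh.
have tkT : 0 <= tk k <= T by apply: knot_in => //; exact: ltnW.
have Bphi : BL phi := test_BL tphi [::].
have [[B hB] _] := Bphi.
have ft y z : `|phi z - phi y - \sum_(l < d) partial l phi y * (z - y) 0 l| <= C * sq (z - y).
  by under eq_bigr do rewrite mulrC; rewrite -{1}[z](subrKC y); exact: hC.
have step := @scheme_step_Rintegral _ _ _ _ r0 T0 b sigma m0 rho N mu m rho0 N0 hm k phi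
  _ B C kN (b_cont_x (m := m) tkT) (s_cont_x (m := m) tkT) (BL_continuous Bphi) hB C0 ft.
set a := avg _ _ _ _ in step cons; set g := fun x => generator b sigma m phi x (tk k) in Bg cons *.
have ma : measurable_fun setT (a : Borel R d -> R).
  by apply: continuous_borel; apply: avg_continuous => //; [exact: b_cont_x|exact: s_cont_x|exact: BL_continuous].
have ai : (m (tk k)).-integrable setT (EFin \o a).
  by apply: (@bounded_integrable _ _ _ (m (tk k)) a B ma) => x; exact: avg_bounded.
have bg : BL (fun x => phi x + h * g x) by apply: BLD => //; exact: BLZ.
have i2 : `|\int[m (tk k)]_x a x - \int[m (tk k)]_x (phi x + h * g x)| <= e * h.
  apply: Rintegral_dist_le => //; first exact: BL_integrable.
  by move=> x; rewrite opprD addrA.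
have i3 : \int[m (tk k)]_x (phi x + h * g x) =
    \int[m (tk k)]_x phi x + h * mean_generator b sigma phi m (tk k).
  rewrite RintegralD//; [|exact: BL_integrable|by apply: BL_integrable; exact: BLZ].
  by rewrite RintegralZl//; exact: BL_integrable.
move: step i2; rewrite i3 => s1 s2.
rewrite -addrA -opprD -(subrKA (\int[m (tk k)]_x a x)) (le_trans (ler_normD _ _))//.
by rewrite -mulrA mulr_natl mulr2n lerD// (le_trans s1).
Qed.

End one_step.

Section limit_points.
Context {R : realType} {d r : nat} {T : R}.
Hypothesis r0 : (0 < r)%N.
Hypothesis T0 : 0 < T.
Context (b : curve d T -> 'rV[R]_d -> R -> 'rV[R]_d).
Context (sigma : curve d T -> 'rV[R]_d -> R -> 'M[R]_(d, r)).
Hypothesis b_cont : {within [set z : curve d T * 'rV[R]_d * R | z.2 \in `[0, T]],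
  continuous (fun z => b z.1.1 z.1.2 z.2)}.
Hypothesis sigma_cont : {within [set z : curve d T * 'rV[R]_d * R | z.2 \in `[0, T]],
  continuous (fun z => sigma z.1.1 z.1.2 z.2)}.
Context (C : R).
Hypothesis C0 : 0 <= C.
Hypothesis growth : forall m x t, 0 <= t <= T ->
  enorm (b m x t) + enorm (sigma m x t) <= C * (1 + enorm x).
Hypothesis loc_lip : forall (mu : curve d T) (K : set 'rV[R]_d), compact K ->
  exists2 CK : R, 0 < CK & forall x y t, K x -> K y -> t \in `[0, T] ->
    enorm (b mu y t - b mu x t) + enorm (sigma mu y t - sigma mu x t)
      <= CK * enorm (y - x).
Context (m0 : probability (Borel R d) R).
Context (N : nat -> nat) (rho : nat -> R).
Hypothesis N0 : forall n, (0 < N n)%N.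
Hypothesis rho0 : forall n, 0 < rho n.
Hypothesis tstep_0 : forall e, 0 < e -> \forall n \near \oo, tstep T (N n) <= e.
Hypothesis rho_0 : forall e, 0 < e -> \forall n \near \oo, rho n <= e.
Hypothesis rho_h : forall e, 0 < e ->
  \forall n \near \oo, rho n ^+ 2 <= e * tstep T (N n).
Context (mu : nat -> 'rV[int]_d -> nat -> R) (m : nat -> curve d T).
Hypothesis hm : forall n, scheme_solution b sigma m0 (rho n) (N n) (mu n) (m n).
Context (mbar : curve d T).
Hypothesis mbarP : cluster (m @ \oo) mbar.

Lemma cluster_near (P : nat -> Prop) (B : set (curve d T)) :
  (\forall n \near \oo, P n) -> nbhs mbar B -> exists n, P n /\ B (m n).
Proof.
move=> nP nB; have mP : (m @ \oo) [set m n | n in [set n | P n]].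
  by apply: filterS nP => n Pn; exists n.
by have [_ [[n Pn <-] Bn]] := mbarP mP nB; exists n.
Qed.

Context (phi : 'rV[R]_d -> R).
Hypothesis tphi : test_function phi.
Let A t := \int[mbar t]_x phi x.
Let I := mean_generator b sigma phi mbar.

(** The initial law of m^n is [m0] rounded to the grid, so on Lipschitz functions the two differ by
    O(rho n). *)
Lemma limit_initial : A 0 = \int[m0]_x phi x.
Proof.
have Bphi : BL phi := test_BL tphi [::]; have [[B hB] _] := Bphi.
have [L L0 hL] := test_lipschitz tphi [::].
apply/eqP; rewrite -subr_eq0 -normr_le0; apply/ler_addgt0Pr => e e0; rewrite add0r.
have e2 : 0 < e / 2 by rewrite divr_gt0.
have c0 : 0 < e / 2 / (L * d%:R + 1) by rewrite divr_gt0// ltr_wpDl// mulr_ge0.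
have [n [rn mn]] := cluster_near (rho_0 c0) (curve_weak_nbhs mbar Bphi e2).
have := initial_Rintegral (rho0 n) (N0 n) T0 (hm n) (BL_measurable Bphi) hB L0 hL.
have := mn 0 _; rewrite in_itv/= lexx (ltW T0) => /(_ isT); rewrite distrC => h1 h2.
rewrite -(subrKA (\int[m n 0]_x phi x)) (le_trans (ler_normD _ _))//.
suff : L * (d%:R * rho n) <= e / 2 by move: h1 h2; rewrite /A; lra.
apply: (@le_trans _ _ (L * d%:R * (e / 2 / (L * d%:R + 1)))).
  by rewrite mulrA ler_wpM2l// mulr_ge0.
by rewrite ratio_le ?mulr_ge0// ltW.
Qed.

(** For u <= v near s, t |-> int phi dm^n(t) has slopes within [e] of I s on every cell that meets
    [u, v]; its increment from u to v, and then that of [A], obeys the same bound. The index n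
    depends on the error [eta] of approximating [A], which is arbitrary, while the neighbourhood of
    s does not. *)
Lemma limit_increment s e : s \in `[0, T] -> 0 < e ->
  exists2 delta : R, 0 < delta & forall t, t \in `[0, T] -> `|t - s| <= delta ->
    `|A t - A s - I s * (t - s)| <= e * `|t - s|.
Proof.
move=> sT e0; have Bphi : BL phi := test_BL tphi [::].
have e4 : 0 < e / 4 by rewrite divr_gt0.
have [C1 C10 hC1] := test_taylor1 tphi [::].
(* The slope error [e] is made of 2 (e/4) for the one-step expansion, e/4 for passing from m^n to
   [mbar] and e/4 for moving the time to s. *)
have [h0 h00 cons] := avg_consistency r0 tphi C0 e4.
have [dl dl0 hdl] : exists2 dl : R, 0 < dl &
    forall s', s' \in `[0, T] -> `|s - s'| < dl -> `|I s' - I s| <= e / 4.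
  have /subspace_continuousP/(_ s sT)/cvgrPdist_le/(_ _ e4) :=
    mean_generator_continuous b_cont sigma_cont loc_lip tphi (m := mbar).
  by case=> dl /= dl0 hdl; exists dl => // s' s'T ss'; rewrite distrC; exact: hdl.
exists (dl / 2) => [|t tT ts]; first by rewrite divr_gt0.
suff main : forall u v, u \in `[0, T] -> v \in `[0, T] -> u <= v ->
    `|u - s| <= dl / 2 -> `|v - s| <= dl / 2 -> `|A v - A u - I s * (v - u)| <= e * (v - u).
  move: ts; have [ts|ts] := leP s t => tsd.
    by rewrite [`|t - s|]ger0_norm ?subr_ge0//; apply: main => //; rewrite subrr normr0 divr_ge0// ltW.
  rewrite [`|t - s|]ltr0_norm ?subr_lt0// -normrN [X in `|X|](_ : _ = A s - A t - I s * (s - t)); last by ring.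
  by rewrite opprB; apply: main => //; [exact: ltW|rewrite subrr normr0 divr_ge0// ltW].
move=> u v uT vT uv us vs.
apply/ler_addgt0Pr => eta eta0; have eta2 : 0 < eta / 2 by rewrite divr_gt0.
have c0 : 0 < e / 4 / (C1 * d%:R + 1) by rewrite divr_gt0// ltr_wpDl// mulr_ge0.
have dl2 : 0 < dl / 3 by rewrite divr_gt0.
have [n [[h1 [h2 h3]] [B1 B2]]] := cluster_near
  (filterI (tstep_0 h00) (filterI (tstep_0 dl2) (rho_h c0)))
  (filterI (curve_weak_nbhs mbar Bphi eta2)
    (mean_generator_uniform b_cont sigma_cont loc_lip tphi mbar e4)).
set h := tstep T (N n) in h1 h2 h3.
have hp : 0 < h by exact: tstep_gt0.
have [[B hB] _] := Bphi.
have aff k t' : (k < N n)%N -> k%:R * h <= t' <= k.+1%:R * h ->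
    \int[m n t']_x phi x = (t' - k%:R * h) / h * \int[m n (k.+1%:R * h)]_x phi x +
      (k.+1%:R * h - t') / h * \int[m n (k%:R * h)]_x phi x.
  by move=> kN kt; exact (cell_Rintegral T0 (N0 n) (hm n) kN kt hB (BL_measurable Bphi)).
move: (uT) (vT); rewrite !in_itv/= => /andP[u0 u1] /andP[v0 v1].
have NhT : (N n)%:R * h = T by exact: tknot_last (N0 n).
have slope k : (k < N n)%N -> u <= k.+1%:R * h -> k%:R * h <= v ->
    `|\int[m n (k.+1%:R * h)]_x phi x - \int[m n (k%:R * h)]_x phi x - I s * h| <= e * h.
  move=> kN uk kv.
  have kT : 0 <= k%:R * h <= T by exact: knot_in (ltnW kN).
  have kT' : k%:R * h \in `[0, T] by rewrite in_itv.
  (* A cell that meets [u, v] starts within dl/2 + h <= dl/2 + dl/3 of s. *)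
  have ks : `|s - k%:R * h| < dl.
    move: us vs uk; rewrite -[k.+1%:R]natr1 mulrDl mul1r !ler_norml ltr_norml => /andP[? ?] /andP[? ?] ?.
    by apply/andP; split; lra.
  have one := one_step_error r0 T0 (continuous_slice b_cont) (continuous_slice sigma_cont)
    (rho0 n) (N0 n) (hm n) tphi kN C10 hC1 (generator_BL loc_lip tphi (m n) kT') (e := e / 4).
  have {}one : `|\int[m n (k.+1%:R * h)]_x phi x - \int[m n (k%:R * h)]_x phi x
      - h * mean_generator b sigma phi (m n) (k%:R * h)| <= 2 * (e / 4) * h.
    apply: one => [x|].
      by apply: (cons h (fun x => b (m n) x (k%:R * h)) (fun x => sigma (m n) x (k%:R * h))) => //; exact: growth.
    have Cd : 0 <= C1 * d%:R by exact: mulr_ge0.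
    apply: (le_trans (ler_wpM2l Cd h3)); rewrite mulrA ler_wpM2r ?(ltW hp)//.
    by rewrite ratio_le// ltW.
  have i1 := B2 _ kT'; have i2 := hdl _ kT' ks.
  move: one i1 i2; rewrite -/I; move: (mean_generator _ _ _ _ _) (I _) (I s) => x y z one i1 i2.
  rewrite [X in `|X|](_ : _ = (\int[m n (k.+1%:R * h)]_x phi x - \int[m n (k%:R * h)]_x phi x
     - h * x) + h * ((x - y) + (y - z))); last by ring.
  rewrite (le_trans (ler_normD _ _))//.
  rewrite [leRHS](_ : _ = 2 * (e / 4) * h + h * (e / 4 + e / 4)); last by field.
  rewrite lerD// normrM ger0_norm ?(ltW hp)// ler_wpM2l ?(ltW hp)//.
  by rewrite (le_trans (ler_normD _ _))// lerD.
have vNh : v <= (N n)%:R * h by rewrite NhT.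
have := piecewise_affine_increment hp (ltW e0) aff slope u0 vNh (lexx u) uv (lexx v).
have := B1 u uT; have := B1 v vT; rewrite -/(A u) -/(A v).
move: (\int[m n u]_x phi x) (\int[m n v]_x phi x) => a c.
rewrite !ler_norml => /andP[? ?] /andP[? ?] /andP[? ?]; apply/andP; split; lra.
Qed.

(** Increments are kept below s and T - s in size, so that s + h stays in [0, T]. *)
Lemma limit_is_derive s : s \in `]0, T[ -> is_derive s 1 A (I s).
Proof.
move=> sT; have sT' : s \in `[0, T] by exact: subset_itv_oo_cc sT.
have lim : h^-1 *: ((A \o shift s) (h *: 1) - A s) @[h --> 0^'] --> I s.
  apply/cvgrPdist_le => e e0; have [dl dl0 hdl] := limit_increment sT' e0.
  move: (sT); rewrite in_itv/= => /andP[s0 s1].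
  have r00 : 0 < Num.min dl (Num.min s (T - s)) by rewrite !lt_min dl0 s0 subr_gt0.
  near=> h; have h0 : h != 0 by near: h; exact: nbhs_dnbhs_neq.
  have : `|h| <= Num.min dl (Num.min s (T - s)) by near: h; exact: dnbhs0_le.
  rewrite !le_min => /andP[hd /andP[hs hT]].
  have hn : 0 < `|h| by rewrite normr_gt0.
  have shE : s + h - s = h by rewrite addrAC subrr add0r.
  have := hdl (s + h) _; rewrite shE => /(_ _ hd) inc.
  rewrite /= /GRing.scale/= mulr1 [h + s]addrC.
  rewrite (_ : I s - _ = - (h^-1 * (A (s + h) - A s - I s * h))); last by field.
  rewrite normrN normrM normfV ler_pdivrMl// [`|h| * e]mulrC; apply: inc.
  by move: hs hT; rewrite in_itv/= !ler_norml => /andP[? ?] /andP[? ?]; apply/andP; split; lra.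
by apply: DeriveDef; [apply/cvg_ex; exists (I s)|exact: cvg_lim].
Unshelve. all: by end_near. Qed.

Lemma limit_continuous : {within `[0, T], continuous A}.
Proof.
apply/subspace_continuousP => s sT; apply/cvgrPdist_lt => e e0.
have /subspace_continuousP/(_ s sT) cs := @curve_cont _ _ _ mbar.
have n1 : nbhs s [set t | t \in `[0, T] -> `|A t - A s| < e].
  exact: cs _ (wass1_weak_nbhs (mbar s) (test_BL tphi [::]) e0).
by apply: filterS n1 => t h tT; rewrite distrC; exact: h.
Qed.

(** Fundamental theorem of calculus for [A], whose derivative [I] is continuous; at the ends of
    [0, t] the continuity of the curve takes the place of differentiability. *)
Lemma limit_equation t : t \in `[0, T] ->
  A t = \int[m0]_x phi x + \int[lebesgue_measure]_(s in `[0, t]) I s.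
Proof.
rewrite in_itv/= le_eqVlt => /andP[/predU1P[<- _|t0 tT]].
  by rewrite set_itv1 Rintegral_set1 addr0 limit_initial.
rewrite -limit_initial.
have sub : `[0, t] `<=` `[0, T] by apply: subset_itvl; rewrite bnd_simp.
have cI : {within `[0, t], continuous I}.
  apply: continuous_subspaceW sub _; exact: mean_generator_continuous.
have cA := continuous_subspaceW sub limit_continuous.
have [_ A0 At] := (continuous_within_itvP A t0).1 cA.
have dA : {in `]0, t[, forall s, is_derive s (1 : R) A (I s)}.
  move=> s; rewrite in_itv/= => /andP[s0 st]; apply: limit_is_derive.
  by rewrite in_itv/= s0 (lt_le_trans st).
have := continuous_FTC2 t0 cI (F := A).
rewrite /Rintegral => ->//.
- by rewrite -EFinB/= subrKC.
- by split => // s /dA[].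
- by move=> s /dA ds; rewrite derive1E; exact: derive_val.
Qed.

End limit_points.

Theorem theorem4p1 (R : realType) (d r : nat) (hd : (0 < d)%N) (hr : (0 < r)%N)
    (T : R) (hT : 0 < T) (m0 : wprob R d 2)
    (b : curve d T -> 'rV[R]_d -> R -> 'rV[R]_d)
    (sigma : curve d T -> 'rV[R]_d -> R -> 'M[R]_(d, r))
    (b_cont : {within [set z : curve d T * 'rV[R]_d * R | z.2 \in `[0, T]],
       continuous (fun z => b z.1.1 z.1.2 z.2)})
    (sigma_cont : {within [set z : curve d T * 'rV[R]_d * R | z.2 \in `[0, T]],
       continuous (fun z => sigma z.1.1 z.1.2 z.2)})
    (growth : exists2 C : R, 0 < C & forall mu x t, t \in `[0, T] ->
       enorm (b mu x t) + enorm (sigma mu x t) <= C * (1 + enorm x))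
    (loc_lip : forall (mu : curve d T) (K : set 'rV[R]_d), compact K ->
       exists2 CK : R, 0 < CK & forall x y t, K x -> K y -> t \in `[0, T] ->
         enorm (b mu y t - b mu x t) + enorm (sigma mu y t - sigma mu x t)
           <= CK * enorm (y - x))
    (N : nat -> nat) (hN : forall n, (0 < N n)%N) (N_infty : N @ \oo --> \oo)
    (rho : nat -> R) (hrho : forall n, 0 < rho n)
    (rho_0 : rho @ \oo --> 0)
    (rho_h : (fun n => rho n ^+ 2) =o_\oo (fun n => T / (N n)%:R))
    (m0_cells : forall n, null_cell_boundaries (rho n) m0)
    (mu : nat -> 'rV[int]_d -> nat -> R) (m : nat -> curve d T)
    (hm : forall n, scheme_solution b sigma m0 (rho n) (N n) (mu n) (m n)) :
  [/\ exists mbar : curve d T, cluster (m @ \oo) mbar,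
      forall mbar : curve d T, cluster (m @ \oo) mbar ->
        FPK_solution b sigma m0 mbar &
      exists mbar : curve d T, FPK_solution b sigma m0 mbar].
Proof.
have [C C_gt0 gr] := growth; have C0 := ltW C_gt0.
have {}gr mu' x t : 0 <= t <= T -> enorm (b mu' x t) + enorm (sigma mu' x t) <= C * (1 + enorm x).
  by move=> tT; apply: gr; rewrite in_itv.
have tstep0 e : 0 < e -> \forall n \near \oo, tstep T (N n) <= e.
  move=> e0; pose M := Num.bound (T / e).
  have NM : \forall n \near \oo, (M <= N n)%N := N_infty _ (nbhs_infty_ge M).
  apply: filterS NM => n Mn.
  rewrite /tstep ler_pdivrMr ?ltr0n// mulrC -ler_pdivrMr//.
  rewrite (@le_trans _ _ M%:R)// ?ler_nat// ltW// archi_boundP// ltW// divr_gt0//.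
have rho0 e : 0 < e -> \forall n \near \oo, rho n <= e.
  move=> e0; have /cvgrPdist_le/(_ _ e0) := rho_0.
  by apply: filterS => n; rewrite sub0r normrN; apply: le_trans; exact: ler_norm.
have rhoh e : 0 < e -> \forall n \near \oo, rho n ^+ 2 <= e * tstep T (N n).
  move=> e0; have /eqoP/(_ _ e0) := rho_h; apply: filterS => n.
  by rewrite ger0_norm ?sqr_ge0// ger0_norm// divr_ge0 ?(ltW hT).
have bx := continuous_slice b_cont; have sx := continuous_slice sigma_cont.
have rho1 : \forall n \near \oo, rho n ^+ 2 <= tstep T (N n).
  by apply: filterS (rhoh 1 ltr01) => n; rewrite mul1r.
have hle n : tstep T (N n) <= T.
  by rewrite ler_pdivrMr ?ltr0n// ler_peMr ?(ltW hT)// ler1n.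
(* [m0] has a finite second moment, so [fine] loses nothing. *)
pose V := fine (\int[m0]_x (sq (x : 'rV[R]_d))%:E)%E.
have V0 : 0 <= V by apply: fine_ge0; apply: integral_ge0 => x _; rewrite lee_fin sq_ge0.
have VE : (\int[m0]_x (sq (x : 'rV[R]_d))%:E = V%:E)%E.
  rewrite fineK// ge0_fin_numE; last by apply: integral_ge0 => x _; rewrite lee_fin sq_ge0.
  have := law_moment m0; congr (_ < _)%E.
  by apply: eq_integral => x _; rewrite enorm_sqr.
(* In the bound on the initial moments, (d rho)^2 <= d^2 T because rho^2 <= h <= T for large n. *)
pose S0 := 2 * V + 2 * (d%:R ^+ 2 * T).
have S00 : 0 <= S0 by rewrite addr_ge0 ?mulr_ge0 ?sqr_ge0 ?(ltW hT).
pose S := expR (@moment_rate R d T C * T) * (1 + S0).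
have S_ge0 : 0 <= S by rewrite mulr_ge0 ?expR_ge0// addr_ge0.
have mS : \forall n \near \oo, forall t, 0 <= t <= T ->
    (\int[m n t]_x (sq (x : 'rV[R]_d))%:E <= S%:E)%E.
  apply: filterS rho1 => n rn; apply: (moment_bound hr hT bx sx C0 gr (hrho n) (hN n) (hm n) rn S00).
  apply: (le_trans (initial_moment (hrho n) (hN n) hT (hm n))).
  rewrite VE -EFinM -EFinD lee_fin lerD2l ler_wpM2l// exprMn ler_wpM2l ?sqr_ge0//.
  exact: le_trans (hle n).
have [mbar hmbar] : exists mbar : curve d T, cluster (m @ \oo) mbar.
  apply: (curve_compactness hT S_ge0 mS) => f [B [g [fB gB ft]]].
  have B0 : 0 <= B by apply: le_trans (fB 0).
  exists (@C11_rate R d T C B S).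
    have T1 : 0 <= T + 1 by rewrite addr_ge0// ltW.
    apply: addr_ge0; last exact: mulr_ge0.
    apply: mulr_ge0; last exact: addr_ge0.
    by apply: addr_ge0; rewrite !mulr_ge0// sqr_ge0.
  apply: filterS (filterI rho1 mS) => n [rn Sn].
  exact: (time_lipschitz hr hT bx sx C0 gr (hrho n) (hN n) (hm n) rn S_ge0 Sn fB gB ft).
have sol (m' : curve d T) : cluster (m @ \oo) m' -> FPK_solution b sigma m0 m'.
  move=> hm' t tT phi tphi.
  exact: (limit_equation hr hT b_cont sigma_cont C0 gr loc_lip hN hrho tstep0 rho0 rhoh hm hm' tphi tT).
by split; [exists mbar|exact: sol|exists mbar; exact: sol].
Qed.
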